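(* Let $(X,d)$ be a locally compact length space, $I\subseteq\mathbb{R}$ an open interval and $f:I\to(0,\infty)$ continuous. Then the generalized cone $I\times_f X$, equipped with $(D,\ll,\le,\tau)$, is a strongly causal Lorentzian length space.
   Context: The generalized cone $Y=I\times_f X$ is the set $I\times X$ with metric $D((t,x),(t',x'))=|t-t'|+d(x,x')$. A curve $\gamma=(\alpha,\beta):J\to Y$ is causal if it is $D$-absolutely continuous (so the metric derivative $v_\beta$ exists a.e.), $\alpha$ is strictly monotone, and $-\dot\alpha^2+(f\circ\alpha)^2v_\beta^2\le0$ a.e. (timelike: $<0$ a.e.); future directed if $\dot\alpha>0$ a.e. Length: $L(\gamma)=\int\sqrt{\dot\alpha^2-(f\circ\alpha)^2v_\beta^2}$. Time separation: $\tau(y,y')=\sup\{L(\gamma):\gamma$ future directed causal from $y$ to $y'\}$, or $0$ if there is no such curve. $y\ll y'$ iff there is a future directed timelike curve from $y$ to $y'$; $y\le y'$ iff $y=y'$ or there is a future directed causal curve from $y$ to $y'$. Lorentzian pre-length space: a metric space $(Z,d)$ with a preorder $\le$, a transitive relation $\ll\subseteq\le$, and a lower semicontinuous $\tau:Z\times Z\to[0,\infty]$ satisfying $\tau(x,z)\ge\tau(x,y)+\tau(y,z)$ for $x\le y\le z$, $\tau(x,y)=0$ if $x\not\le y$, and $\tau(x,y)>0\iff x\ll y$. In it, a causal (timelike) curve is a locally Lipschitz curve, non-constant on any subinterval, with $\gamma(t_1)\le\gamma(t_2)$ ($\gamma(t_1)\ll\gamma(t_2)$) for $t_1<t_2$;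 its $\tau$-length is $L_\tau(\gamma)=\inf\sum_i\tau(\gamma(t_i),\gamma(t_{i+1}))$ over partitions. It is a Lorentzian length space (in the sense of Kunzinger–Sämann) if: it is causally path connected (for $x\ll y$ there is a future directed timelike curve from $x$ to $y$, for $x<y$ a future directed causal one); locally causally closed (every point has a neighborhood $U$ such that $x_n\to x\in\bar U$, $y_n\to y\in\bar U$, $x_n\le y_n$ imply $x\le y$); localizable (every point has an open neighborhood $\Omega$ with a bound $C$ on the $d$-length of all causal curves in $\Omega$, and a continuous $\omega:\Omega\times\Omega\to[0,\infty)$ making $\Omega$ with the restricted relations a Lorentzian pre-length space with $I^\pm(y)\cap\Omega\neq\emptyset$ for $y\in\Omega$, such that any $p<q$ in $\Omega$ are joined by a causal curve in $\Omega$ that is maximal among causal curves in $\Omega$ and has $\tau$-length $\omega(p,q)\le\tau(p,q)$); and $\tau=\mathcal{T}$, where $\mathcal{T}(x,y)=\sup\{L_\tau(\gamma):\gamma$ future directed causal from $x$ to $y\}$ (and $0$ if there is none). It is strongly causal if the topology generated by the sets $I^+(p)\cap I^-(q)$ coincides with the metric topology. *)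

(* Defs.v *)
From HB Require Import structures.
From Stdlib Require List.
From mathcomp Require Import all_boot all_order all_algebra.
From mathcomp Require Import all_classical all_reals all_analysis.
Set Implicit Arguments. Unset Strict Implicit. Unset Printing Implicit Defensive.
Import Order.TTheory GRing.Theory Num.Theory.
Import numFieldNormedType.Exports.
Local Open Scope classical_set_scope.
Local Open Scope ring_scope.

Section Metric.
Context {R : realType} {Z : Type} (d : Z -> Z -> R).

Definition is_metric : Prop :=
  (forall x y, 0 <= d x y) /\ (forall x y, d x y = 0 <-> x = y) /\
  (forall x y, d x y = d y x) /\ (forall x y z, d x z <= d x y + d y z).

Definition dball (x : Z) (r : R) : set Z := [set y | d x y < r].

Definition dopen (U : set Z) : Prop :=
  forall x, U x -> exists2 r : R, 0 < r & dball x r `<=` U.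

Definition dclosure (U : set Z) : set Z :=
  [set x | forall r : R, 0 < r -> exists2 y, U y & d x y < r].

Definition dnbhd (U : set Z) (x : Z) : Prop :=
  exists2 V, dopen V & V x /\ V `<=` U.

Definition dcompact (K : set Z) : Prop :=
  forall (I : Type) (U : I -> set Z), (forall i, dopen (U i)) ->
    K `<=` \bigcup_i U i ->
    exists s : seq I, K `<=` \bigcup_(i in [set j | Stdlib.Lists.List.In j s]) U i.

Definition dlocally_compact : Prop :=
  forall x, exists2 K, dcompact K & dnbhd K x.

Definition dconverges (u : nat -> Z) (x : Z) : Prop :=
  forall e : R, 0 < e -> exists N : nat, forall n, (N <= n)%N -> d (u n) x < e.

(* a curve c : [a,b] -> Z, given as a function on R whose values outside
   [a,b] are irrelevant *)
Definition dcont_on (a b : R) (c : R -> Z) : Prop :=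
  forall t, a <= t <= b -> forall e : R, 0 < e ->
    exists2 del : R, 0 < del & forall s, a <= s <= b -> `|s - t| < del ->
      d (c s) (c t) < e.

(* partitions a = t_0 < t_1 < ... < t_n = b, encoded by s = [:: t_1; ...; t_n] *)
Definition partition (a b : R) (s : seq R) : Prop :=
  path <%R a s /\ last a s = b.

Definition steps (a : R) (s : seq R) : seq (R * R) := zip (a :: s) s.

Definition dlength (a b : R) (c : R -> Z) : \bar R :=
  ereal_sup [set x | exists2 s, partition a b s &
     x = (\sum_(p <- steps a s) d (c p.1) (c p.2))%:E].

Definition length_space : Prop :=
  forall x y, (d x y)%:E = ereal_inf [set L | exists a b c,
     [/\ a < b, dcont_on a b c, c a = x, c b = y & L = dlength a b c]].

End Metric.

Section LpLSax.
Context {R : realType} {Z : Type} (d : Z -> Z -> R)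
  (le ll : Z -> Z -> Prop) (tau : Z -> Z -> \bar R).

Definition LpLS_axioms_on (S : set Z) : Prop :=
  [/\
      [/\ (forall x, S x -> le x x),
      (forall x y z, S x -> S y -> S z -> le x y -> le y z -> le x z),
      (forall x y z, S x -> S y -> S z -> ll x y -> ll y z -> ll x z) &
      (forall x y, S x -> S y -> ll x y -> le x y)],
      (forall x y, S x -> S y -> (0 <= tau x y)%E) &
    [/\
      (forall x y (r : R), S x -> S y -> (r%:E < tau x y)%E ->
         exists2 del : R, 0 < del & forall x' y', S x' -> S y' ->
           d x x' < del -> d y y' < del -> (r%:E < tau x' y')%E),
      (forall x y z, S x -> S y -> S z -> le x y -> le y z ->
         (tau x y + tau y z <= tau x z)%E),
      (forall x y, S x -> S y -> ~ le x y -> tau x y = 0%E) &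
      (forall x y, S x -> S y -> ((0 < tau x y)%E <-> ll x y))]].

End LpLSax.

Section Lorentz.
Context {R : realType} {Z : Type} (d : Z -> Z -> R)
  (le ll : Z -> Z -> Prop) (tau : Z -> Z -> \bar R).

Definition is_LpLS : Prop := is_metric d /\ LpLS_axioms_on d le ll tau setT.

Definition loc_lipschitz_on (a b : R) (g : R -> Z) : Prop :=
  forall t, a <= t <= b -> exists2 del : R, 0 < del & exists L : R,
    forall s s', a <= s <= b -> a <= s' <= b -> `|s - t| < del -> `|s' - t| < del ->
      d (g s) (g s') <= L * `|s - s'|.

Definition nowhere_constant_on (a b : R) (g : R -> Z) : Prop :=
  forall s s', a <= s -> s < s' -> s' <= b ->
    exists u v, [/\ s <= u <= s', s <= v <= s' & g u <> g v].

Definition causal_curve (a b : R) (g : R -> Z) : Prop :=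
  [/\ a < b, loc_lipschitz_on a b g, nowhere_constant_on a b g &
      forall t1 t2, a <= t1 -> t1 < t2 -> t2 <= b -> le (g t1) (g t2)].

Definition timelike_curve (a b : R) (g : R -> Z) : Prop :=
  [/\ a < b, loc_lipschitz_on a b g, nowhere_constant_on a b g &
      forall t1 t2, a <= t1 -> t1 < t2 -> t2 <= b -> ll (g t1) (g t2)].

Definition tau_length (a b : R) (g : R -> Z) : \bar R :=
  ereal_inf [set x | exists2 s, partition a b s &
     x = (\sum_(p <- steps a s) tau (g p.1) (g p.2))%E].

Definition causally_path_connected : Prop :=
  forall x y,
    (ll x y -> exists a b g, [/\ timelike_curve a b g, g a = x & g b = y]) /\
    (le x y -> x <> y -> exists a b g, [/\ causal_curve a b g, g a = x & g b = y]).

Definition locally_causally_closed : Prop :=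
  forall p, exists2 U, dnbhd d U p &
    forall (xs ys : nat -> Z) x y,
      (forall n, dclosure d U (xs n)) -> (forall n, dclosure d U (ys n)) ->
      dclosure d U x -> dclosure d U y ->
      dconverges d xs x -> dconverges d ys y ->
      (forall n, le (xs n) (ys n)) -> le x y.

Definition curve_in (a b : R) (g : R -> Z) (O : set Z) : Prop :=
  forall t, a <= t <= b -> O (g t).

Definition localizable : Prop :=
  forall p, exists O : set Z, [/\ dopen d O, O p,
    (exists C : R, forall a b g, causal_curve a b g -> curve_in a b g O ->
        (dlength d a b g <= C%:E)%E) &
    exists om : Z -> Z -> R, [/\
      (forall x y, O x -> O y -> 0 <= om x y),
      (forall x y, O x -> O y -> forall e : R, 0 < e ->
         exists2 del : R, 0 < del & forall x' y', O x' -> O y' ->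
           d x x' < del -> d y y' < del -> `|om x' y' - om x y| < e),
      LpLS_axioms_on d le ll (fun x y => (om x y)%:E) O,
      (forall y, O y -> (exists z, O z /\ ll y z) /\ (exists z, O z /\ ll z y)) &
      (forall x y, O x -> O y -> le x y -> x <> y ->
         exists a b g, [/\ causal_curve a b g, g a = x, g b = y, curve_in a b g O &
           [/\ (forall a' b' g', causal_curve a' b' g' -> g' a' = x -> g' b' = y ->
                  curve_in a' b' g' O -> (tau_length a' b' g' <= tau_length a b g)%E),
               tau_length a b g = (om x y)%:E &
               ((om x y)%:E <= tau x y)%E]])]].
End Lorentz.

Section LLS.
Context {R : realType} {Z : Type} (d : Z -> Z -> R)
  (le ll : Z -> Z -> Prop) (tau : Z -> Z -> \bar R).

Definition Tcal (x y : Z) : \bar R :=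
  if pselect (exists a b g, [/\ causal_curve d le a b g, g a = x & g b = y])
  then ereal_sup [set L | exists a b g,
         [/\ causal_curve d le a b g, g a = x, g b = y & L = tau_length tau a b g]]
  else 0%E.

Definition is_LLS : Prop :=
  [/\ is_LpLS d le ll tau,
      causally_path_connected d le ll,
      locally_causally_closed d le,
      localizable d le ll tau &
      (forall x y, tau x y = Tcal x y)].

Definition Ifut (p : Z) : set Z := [set z | ll p z].
Definition Ipast (q : Z) : set Z := [set z | ll z q].

(* U is open in the topology generated by the sets I^+(p) /\ I^-(q):
   U is a union of finite intersections of such sets *)
Definition Alex_open (U : set Z) : Prop :=
  forall x, U x -> exists s : seq (Z * Z),
    (forall pq, Stdlib.Lists.List.In pq s -> (Ifut pq.1 `&` Ipast pq.2) x) /\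
    (forall z, (forall pq, Stdlib.Lists.List.In pq s -> (Ifut pq.1 `&` Ipast pq.2) z) ->
       U z).

Definition strongly_causal : Prop :=
  forall U : set Z, dopen d U <-> Alex_open U.

End LLS.

Unset Implicit Arguments.
Section Cone.
Context {R : realType} {X : Type} (d : X -> X -> R) (a0 b0 : \bar R) (f : R -> R).

Definition in_I (t : R) : bool := ((a0 < t%:E)%E && (t%:E < b0)%E).

Definition cone : Type := {p : R * X | in_I p.1}.

Definition cone_dist (y y' : cone) : R :=
  `|(val y).1 - (val y').1| + d (val y).2 (val y').2.

Definition calpha (g : R -> cone) (t : R) : R := (val (g t)).1.
Definition cbeta (g : R -> cone) (t : R) : X := (val (g t)).2.

Definition D_abs_cont (a b : R) (g : R -> cone) : Prop :=
  forall e : R, 0 < e -> exists2 del : R, 0 < del &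
    forall s : seq (R * R),
      (* s = [:: (s_1,t_1); ...; (s_n,t_n)] with a <= s_1 <= t_1 <= s_2 <= ... <= t_n <= b *)
      path (fun p q : R * R => p.2 <= q.1) (a, a) s ->
      all (fun p : R * R => (p.1 <= p.2) && (p.2 <= b)) s ->
      \sum_(p <- s) (p.2 - p.1) < del ->
      \sum_(p <- s) cone_dist (g p.1) (g p.2) < e.

Definition mquot (g : R -> cone) (t : R) (h : R) : R :=
  d (cbeta g (t + h)) (cbeta g t) / `|h|.

Definition mder (g : R -> cone) (t : R) : R := lim (mquot g t @ 0^').

Definition mder_exists (g : R -> cone) (t : R) : Prop :=
  exists l : R, mquot g t @ 0^' --> l.

Definition cone_causal (a b : R) (g : R -> cone) : Prop :=
  [/\ a < b, D_abs_cont a b g,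
      (forall s t, a <= s -> s < t -> t <= b -> calpha g s < calpha g t) \/
      (forall s t, a <= s -> s < t -> t <= b -> calpha g t < calpha g s) &
      {ae lebesgue_measure, forall t, a <= t <= b ->
         [/\ derivable (calpha g) t 1, mder_exists g t &
             - (derive1 (calpha g) t) ^+ 2 + (f (calpha g t)) ^+ 2 * (mder g t) ^+ 2 <= 0]}].

Definition cone_timelike (a b : R) (g : R -> cone) : Prop :=
  [/\ a < b, D_abs_cont a b g,
      (forall s t, a <= s -> s < t -> t <= b -> calpha g s < calpha g t) \/
      (forall s t, a <= s -> s < t -> t <= b -> calpha g t < calpha g s) &
      {ae lebesgue_measure, forall t, a <= t <= b ->
         [/\ derivable (calpha g) t 1, mder_exists g t &
             - (derive1 (calpha g) t) ^+ 2 + (f (calpha g t)) ^+ 2 * (mder g t) ^+ 2 < 0]}].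

Definition future_directed (a b : R) (g : R -> cone) : Prop :=
  {ae lebesgue_measure, forall t, a <= t <= b -> 0 < derive1 (calpha g) t}.

Definition cone_length (a b : R) (g : R -> cone) : \bar R :=
  (\int[lebesgue_measure]_(t in `[a, b])
     (Num.sqrt ((derive1 (calpha g) t) ^+ 2 - (f (calpha g t)) ^+ 2 * (mder g t) ^+ 2))%:E)%E.

Definition cone_fd_causal_from_to (y y' : cone) (a b : R) (g : R -> cone) : Prop :=
  [/\ cone_causal a b g, future_directed a b g, g a = y & g b = y'].

Definition cone_tau (y y' : cone) : \bar R :=
  if pselect (exists a b g, cone_fd_causal_from_to y y' a b g)
  then ereal_sup [set L | exists a b g,
         cone_fd_causal_from_to y y' a b g /\ L = cone_length a b g]
  else 0%E.

Definition cone_ll (y y' : cone) : Prop :=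
  exists a b g, [/\ cone_timelike a b g, future_directed a b g, g a = y & g b = y'].

Definition cone_le (y y' : cone) : Prop :=
  y = y' \/ exists a b g, cone_fd_causal_from_to y y' a b g.

End Cone.

(* Main.v *)
(* With F' = 1/f, a causal curve from (t,x) to (t',x') has fibre length at most
   F t' - F t; hence the causal relation says that x and x' are joined by a curve
   B with d (B s) (B s') <= F s' - F s, and (t,x) << (t',x') that
   d x x' < F t' - F t. For l >= 0 put
     V_l' = l / (f sqrt (f^2 + l^2)),  H_l' = f / sqrt (f^2 + l^2).
   By Cauchy-Schwarz the length of a causal curve is at most
     (H_l t' - H_l t) + l (V_l t' - V_l t - d x x'),
   and graphs over almost shortest curves of X, run through with fibre speed
   proportional to V_m' for m slightly larger than l, show that this is attained
   by tau when d x x' = V_l t' - V_l t. Thus tau depends on t, t' and d x x'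
   only; the reverse triangle inequality and the continuity of tau follow from
   this duality. In a locally compact length space shortest paths exist locally:
   over them the graphs with fibre speed V_l' are maximal, because H_l is
   additive along them, and small diamonds are causally convex neighbourhoods. *)

Require Import Defs.
From HB Require Import structures.
From mathcomp Require Import all_boot all_order all_algebra.
From mathcomp Require Import all_classical all_reals all_analysis.
From mathcomp Require Import ring lra zify.
Import Order.TTheory GRing.Theory Num.Theory.
Import numFieldNormedType.Exports.
Local Open Scope classical_set_scope.
Local Open Scope ring_scope.
Set Implicit Arguments. Unset Strict Implicit. Unset Printing Implicit Defensive.

(** * Absolutely continuous functions and primitives *)

(** The number l is the Lagrange multiplier for maximising Lorentzian length at given fibre length:
    stationarity of sqrt(1 - f^2 v^2) + l v in the fibre speed v gives v = V_l', and H_l' is the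
    Lorentzian speed sqrt(1 - f^2 v^2) that remains. Two obstacles shape the proof. The space [X]
    may be incomplete, so distant points may lack a shortest path and the extremal of multiplier l
    can only be approached: global lower bounds pass through a strict inequality for some m > l, and
    exact geodesics are used near a point only. Moreover, the conditions on a causal curve hold
    almost everywhere only, and its length integrates a function that is not known to be measurable.
    The upper bounds therefore come from increments of Phi(alpha) - l d(z, beta), whose difference
    quotients are bounded below even where the distance has no derivative, and such integrals are
    compared through the simple functions below them. *)

Section RealAnalysis.
Context {R : realType}.
Implicit Types (a b t u v e : R).

(** Takes the place of a compactness argument: the points reached have a supremum [T], and the step
    at [T] leads from some point just before it to points beyond it. The radius [e] may depend on
    [T]. *)
Lemma segment_ind a b (P : R -> Prop) : a <= b -> P a ->
  (forall T, a <= T <= b -> exists2 e, 0 < e & forall u v,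
     a <= u -> T - e < u -> u <= T -> T <= v -> v < T + e -> v <= b -> P u -> P v) ->
  P b.
Proof.
move=> ab Pa step.
pose S := [set t | a <= t <= b /\ P t].
have Sa : S a by split; rewrite ?lexx ?ab.
have hS : has_sup S by split; [exists a | exists b => t [/andP[]]].
have aT : a <= sup S by apply: ub_le_sup => //; case: hS.
have Tb : sup S <= b by apply: ge_sup; [exists a | move=> t [/andP[]]].
have [e e0 He] := step (sup S) (introT andP (conj aT Tb)).
have [u [/andP[au ub] Pu] uT] := sup_adherent e0 hS.
have uS : u <= sup S by apply: ub_le_sup => //; [case: hS | split => //; rewrite au].
have [bT|Tltb] := leP b (sup S).
  by apply: (He u b) => //; lra.
pose v := Order.min b (sup S + e / 2).
have vT : sup S < v by rewrite lt_min Tltb; lra.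
have vb : v <= b by rewrite ge_min lexx.
have ve : v < sup S + e by rewrite gt_min; apply/orP; right; lra.
have Sv : S v by split; [rewrite vb andbT; lra | apply: (He u v) => //; lra].
by have := ub_le_sup (proj2 hS) Sv; lra.
Qed.

(** The cost [psi] of an interval is arbitrary, so that increments of real functions, [cone_dist]
    along a curve and plain length share one notion and can be added and compared. *)
Definition abs_cont_itv a b (psi : R -> R -> R) : Prop :=
  forall e, 0 < e -> exists2 del, 0 < del &
    forall s : seq (R * R),
      path (fun p q : R * R => p.2 <= q.1) (a, a) s ->
      all (fun p : R * R => (p.1 <= p.2) && (p.2 <= b)) s ->
      \sum_(p <- s) (p.2 - p.1) < del ->
      \sum_(p <- s) psi p.1 p.2 < e.

Definition abs_cont_on a b (phi : R -> R) : Prop :=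
  abs_cont_itv a b (fun u v => `|phi v - phi u|).

Lemma path_itv_ge a b (s : seq (R * R)) :
  path (fun p q : R * R => p.2 <= q.1) (a, a) s ->
  all (fun p : R * R => (p.1 <= p.2) && (p.2 <= b)) s ->
  {in s, forall p, [/\ a <= p.1, p.1 <= p.2 & p.2 <= b]}.
Proof.
have : a <= (a, a).2 by [].
elim: s (a, a) => [|q s IH] x ax //= /andP[xq ps] /andP[/andP[q12 qb] als] p.
rewrite inE => /orP[/eqP ->|]; first by split => //; exact: le_trans xq.
by apply: IH ps als p; apply: le_trans q12; exact: le_trans xq.
Qed.

Lemma abs_cont_itv_le a b (K : R) (psi psi' : R -> R -> R) : 0 < K ->
  (forall u v, a <= u -> u <= v -> v <= b -> psi' u v <= K * psi u v) ->
  abs_cont_itv a b psi -> abs_cont_itv a b psi'.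
Proof.
move=> K0 le AC e e0; have [del del0 H] := AC (e / K) (divr_gt0 e0 K0).
exists del => // s ps als ss; have := H s ps als ss; rewrite ltr_pdivlMr// mulrC => /(le_lt_trans _); apply.
rewrite mulr_sumr big_seq [leRHS]big_seq; apply: ler_sum => p ps'.
by have [] := path_itv_ge ps als ps' => *; apply: le.
Qed.

Lemma abs_cont_itvD a b (psi psi' : R -> R -> R) :
  abs_cont_itv a b psi -> abs_cont_itv a b psi' ->
  abs_cont_itv a b (fun u v => psi u v + psi' u v).
Proof.
move=> AC AC' e e0; have e20 : 0 < e / 2 by lra.
have [del del0 H] := AC _ e20; have [del' del'0 H'] := AC' _ e20.
exists (Order.min del del'); first by rewrite lt_min del0.
move=> s ps als; rewrite lt_min => /andP[/(H s ps als) h /(H' s ps als) h'].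
by rewrite big_split/=; lra.
Qed.

Lemma abs_cont_itv_id a b : abs_cont_itv a b (fun u v => v - u).
Proof. by move=> e e0; exists e. Qed.

Lemma abs_cont_itvS a b a' b' (psi : R -> R -> R) : a <= a' -> b' <= b ->
  abs_cont_itv a b psi -> abs_cont_itv a' b' psi.
Proof.
move=> aa' bb' AC e e0; have [del del0 H] := AC e e0; exists del => // s ps als; apply: H.
  by case: s ps {als} => //= p s /andP[a'p ->]; rewrite andbT; exact: le_trans a'p.
by apply: sub_all als => p /andP[-> /= ?]; exact: le_trans bb'.
Qed.

Local Notation mu := (@lebesgue_measure R).

(* Cover the exceptional null set by an open set of small measure: along a chain
   of intervals from [a] to [b], those meeting the null set contribute little by
   absolute continuity, the others almost do not decrease [phi]. *)
Lemma ae_nondecreasing a b (phi : R -> R) : a <= b -> abs_cont_on a b phi ->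
  {ae mu, forall t, a <= t <= b -> forall e, 0 < e ->
     \forall h \near 0^', - e <= h^-1 * (phi (t + h) - phi t)} ->
  phi a <= phi b.
Proof.
move=> ab AC [N [mN N0' HN]].
have N0 : mu N = 0%E := N0'.
suff H e : 0 < e -> - e * (b - a) - e <= phi b - phi a.
  apply/ler_addgt0Pl => e e0.
  have b1 : 0 < b - a + 1 by lra.
  have := H (e / (b - a + 1)) (divr_gt0 e0 b1).
  have -> : - (e / (b - a + 1)) * (b - a) - e / (b - a + 1) = - e.
    by field; lra.
  lra.
move=> e0.
have [del del0 Hdel] := AC e e0.
have muN : (mu N < +oo)%E by rewrite N0.
have [W [oW NW mW]] := lebesgue_regularity_outer mN muN del0.
have mesW : measurable W by exact: measurable_realfun.open_measurable.
have muW : (mu W < del%:E)%E.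
  have : mu ((W `\` N) `|` N) = mu (W `\` N).
    by apply: measureU0 => //; exact: measurableD.
  by rewrite setUC setDUK// => ->.
(* The total length of the chain is charged to the part of [W] before [t]; with half-open intervals,
   adjoining [u, v[ is a disjoint union. *)
pose C t := exists s : seq (R * R),
  [/\ path (fun p q : R * R => p.2 <= q.1) (a, a) s,
      all (fun p : R * R => (p.1 <= p.2) && (p.2 <= t)) s,
      (last (a, a) s).2 <= t,
      ((\sum_(p <- s) (p.2 - p.1))%:E <= mu (W `&` `[a, t[))%E &
      - e * (t - a) - \sum_(p <- s) `|phi p.2 - phi p.1| <= phi t - phi a].
suff [s [ps als _ sumW lower]] : C b.
  suff : \sum_(p <- s) `|phi p.2 - phi p.1| < e by move=> ?; lra.
  apply: Hdel => //; rewrite -lte_fin; apply: le_lt_trans muW.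
  apply: le_trans sumW _; apply: le_measure; rewrite ?inE//.
  exact: measurableI.
apply: (@segment_ind a b C ab).
  exists [::]; split => //=; rewrite !big_nil; first exact: measure_ge0.
  by rewrite !subrr mulr0 subr0.
move=> T aTb; have [WT|NT] := pselect (N T).
  have /nbhs_ballP[r /= r0 Hr] : nbhs T W by apply: open_nbhs_nbhs; split => //; exact: NW.
  exists r => // u v au Tu uT Tv vT vb [s [ps als lasts sumW lower]].
  exists (rcons s (u, v)).
  have subW : `[u, v[ `<=` W.
    move=> x /=; rewrite in_itv/= => /andP[ux xv]; apply: Hr => /=.
    by rewrite /ball/= ltr_norml; clear -Tu uT ux xv Tv vT; apply/andP; split; lra.
  have WE : W `&` `[a, v[ = (W `&` `[a, u[) `|` `[u, v[.
    apply/seteqP; split => x /=; rewrite !in_itv/=.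
      move=> [Wx /andP[ax xv]]; have [ux|xu] := leP u x; [by right|left; split => //].
      by rewrite ax.
    move=> [[Wx /andP[ax xu]]|/andP[ux xv]]; split => //.
    - by clear -ax xu uT Tv; apply/andP; split; lra.
    - by apply: subW; rewrite /= in_itv/= ux.
    - by clear -au ux xv; apply/andP; split; lra.
  split.
  - by rewrite rcons_path ps.
  - rewrite all_rcons /= lexx andbT; apply/andP; split; first by clear -uT Tv; lra.
    by apply: sub_all als => p /andP[-> /= pu]; clear -uT Tv pu; lra.
  - by rewrite last_rcons.
  - have -> : mu (W `&` `[a, v[) = (mu (W `&` `[a, u[) + mu `[u, v[)%E.
      rewrite WE; apply: measureU => //; first exact: measurableI.
      apply/seteqP; split => x //=; rewrite !in_itv/= => -[[_ /andP[_ xu]] /andP[ux _]].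
      lra.
    have -> : mu `[u, v[ = (v - u)%:E.
      rewrite lebesgue_measure_itv/= lte_fin.
      by case: ltP => // vu; congr EFin; clear -uT Tv vu; lra.
    by rewrite big_rcons/= EFinD leeD2r.
  - rewrite big_rcons/=; have := ler_norm (phi u - phi v); rewrite distrC.
    have : 0 <= e * (v - u) by apply: mulr_ge0; [exact: ltW|clear -uT Tv; lra].
    lra.
have {}NT : forall e0, 0 < e0 -> \forall h \near 0^', - e0 <= h^-1 * (phi (T + h) - phi T).
  by apply: contrapT => H; apply: NT; apply: HN => H'; apply: H => e1 e10; exact: H'.
have /nbhs_ballP[r /= r0 Hr] := NT e e0.
have low h : h != 0 -> `|h| < r -> - e <= h^-1 * (phi (T + h) - phi T).
  by move=> h0 hr; apply: Hr => //; rewrite /ball/= sub0r normrN.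
exists r => // u v au Tu uT Tv vT vb [s [ps als lasts sumW lower]].
have uT' : phi u - phi T <= e * (T - u).
  have [->|nTu] := eqVneq u T; first by rewrite !subrr mulr0.
  have := low (u - T); rewrite subr_eq0 nTu [T + _]addrC subrK => /(_ isT).
  rewrite ler0_norm; last by clear -uT; lra.
  have uT0 : 0 < T - u by rewrite subr_gt0 lt_neqAle nTu.
  have rTu : - (u - T) < r by clear -Tu; lra.
  move=> /(_ rTu); rewrite -[X in X^-1]opprB invrN mulNr lerN2 ler_pdivrMl//.
  by rewrite mulrC.
have vT' : - e * (v - T) <= phi v - phi T.
  have [->|nTv] := eqVneq v T; first by rewrite !subrr mulr0.
  have := low (v - T); rewrite subr_eq0 nTv [T + _]addrC subrK => /(_ isT).
  rewrite ger0_norm; last by clear -Tv; lra.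
  have vT0 : 0 < v - T by rewrite subr_gt0 lt_neqAle eq_sym nTv.
  have rvT : v - T < r by clear -vT; lra.
  by move=> /(_ rvT); rewrite ler_pdivlMl// mulrC.
exists s; split => //.
- by apply: sub_all als => p /andP[-> /= pu]; clear -pu uT Tv; lra.
- by clear -lasts uT Tv; lra.
- apply: le_trans sumW _; apply: le_measure; rewrite ?inE//; try exact: measurableI.
  by apply: setIS => x /=; rewrite !in_itv/= => /andP[-> /= xu]; clear -xu uT Tv; lra.
- by clear -lower uT' vT'; lra.
Qed.

(* One of the two integrals is always over a null set, so [prim t0 phi] is the
   oriented integral of [phi] from [t0]. *)
Definition prim (t0 : R) (phi : R -> R) (t : R) : R :=
  \int[mu]_(x in `[t0, t]) phi x - \int[mu]_(x in `[t, t0]) phi x.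

(** The fundamental theorem is applied to the integral from [u], which lies strictly left of both
    [t0] and [t]; on [u, w] [prim] differs from it by a constant. *)
Lemma is_derive_prim (u w t0 : R) (phi : R -> R) :
  u < t0 < w -> {in `[u, w], continuous phi} ->
  forall t, u < t < w -> is_derive t 1 (prim t0 phi) (phi t).
Proof.
move=> /andP[ut0 t0w] cphi t /andP[ut tw].
have cphi' x y : u <= x -> y <= w -> {within `[x, y], continuous phi}.
  move=> ux yw; apply: continuous_in_subspaceT => z; rewrite inE/= in_itv/= => /andP[xz zy].
  by apply: cphi; rewrite in_itv/=; apply/andP; split; lra.
have intphi x y : u <= x -> y <= w -> mu.-integrable `[x, y] (EFin \o phi).
  by move=> ux yw; apply: continuous_compact_integrable; [exact: segment_compact|exact: cphi'].
pose G x := \int[mu]_(z in `[u, x]) phi z.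
have split3 x y : u <= x -> x <= y -> y <= w -> \int[mu]_(z in `[x, y]) phi z = G y - G x.
  move=> ux xy yw; have := @Rintegral_itvB R phi (BLeft u) (BRight y) x.
  rewrite !bnd_simp => /(_ (intphi u y (lexx _) yw) ux xy) ->.
  rewrite Rintegral_itv_obnd_cbnd//; apply: integrableS (intphi x y ux yw) => //.
  by apply: subset_itvr; rewrite bnd_simp.
have primE x : u <= x <= w -> prim t0 phi x = G x - G t0.
  move=> /andP[ux xw]; rewrite /prim; have [t0x|xt0] := leP t0 x.
    rewrite split3//; last lra.
    have -> : \int[mu]_(z in `[x, t0]) phi z = 0.
      move: t0x; rewrite le_eqVlt => /orP[/eqP ->|t0x].
        by rewrite set_itv1 Rintegral_set1.
      by rewrite set_itv_ge ?Rintegral_set0// bnd_simp -ltNge.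
    by rewrite subr0.
  rewrite [X in _ - X]split3//; try lra.
  by rewrite set_itv_ge ?Rintegral_set0 ?bnd_simp -?ltNge//; lra.
have [dG G't] : derivable G t 1 /\ derive1 G t = phi t.
  apply: (@continuous_FTC1 R phi (BLeft u) t w) => //.
  - exact: intphi.
  - by apply: cphi; rewrite in_itv/= !ltW.
have dG' : is_derive t 1 G (phi t).
  by rewrite -G't derive1E; exact: derivableP.
have near_eq : \forall x \near t, prim t0 phi x = G x - G t0.
  have : \forall x \near t, x \in `]u, w[ by apply: near_in_itvoo; rewrite in_itv/= ut.
  apply: filterS => x; rewrite in_itv/= => /andP[ux xw]; apply: primE.
  by rewrite !ltW.
have : is_derive t 1 (fun x => G x - G t0) (phi t).
  rewrite -[X in is_derive _ _ _ X]subr0; apply: is_deriveB.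
apply: near_eq_is_derive.
by apply: filterS near_eq => x ->.
Qed.


End RealAnalysis.

Section RealAnalysis2.
Import HBNNSimple.
Context {R : realType}.
Implicit Types (a b t u v e : R).
Local Notation mu := (@lebesgue_measure R).

Lemma derivable_quot (F : R -> R) t : derivable F t 1 ->
  (fun h => h^-1 * (F (t + h) - F t)) @ 0^' --> derive1 F t.
Proof.
move=> dF; have : (fun h => h^-1 *: ((F \o shift t) (h *: 1) - F t)) @ 0^' --> derive1 F t.
  by rewrite derive1E; exact: dF.
rewrite (_ : (fun h => h^-1 * _) = (fun h => h^-1 *: ((F \o shift t) (h *: 1) - F t)))//.
by apply/funext => h /=; rewrite [h *: 1]mulr1 [h + t]addrC.
Qed.

(* [g] need not be measurable: its integral is a supremum over simple functions
   below it, and the primitives of those are differentiable almost everywhere. *)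
Lemma ae_integral_le_increment a b (g phi : R -> R) : a < b ->
  (forall t, a <= t <= b -> 0 <= g t) -> abs_cont_on a b phi ->
  {ae mu, forall t, a <= t <= b -> forall e, 0 < e ->
     \forall h \near 0^', g t - e <= h^-1 * (phi (t + h) - phi t)} ->
  (\int[mu]_(t in `[a, b]) (g t)%:E <= (phi b - phi a)%:E)%E.
Proof.
move=> ab g0 AC aeg.
rewrite integral_mkcond ge0_integralTE; last first.
  by move=> x; rewrite patchE; case: ifPn => //; rewrite inE/= in_itv/= lee_fin; exact: g0.
apply: ge_ereal_sup => _ [h /= hg <-].
have hab t : a <= t <= b -> h t <= g t.
  by move=> abt; have := hg t; rewrite patchE mem_set ?lee_fin//= in_itv.
have h0 t : ~ (a <= t <= b) -> h t = 0.
  move=> abt; apply/eqP; rewrite eq_le fun_ge0 andbT.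
  by have := hg t; rewrite patchE memNset ?lee_fin//= in_itv.
have [M [_ HM]] := simple_bounded h.
have M1 : M < `|M| + 1 by rewrite ltr_pwDr// ler_norm.
have hM t : `|h t| <= `|M| + 1 by apply: (HM _ M1).
have inth x y : mu.-integrable `[x, y] (EFin \o h).
  apply: measurable_bounded_integrable => //.
  - by rewrite /= lebesgue_measure_itv/=; case: ifP => _; rewrite ?ltry.
  - exact: measurable_funTS.
  - exists (`|M|); split; first exact: num_real.
    by move=> x0 Mx0 z _; apply: (HM _ (le_lt_trans (ler_norm M) Mx0)).
have loch : locally_integrable setT h.
  apply: open_integrable_locally; first exact: openT.
  rewrite (_ : EFin \o h = (EFin \o h) \_ `[a, b]).
    by rewrite -integrable_mkcond.
  apply/funext => x; rewrite patchE; case: ifPn => // /negP; rewrite inE/= in_itv/= => /h0.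
  by rewrite /= => ->.
pose S x := \int[mu]_(t in `[a, x]) h t.
have aeS := @FTC1 R h (BLeft a) (fun y => inth a y) loch.
have SB u v : a <= u -> u <= v -> S v - S u = \int[mu]_(t in `]u, v]) h t.
  move=> au uv; rewrite /S Rintegral_itvB ?bnd_simp//; exact: inth.
have Slip u v : a <= u -> u <= v -> `|S v - S u| <= (`|M| + 1) * (v - u).
  move=> au uv; rewrite SB//.
  have inth' : mu.-integrable `]u, v] (EFin \o h).
    by apply: integrableS (inth u v) => //; apply: subset_itvr; rewrite bnd_simp.
  apply: le_trans (le_normr_Rintegral _ _) _ => //.
  have fin_uv : mu `]u, v] = (v - u)%:E.
    by rewrite lebesgue_measure_itv/= lte_fin; case: ltP => // vu; congr EFin; lra.
  apply: (@le_trans _ _ (\int[mu]_(t in `]u, v]) (`|M| + 1))); last first.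
    rewrite Rintegral_cst//; apply: ler_wpM2l; first exact: addr_ge0.
    set m := fine _; suff -> : m = v - u by [].
    by apply: (congr1 fine (y := (v - u)%:E)); exact: fin_uv.
  apply: le_Rintegral => //; first exact: integrable_norm inth'.
  apply: (@integrableS _ _ _ mu `[u, v]) => //.
    by apply: subset_itvr; rewrite bnd_simp.
  apply: continuous_compact_integrable; first exact: segment_compact.
  by apply: continuous_subspaceT => x; exact: cst_continuous.
(* It remains to see that [phi - S] does not decrease: [S] is Lipschitz because the simple function
   [h] is bounded, and almost everywhere its derivative is [h], which is at most [g]. *)
have ACpS : abs_cont_on a b (fun x => phi x - S x).
  have ACs := abs_cont_itvD AC (@abs_cont_itv_id _ a b).
  apply: (@abs_cont_itv_le _ a b (`|M| + 1 + 1) _ _ _ _ ACs).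
    by have := normr_ge0 M; lra.
  move=> u v au uv vb; have -> : phi v - S v - (phi u - S u) = (phi v - phi u) - (S v - S u) by ring.
  apply: le_trans (ler_normB _ _) _; have := Slip u v au uv.
  have : 0 <= (`|M| + 1) * `|phi v - phi u| by rewrite mulr_ge0// addr_ge0.
  lra.
have key : phi a - S a <= phi b - S b.
  apply: (ae_nondecreasing (ltW ab) ACpS).
  have aea : {ae mu, forall t, t <> a}.
    by exists [set a]; split => //; [exact: lebesgue_measure_set1|move=> x /= /contrapT].
  have FF : Filter (nbhs (almost_everywhere mu)) := ae_filter_ringOfSetsType mu.
  apply: filterS3 aeg aeS aea => t gt St ta /andP[at_ tb] e e0.
  have {}at_ : a < t by rewrite lt_neqAle at_ andbT eq_sym; apply/eqP.
  have [dS S't] := St at_.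
  have e20 : 0 < e / 2 by lra.
  have Sq : \forall x \near 0^', x^-1 * (S (t + x) - S t) <= h t + e / 2.
    by apply: (cvgr_le _ (derivable_quot dS)); rewrite S't; lra.
  have := gt; rewrite (ltW at_) tb => /(_ isT _ e20).
  move: Sq; apply: filterS2 => x.
  have := hab t; rewrite (ltW at_) tb => /(_ isT).
  have -> : phi (t + x) - S (t + x) - (phi t - S t) = (phi (t + x) - phi t) - (S (t + x) - S t) by ring.
  rewrite [X in _ -> _ -> _ -> _ <= X]mulrBr; lra.
have SE : sintegral mu h = (S b - S a)%:E.
  rewrite {2}/S set_itv1 Rintegral_set1 subr0 /S /Rintegral fineK; last first.
    exact: integrable_fin_num (inth a b).
  rewrite -integralT_nnsfun [RHS]integral_mkcond; apply: eq_integral => x _.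
  rewrite patchE; case: ifPn => // /negP; rewrite inE/= in_itv/= => /h0.
  by rewrite /= => ->.
by rewrite SE lee_fin; lra.
Qed.

End RealAnalysis2.

(** * Geodesics in locally compact length spaces *)

Section MetricFacts.
Context {R : realType} {X : Type} (d : X -> X -> R) (hd : is_metric d).
Implicit Types (x y z : X).

Lemma dist_ge0 x y : 0 <= d x y. Proof. by case: hd => h _; exact: h. Qed.
Lemma dist_eq0 x y : d x y = 0 -> x = y. Proof. by case: hd => _ [h _] /h. Qed.
Lemma distxx x : d x x = 0. Proof. by case: hd => _ [h _]; apply/h. Qed.
Lemma dist_sym x y : d x y = d y x. Proof. by case: hd => _ [_ [h _]]; exact: h. Qed.
Lemma dist_tri y x z : d x z <= d x y + d y z. Proof. by case: hd => _ [_ [_ h]]; exact: h. Qed.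

(** If no point of [K] were a cluster point, balls avoiding a tail of [u] would cover [K], and a
    finite subcover would avoid a common tail. *)
Lemma dcompact_cluster (K : set X) (u : nat -> X) : dcompact d K -> (forall n, K (u n)) ->
  exists2 z, K z & forall (e : R) N, 0 < e -> exists2 n, (N <= n)%N & d (u n) z < e.
Proof.
move=> cK Ku; apply: contrapT => nz.
have /choice[eN HeN] : forall z, exists p : R * nat, K z ->
    0 < p.1 /\ forall n, (p.2 <= n)%N -> p.1 <= d (u n) z.
  move=> z; have [Kz|] := pselect (K z); last by exists (0, 0%N).
  apply: contrapT => nz'; apply: nz; exists z => // e N e0.
  apply: contrapT => nn; apply: nz'; exists (e, N) => _; split => // n /= Nn.
  by rewrite leNgt; apply/negP => ue; apply: nn; exists n.
pose U z := [set y | K z /\ d y z < (eN z).1].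
have oU z : dopen d (U z).
  move=> y [Kz yz]; exists ((eN z).1 - d y z); first by rewrite subr_gt0.
  move=> w; rewrite /dball/= => yw; split => //.
  by have := dist_tri y w z; rewrite (dist_sym w y); lra.
have [|s Ks] := cK X U oU.
  by move=> z Kz; exists z => //; split => //; rewrite distxx; have [] := HeN z Kz.
have [N HN] : exists N, forall z, Stdlib.Lists.List.In z s -> ((eN z).2 <= N)%N.
  elim: s {Ks} => [|z s [N IH]]; first by exists 0%N.
  exists (maxn N (eN z).2) => w /= [<-|/IH h]; first exact: leq_maxr.
  exact: leq_trans h (leq_maxl _ _).
have [z /= sz [Kz uz]] := Ks _ (Ku N).
have [_ /(_ _ (HN z sz))] := HeN z Kz; lra.
Qed.

Lemma small_inv (e : R) : 0 < e -> exists n : nat, (n.+1%:R)^-1 < e.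
Proof.
move=> e0; have ei0 : 0 <= e^-1 by rewrite invr_ge0 ltW.
exists (Num.truncn (e^-1)); rewrite invf_plt ?posrE// ?ltr0n//.
by have := truncnS_gt (e^-1).
Qed.

Hypothesis hlen : length_space d.

Lemma short_curve x y (r : R) : d x y < r ->
  exists a b c, [/\ a < b, dcont_on d a b c, c a = x, c b = y & (dlength d a b c < r%:E)%E].
Proof.
rewrite -lte_fin hlen => /ereal_inf_lt[L [a [b [c [ab cc ca cb ->]]]] Lr].
by exists a, b, c.
Qed.

Lemma sum_le_dlength (a b : R) (c : R -> X) s : Defs.partition a b s ->
  ((\sum_(p <- steps a s) d (c p.1) (c p.2))%:E <= dlength d a b c)%E.
Proof. by move=> ps; apply: ereal_sup_ubound; exists s. Qed.

Lemma dist_continuous (a b : R) (c : R -> X) z : dcont_on d a b c ->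
  {within `[a, b], continuous (fun t => d z (c t))}.
Proof.
move=> cc; apply/subspace_continuousP => t; rewrite /= in_itv/= => tab.
apply/cvgrPdist_lt => e e0; have [del del0 H] := cc t tab e e0.
rewrite near_withinE; apply/nbhs_ballP; exists del => // s /=; rewrite /ball/= distrC => st.
rewrite in_itv/= => sab; have := H s sab st.
have := dist_tri (c t) z (c s); have := dist_tri (c s) z (c t); rewrite (dist_sym (c t)).
by move=> *; rewrite /from_subspace ltr_norml; apply/andP; split; lra.
Qed.

(** On a curve of length below D + 1/(n+1), the intermediate value theorem gives a point at distance
    exactly D/2 from [z], hence at most D/2 + 1/(n+1) from [w]. These points stay in [K], and a
    cluster point is a midpoint. *)
Lemma midpoint (K : set X) p (rho : R) : dcompact d K -> dball d p rho `<=` K ->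
  forall z w, d p z + d z w < rho ->
  exists m, d z m = d z w / 2 /\ d m w = d z w / 2.
Proof.
move=> cK rK z w zw; set D := d z w.
have D0 : 0 <= D by exact: dist_ge0.
have [D00|Dn0] := eqVneq D 0.
  by exists z; rewrite distxx D00 mul0r -/D.
have Dp : 0 < D by rewrite lt_neqAle eq_sym Dn0.
have /choice[m Hm] : forall n : nat, exists m, d z m = D / 2 /\ d m w <= D / 2 + (n.+1%:R)^-1.
  move=> n; have n0 : 0 < (n.+1%:R)^-1 :> R by rewrite invr_gt0 ltr0n.
  have [|a [b [c [ab cc ca cb lc]]]] := @short_curve z w (D + (n.+1%:R)^-1); first by rewrite ltrDl.
  have [|t tab ct] := @IVT R _ a b (D / 2) (ltW ab) (dist_continuous (z := z) cc).
    rewrite ca cb distxx -/D min_l// max_r//; apply/andP; split; lra.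
  exists (c t); rewrite ct; split => //.
  move: tab; rewrite in_itv/= => /andP[at_ tb].
  have ta : a < t.
    rewrite lt_neqAle at_ andbT; apply/eqP => ta; move: ct; rewrite -ta ca distxx; lra.
  have {}tb : t < b.
    rewrite lt_neqAle tb andbT; apply/eqP => tb'; move: ct; rewrite tb' cb -/D; lra.
  have /(@sum_le_dlength a b c) : Defs.partition a b [:: t; b] by split => //=; rewrite ta tb.
  rewrite /steps /= !big_cons big_nil /= => /le_lt_trans/(_ lc).
  move: (n.+1%:R^-1) => q.
  by rewrite lte_fin ca cb ct -/D; lra.
have Km n : K (m n).
  apply: rK; have [zm _] := Hm n; rewrite /dball /=; have := dist_tri z p (m n).
  by rewrite zm; move: zw; rewrite -/D; lra.
have [m0 Km0 Hm0] := dcompact_cluster cK Km.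
have zm0 : d z m0 <= D / 2.
  apply/ler_addgt0Pl => e e0; have [n _ mn] := Hm0 e 0%N e0.
  by have [zm _] := Hm n; have := dist_tri (m n) z m0; lra.
have m0w : d m0 w <= D / 2.
  apply/ler_addgt0Pl => e e0; have e20 : 0 < e / 2 by lra.
  have [N HN] := small_inv e20.
  have [n Nn mn] := Hm0 _ N e20; have [_ mw] := Hm n.
  have := dist_tri (m n) m0 w; rewrite (dist_sym m0 (m n)).
  have : (n.+1%:R)^-1 <= (N.+1%:R)^-1 :> R by rewrite lef_pV2 ?posrE ?ltr0n// ler_nat.
  move: (n.+1%:R^-1) mw (N.+1%:R^-1) HN => q mw q' HN.
  lra.
exists m0; have := dist_tri m0 z w; rewrite -/D => *; split; apply/eqP; rewrite eq_le; lra.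
Qed.


Lemma le_add_pow2 (A B C : R) : 0 <= C -> (forall n, A <= B + C / 2 ^+ n) -> A <= B.
Proof.
move=> C0 H; apply/ler_addgt0Pl => e e0.
have C1 : 0 < C + 1 by lra.
have [n Hn] := small_inv (divr_gt0 e0 C1).
apply: le_trans (H n) _; rewrite addrC lerD2r.
have p0 : 0 < 2 ^+ n :> R by rewrite exprn_gt0.
rewrite ler_pdivrMr//; move: Hn; rewrite ltr_pdivlMr// ltr_pdivrMl ?ltr0n// => Hn.
apply: le_trans (_ : C + 1 <= _); first by rewrite lerDl.
apply: le_trans (ltW Hn) _; rewrite mulrC; apply: ler_wpM2l; first exact: ltW.
by rewrite -natrX ler_nat; exact: ltn_expl.
Qed.

Section Dyadic.
Variables (x y p : X) (rho : R) (K : set X) (mid : X -> X -> X).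
Hypotheses (cK : dcompact d K) (rK : dball d p rho `<=` K).
Local Notation L := (d x y).
Hypothesis small : d p x + L + L < rho.
Hypothesis hmid : forall z w, d p z + d z w < rho ->
  d z (mid z w) = d z w / 2 /\ d (mid z w) w = d z w / 2.

(** The point meant for arclength k L / 2^n on the geodesic under construction: even indices keep
    the previous level, odd ones insert midpoints. *)
Fixpoint dyadic (n k : nat) : X :=
  if n is m.+1 then
    if odd k then mid (dyadic m k./2) (dyadic m k./2.+1) else dyadic m k./2
  else if k is 0 then x else y.

Lemma dyadic_even n k : dyadic n.+1 k.*2 = dyadic n k.
Proof. by rewrite /= odd_double doubleK. Qed.

Let dyadic_lip n : (forall k, (k < 2 ^ n)%N -> d (dyadic n k) (dyadic n k.+1) = L / 2 ^+ n) ->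
  forall i j, (i + j <= 2 ^ n)%N -> d (dyadic n i) (dyadic n (i + j)) <= j%:R * (L / 2 ^+ n).
Proof.
move=> H i; elim=> [|j IH] ij; first by rewrite addn0 distxx mul0r.
rewrite addnS; apply: le_trans (dist_tri (dyadic n (i + j)) _ _) _.
rewrite H; last by rewrite -addnS.
have := IH (leq_trans (leq_addr 1 _) _); rewrite addn1 -addnS => /(_ ij).
by rewrite -[j.+1]addn1 natrD mulrDl mul1r; lra.
Qed.

(** The equal steps of one level keep its points within [L] of [x], so [small] allows [hmid] to be
    applied again on the next level. *)
Lemma dyadic_spec n : [/\ dyadic n 0 = x, dyadic n (2 ^ n) = y &
  forall k, (k < 2 ^ n)%N -> d (dyadic n k) (dyadic n k.+1) = L / 2 ^+ n].
Proof.
elim: n => [|n [IH0 IH1 IH]].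
  by split => // k; rewrite expn0 ltnS leqn0 => /eqP ->; rewrite /= expr0 divr1.
split; first by rewrite -double0 dyadic_even.
  by rewrite expnS mul2n dyadic_even.
move=> k k2.
have h2 : (k./2 < 2 ^ n)%N by move: k2; rewrite -{1}(odd_double_half k) expnS; lia.
have p0 : 0 < 2 ^+ n :> R by rewrite exprn_gt0.
have near : d p (dyadic n k./2) + d (dyadic n k./2) (dyadic n k./2.+1) < rho.
  rewrite IH//; apply: le_lt_trans small.
  have := dyadic_lip IH (i := 0) (ltnW h2); rewrite IH0 add0n => dx.
  have := dist_tri x p (dyadic n k./2).
  have L0 : 0 <= L / 2 ^+ n by rewrite divr_ge0 ?dist_ge0// ltW.
  have : k./2.+1%:R * (L / 2 ^+ n) <= L.
    apply: (@le_trans _ _ ((2 ^ n)%N%:R * (L / 2 ^+ n))).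
      by apply: ler_wpM2r => //; rewrite ler_nat.
    by rewrite natrX mulrC divfK// gt_eqF.
  by rewrite -[k./2.+1]addn1 natrD mulrDl mul1r; have := dist_ge0 x y; lra.
have [m1 m2] := hmid near.
have E : L / 2 ^+ n.+1 = L / 2 ^+ n / 2 by rewrite exprS invfM mulrA mulrAC.
rewrite E -(IH _ h2); case: (boolP (odd k)) => ok.
  rewrite [in X in d X _]/= ok.
  have -> : k.+1 = (k./2.+1).*2 by rewrite -{1}(odd_double_half k) ok doubleS.
  by rewrite dyadic_even.
have -> : dyadic n.+1 k = dyadic n k./2 by rewrite /= (negbTE ok).
have -> : dyadic n.+1 k.+1 = mid (dyadic n k./2) (dyadic n k./2.+1).
  by rewrite /= ok uphalf_half (negbTE ok) add0n.
by [].
Qed.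

Lemma dyadic_dist n i j : (i <= j)%N -> (j <= 2 ^ n)%N ->
  d (dyadic n i) (dyadic n j) <= (j%:R - i%:R) * (L / 2 ^+ n).
Proof.
move=> ij j2; have [_ _ H] := dyadic_spec n.
by have := dyadic_lip H (i := i) (j := j - i); rewrite subnKC// natrB//; apply.
Qed.

(** The point [c s] is the limit of the dyadic points whose index is [s] rounded down to a multiple
    of L / 2^n. Compactness of [K] provides the limit, in place of completeness of [X]. *)
Lemma dyadic_geodesic : exists c : R -> X, [/\ c 0 = x, c L = y &
  forall s s', 0 <= s -> s <= s' -> s' <= L -> d (c s) (c s') <= s' - s].
Proof.
have [L0|Ln0] := eqVneq L 0.
  have xy := dist_eq0 L0; exists (fun=> x); rewrite -xy; split => // s s' *.
  by rewrite distxx; lra.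
have Lp : 0 < L by rewrite lt_neqAle eq_sym Ln0 dist_ge0.
have p0 n : 0 < 2 ^+ n :> R by rewrite exprn_gt0.
have q0 n : 0 < L / 2 ^+ n by rewrite divr_gt0.
pose k (n : nat) (s : R) := Num.truncn (s / (L / 2 ^+ n)).
have kP n s : 0 <= s -> (k n s)%:R * (L / 2 ^+ n) <= s < ((k n s)%:R + 1) * (L / 2 ^+ n).
  move=> s0; rewrite -ler_pdivlMr// -ltr_pdivrMr// natr1.
  exact: Num.Theory.truncn_itv (divr_ge0 s0 (ltW (q0 n))).
have twoL n : 2 ^+ n * (L / 2 ^+ n) = L by rewrite mulrC divfK// gt_eqF.
have k_le n s : 0 <= s -> s <= L -> (k n s <= 2 ^ n)%N.
  move=> s0 sL; have /andP[ks _] := kP n s s0.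
  rewrite -(ler_nat R) natrX -(ler_pM2r (q0 n)) twoL; exact: le_trans sL.
have k_mono n s s' : 0 <= s -> s <= s' -> (k n s <= k n s')%N.
  move=> s0 ss'; have /andP[ks _] := kP n s s0.
  have /andP[_ ks'] := kP n s' (le_trans s0 ss').
  rewrite -ltnS -(ltr_nat R) -(ltr_pM2r (q0 n)) -[X in _ < X%:R * _]addn1 natrD; lra.
have kS n s : 0 <= s -> ((k n s).*2 <= k n.+1 s <= (k n s).*2.+1)%N.
  move=> s0; have /andP[a1 a2] := kP n s s0; have /andP[b1 b2] := kP n.+1 s s0.
  have E : L / 2 ^+ n = 2 * (L / 2 ^+ n.+1) by rewrite exprS invfM; field; rewrite gt_eqF.
  rewrite E in a1 a2.
  apply/andP; split; rewrite -ltnS -(ltr_nat R) -(ltr_pM2r (q0 n.+1)).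
    by rewrite -[(k n.+1 s).+1]addn1 -muln2 natrD natrM; lra.
  by rewrite -[(k n s).*2.+2]addn2 -muln2 natrD natrM; lra.
pose u s n := dyadic n (k n s).
(* Refining moves the rounded index by at most one step of level n+1; the bound is written as a
   difference so that it telescopes in [uD]. *)
have uS s n : 0 <= s -> s <= L -> d (u s n) (u s n.+1) <= L / 2 ^+ n - L / 2 ^+ n.+1.
  move=> s0 sL; rewrite /u -dyadic_even; have /andP[k1 k2] := kS n s s0.
  apply: le_trans (dyadic_dist k1 (k_le _ _ s0 sL)) _.
  have -> : L / 2 ^+ n - L / 2 ^+ n.+1 = 1 * (L / 2 ^+ n.+1).
    by rewrite exprS invfM; field; rewrite gt_eqF.
  apply: ler_wpM2r; first exact: ltW.
  by move: k2; rewrite -(ler_nat R) -[X in _ <= X%:R]addn1 natrD; lra.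
have uD s n m : 0 <= s -> s <= L -> d (u s n) (u s (n + m)%N) <= L / 2 ^+ n - L / 2 ^+ (n + m)%N.
  move=> s0 sL; elim: m => [|m IH]; first by rewrite addn0 distxx subrr.
  rewrite addnS; have := uS s (n + m)%N s0 sL.
  by have := dist_tri (u s (n + m)%N) (u s n) (u s (n + m).+1); lra.
have Ku s n : 0 <= s -> s <= L -> K (u s n).
  move=> s0 sL; apply: rK; rewrite /dball/=; have [d0 _ _] := dyadic_spec n.
  have := dyadic_dist (leq0n _) (k_le n s s0 sL); rewrite d0 -/(u s n) ?mulr0n ?subr0.
  have /andP[ks _] := kP n s s0 => /le_trans/(_ ks) us.
  by have := dist_tri x p (u s n); have := dist_ge0 x y; have := small; lra.
have /choice[c Hc] : forall s, exists z, 0 <= s -> s <= L -> forall n, d (u s n) z <= L / 2 ^+ n.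
  move=> s; have [s0|sn] := boolP (0 <= s); last by exists x.
  have [sL|sn] := boolP (s <= L); last by exists x.
  have [z _ Hz] := dcompact_cluster cK (fun n => Ku s n s0 sL).
  exists z => _ _ n; apply/ler_addgt0Pl => e e0.
  have [m nm mz] := Hz e n e0; have := uD s n (m - n)%N s0 sL; rewrite subnKC//.
  by have := dist_tri (u s m) (u s n) z; have := q0 m; lra.
have k0 n : k n 0 = 0%N.
  have /andP[k0 _] := kP n 0 (lexx _); apply/eqP; rewrite -leqn0 -(ler_nat R).
  by rewrite -(ler_pM2r (q0 n)) mul0r.
have kL n : k n L = (2 ^ n)%N.
  have /andP[_ kL] := kP n L (ltW Lp); apply/eqP; rewrite eqn_leq k_le//=; last exact: ltW.
  by rewrite -ltnS -(ltr_nat R) -(ltr_pM2r (q0 n)) natrX twoL -[X in _ < X%:R * _]addn1 natrD.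
have L0 : 0 <= L by exact: ltW.
exists c; split.
- apply: dist_eq0; apply/eqP; rewrite eq_le dist_ge0 andbT; apply: (le_add_pow2 L0) => n.
  have [d0 _ _] := dyadic_spec n.
  by have := Hc 0 (lexx _) L0 n; rewrite /u k0 d0 dist_sym add0r.
- apply: dist_eq0; apply/eqP; rewrite eq_le dist_ge0 andbT; apply: (le_add_pow2 L0) => n.
  have [_ d1 _] := dyadic_spec n.
  by have := Hc L L0 (lexx _) n; rewrite /u kL d1 dist_sym add0r.
(* Of the three errors L / 2^n, two come from replacing [c] by [u] at [s] and [s'], one from
   rounding [s] down. *)
- move=> s s' s0 ss' s'L; apply: (@le_add_pow2 _ _ (3 * L)); first by lra.
  move=> n; have s'0 := le_trans s0 ss'; have sL := le_trans ss' s'L.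
  have h1 := Hc s s0 sL n; have h2 := Hc s' s'0 s'L n.
  have := dyadic_dist (k_mono n s s' s0 ss') (k_le n s' s'0 s'L); rewrite -/(u s n) -/(u s' n).
  have := dist_tri (u s n) (c s) (c s'); have := dist_tri (u s' n) (u s n) (c s').
  rewrite (dist_sym (c s) (u s n)).
  have /andP[_ ks] := kP n s s0; have /andP[ks' _] := kP n s' s'0.
  rewrite -mulrA mulrBl; lra.
Qed.

End Dyadic.

(** A loss of distance on [s, s'] could not be made up on the rest of a 1-Lipschitz curve, whose
    ends are as far apart as its parameter interval is long. *)
Lemma geodesic_isometric (c : R -> X) x y : c 0 = x -> c (d x y) = y ->
  (forall s s', 0 <= s -> s <= s' -> s' <= d x y -> d (c s) (c s') <= s' - s) ->
  forall s s', 0 <= s -> s <= s' -> s' <= d x y -> d (c s) (c s') = s' - s.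
Proof.
move=> c0 c1 lip s s' s0 ss' s'L; apply/eqP; rewrite eq_le lip//=.
have h0 := lip 0 s (lexx _) s0 (le_trans ss' s'L).
have h1 := lip s' (d x y) (le_trans s0 ss') s'L (lexx _).
have := dist_tri (c s) x y; have := dist_tri (c s') (c s) y.
move: h0 h1; rewrite c0 c1; lra.
Qed.

Lemma local_geodesics : dlocally_compact d -> forall p, exists2 r, 0 < r &
  forall x y, d p x <= r -> d p y <= r -> exists c : R -> X, [/\ c 0 = x, c (d x y) = y &
    forall s s', 0 <= s -> s <= s' -> s' <= d x y -> d (c s) (c s') = s' - s].
Proof.
move=> lc p; have [K cK [V oV [Vp VK]]] := lc p; have [rho rho0 rV] := oV p Vp.
(* Points within r of [p] are at most 2r apart, so [small] asks for r + 2r + 2r < rho. *)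
exists (rho / 6); first by lra.
move=> x y px py.
have rK : dball d p rho `<=` K by move=> z /rV /VK.
have /choice[mid Hmid] : forall z, exists mid : X -> X, forall w, d p z + d z w < rho ->
    d z (mid w) = d z w / 2 /\ d (mid w) w = d z w / 2.
  move=> z.
  have /choice[mid Hmid] : forall w, exists m, d p z + d z w < rho ->
      d z m = d z w / 2 /\ d m w = d z w / 2.
    move=> w; have [zw|_] := boolP (d p z + d z w < rho); last by exists z.
    by have [m Hm] := midpoint cK rK zw; exists m.
  by exists mid.
have small : d p x + d x y + d x y < rho.
  by have := dist_tri p x y; rewrite (dist_sym x p); lra.
have [c [c0 c1 lip]] := dyadic_geodesic cK rK small Hmid.
by exists c; split => //; exact: geodesic_isometric.
Qed.

End MetricFacts.

(** * Piecewise geodesic curves *)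

Section BrokenGeodesics.
Context {R : realType} {X : Type} (d : X -> X -> R) (hd : is_metric d).
Implicit Types (x y z : X) (l : R) (c : R -> X).

(** Here [l] is the length of the curve, in general larger than [d x y]. Off the corners listed in
    [bad], only distances measured from the point [c u] itself have to be exact: this is what a
    metric derivative at [u] sees. *)
Definition broken_geodesic c l x y : Prop :=
  [/\ 0 <= l, c 0 = x, c l = y,
      (forall s s', 0 <= s -> s <= s' -> s' <= l -> d (c s) (c s') <= s' - s) &
      exists bad : seq R, forall u, 0 < u < l -> u \notin bad ->
        exists2 e, 0 < e & forall w, 0 <= w <= l -> `|w - u| < e -> d (c w) (c u) = `|w - u|].

Lemma broken_geodesic_cat c1 c2 l1 l2 x y z :
  broken_geodesic c1 l1 x y -> broken_geodesic c2 l2 y z ->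
  exists c, broken_geodesic c (l1 + l2) x z.
Proof.
move=> [l10 c10 c1l lip1 [b1 iso1]] [l20 c20 c2l lip2 [b2 iso2]].
exists (fun s => if s <= l1 then c1 s else c2 (s - l1)); split.
- lra.
- by rewrite l10.
- case: ifPn => [l12|_]; last by rewrite addrC addKr.
  have l2E : l2 = 0 by lra.
  by rewrite l2E addr0 c1l -c20 -c2l l2E.
- move=> s s' s0 ss' s'l; case: (leP s l1) => sl; case: (leP s' l1) => s'l1.
  + exact: lip1.
  + have := dist_tri hd (c1 l1) (c1 s) (c2 (s' - l1)).
    have := lip1 s l1 s0 sl (lexx _).
    have := lip2 0 (s' - l1) (lexx _); rewrite c20 c1l.
    by move=> /(_ ltac:(lra) ltac:(lra)); lra.
  + lra.
  + by have := lip2 (s - l1) (s' - l1); move=> /(_ ltac:(lra) ltac:(lra) ltac:(lra)); lra.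
- exists (l1 :: b1 ++ map (+%R l1) b2) => u /andP[u0 ul].
  rewrite inE mem_cat !negb_or => /and3P[ul1 ub1 ub2].
  have [ultl1|] := ltP u l1.
    have [|e e0 He] := iso1 u _ ub1; first by rewrite u0.
    exists (Order.min e (l1 - u)); first by rewrite lt_min e0; lra.
    move=> w /andP[w0 wl]; rewrite lt_min => /andP[we wl1].
    have wl1' : w <= l1 by have := ler_norm (w - u); lra.
    by rewrite wl1' (ltW ultl1) He// w0.
  rewrite le_eqVlt eq_sym (negbTE ul1)/= => l1u.
  have ub2' : u - l1 \notin b2.
    by apply: contra ub2 => h; apply/mapP; exists (u - l1) => //=; lra.
  have [|e e0 He] := iso2 (u - l1) _ ub2'; first by apply/andP; split; lra.
  exists (Order.min e (u - l1)); first by rewrite lt_min e0; lra.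
  move=> w /andP[w0 wl]; rewrite lt_min => /andP[we wl1].
  have wl1' : l1 < w by have := ler_norm (u - w); rewrite distrC; lra.
  rewrite !leNgt wl1' l1u/=.
  have E : w - l1 - (u - l1) = w - u by lra.
  by rewrite He ?E//; apply/andP; split; lra.
Qed.

Lemma broken_geodesic_refl x : broken_geodesic (fun=> x) 0 x x.
Proof.
split => // [s s' *|]; first by rewrite distxx//; lra.
by exists [::] => u /andP[u0 /lt_trans/(_ u0)]; rewrite ltxx.
Qed.

Lemma geodesic_broken c x y : c 0 = x -> c (d x y) = y ->
  (forall s s', 0 <= s -> s <= s' -> s' <= d x y -> d (c s) (c s') = s' - s) ->
  broken_geodesic c (d x y) x y.
Proof.
move=> c0 c1 iso; split => //; first exact: dist_ge0.
  by move=> s s' *; rewrite iso.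
exists [::] => u /andP[u0 ul] _; exists 1 => // w /andP[w0 wl] _.
have [wu|uw] := leP w u.
  have -> : `|w - u| = u - w by rewrite ler0_norm; lra.
  by apply: iso => //; lra.
rewrite dist_sym//; have -> : `|w - u| = w - u by rewrite gtr0_norm; lra.
by apply: iso => //; lra.
Qed.

Lemma steps_rcons (a : R) s (v : R) : steps a (rcons s v) = rcons (steps a s) (last a s, v).
Proof. by elim: s a => [|x s IH] a //=; rewrite /steps/= in IH *; rewrite IH. Qed.

Hypotheses (hlen : length_space d) (hlc : dlocally_compact d).

(* Broken geodesics have metric speed 1 off a finite set, so that no a.e.
   existence theorem for metric derivatives of rectifiable curves is needed. *)
Lemma inscribed_broken_geodesic (a b : R) (B : R -> X) : a <= b -> dcont_on d a b B ->
  exists2 s, Defs.partition a b s & exists c,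
    broken_geodesic c (\sum_(p <- steps a s) d (B p.1) (B p.2)) (B a) (B b).
Proof.
move=> ab cB.
apply: (@segment_ind R a b (fun t => exists2 s, Defs.partition a t s & exists c,
    broken_geodesic c (\sum_(p <- steps a s) d (B p.1) (B p.2)) (B a) (B t))) => //.
  exists [::] => //; exists (fun=> B a); rewrite /steps/= big_nil.
  exact: broken_geodesic_refl.
(* By continuity [B] stays near [B T], where any two points are joined by a geodesic; the chord from
   [B u] to [B v] is appended. *)
move=> T aTb; have [r r0 Hr] := local_geodesics hd hlen hlc (B T).
have [del del0 Hdel] := cB T aTb r r0.
exists del => // u v au Tu uT Tv vT vb [s [ps ls] [c Hc]].
have [uv|uv] := leP v u.
  have -> : v = u by lra.
  by exists s => //; exists c.
have near w : a <= w -> w <= b -> `|w - T| < del -> d (B T) (B w) <= r.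
  by move=> aw wb wT; rewrite dist_sym// ltW//; apply: Hdel => //; rewrite aw.
have [| |g [g0 g1 giso]] := Hr (B u) (B v).
- by apply: near => //; [lra|rewrite ltr_norml; apply/andP; split; lra].
- by apply: near => //; [lra|rewrite ltr_norml; apply/andP; split; lra].
exists (rcons s v).
  by split; rewrite ?last_rcons// rcons_path ps ls.
have [c' Hc'] := broken_geodesic_cat Hc (geodesic_broken g0 g1 giso).
by exists c'; rewrite steps_rcons ls big_rcons/= addrC in Hc' *.
Qed.

Lemma broken_geodesic_exists x y r : d x y < r -> exists c l, l < r /\ broken_geodesic c l x y.
Proof.
move=> xy; have [a [b [B [ab cB <- <- Br]]]] := short_curve hlen xy.
have [s ps [c Hc]] := inscribed_broken_geodesic (ltW ab) cB.
exists c, (\sum_(p <- steps a s) d (B p.1) (B p.2)); split => //.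
by rewrite -lte_fin; exact: le_lt_trans (sum_le_dlength d B ps) Br.
Qed.

Lemma sum_steps_telescope (V : R -> R) (a b : R) s : Defs.partition a b s ->
  \sum_(p <- steps a s) (V p.2 - V p.1) = V b - V a.
Proof.
move=> [_ <-]; elim: s a => [|x s IH] a /=; first by rewrite /steps big_nil subrr.
by rewrite /steps/= big_cons/= -/(steps x s) IH; ring.
Qed.

Lemma steps_itv (a b : R) s : Defs.partition a b s ->
  {in steps a s, forall p : R * R, [/\ a <= p.1, p.1 < p.2 & p.2 <= b]}.
Proof.
move=> [ps ls] p; elim: s a ps ls => [|x s IH] a //=.
move=> /andP[ax xs] ls; rewrite /steps/= -/(steps x s) inE => /orP[/eqP ->/=|ps].
  split => //; rewrite -ls; elim: s x xs {IH ls ax} => [|y s IH] x //=.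
  by move=> /andP[xy ys]; apply: le_trans (ltW xy) (IH _ ys).
by have [h1 h2 h3] := IH _ xs ls ps; split => //; apply: le_trans (ltW ax) h1.
Qed.

End BrokenGeodesics.

(** * Calculus of the warping function *)

Section DerivativeComparison.
Context {R : realType}.
Implicit Types (F G f g : R -> R) (a b : R).

Lemma derivative_lt F G f g a b : a < b ->
  (forall s, a <= s <= b -> is_derive s 1 F (f s)) ->
  (forall s, a <= s <= b -> is_derive s 1 G (g s)) ->
  (forall s, a <= s <= b -> f s < g s) -> F b - F a < G b - G a.
Proof.
move=> ab dF dG fg.
have dFG s : a <= s <= b -> is_derive s 1 (fun x => G x - F x) (g s - f s).
  by move=> sab; have := dF s sab; have := dG s sab => ? ?; apply: is_deriveB.
have [||c] := MVT ab (f := fun x => G x - F x) (df := fun s => g s - f s).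
- by move=> s; rewrite in_itv/= => /andP[as_ sb]; apply: dFG; rewrite !ltW.
- apply: derivable_within_continuous => s; rewrite in_itv/= => sab.
  by have [] := dFG s sab.
- rewrite in_itv/= => /andP[ac cb] E.
  have := fg c; rewrite !ltW// => /(_ isT) fgc.
  have : 0 < (g c - f c) * (b - a) by rewrite mulr_gt0//; lra.
  lra.
Qed.

Lemma derivative_le F G f g a b : a <= b ->
  (forall s, a <= s <= b -> is_derive s 1 F (f s)) ->
  (forall s, a <= s <= b -> is_derive s 1 G (g s)) ->
  (forall s, a <= s <= b -> f s <= g s) -> F b - F a <= G b - G a.
Proof.
move=> ab dF dG fg; have [ba|ab'] := leP b a.
  by rewrite (_ : b = a) ?subrr//; lra.
have dFG s : a <= s <= b -> is_derive s 1 (fun x => G x - F x) (g s - f s).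
  by move=> sab; have := dF s sab; have := dG s sab => ? ?; apply: is_deriveB.
have [||c] := MVT ab' (f := fun x => G x - F x) (df := fun s => g s - f s).
- by move=> s; rewrite in_itv/= => /andP[as_ sb]; apply: dFG; rewrite !ltW.
- apply: derivable_within_continuous => s; rewrite in_itv/= => sab.
  by have [] := dFG s sab.
- rewrite in_itv/= => /andP[ac cb] E.
  have fgc : f c <= g c by apply: fg; rewrite ltW//= ltW.
  have : 0 <= (g c - f c) * (b - a) by rewrite mulr_ge0//; lra.
  lra.
Qed.

Lemma is_derive_cM (k : R) F f (s : R) : is_derive s 1 F (f s) ->
  is_derive s 1 (fun x => k * F x) (k * f s).
Proof. by move=> dF; have := is_deriveZ k dF. Qed.

End DerivativeComparison.

(** * Pointwise estimates for the extremal speeds *)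

Section WarpingAlgebra.
Context {R : realType}.
Implicit Types f l m p q : R.

(* With [f = f t], the extremal of multiplier [l] has fibre speed [vspeed f l]
   and Lorentzian speed [lspeed f l]; the two are Legendre dual:
   [lspeed f l + l * vspeed f l = sqrt (1 + l^2 / f^2)]. *)
Definition root2 f l : R := Num.sqrt (f ^+ 2 + l ^+ 2).
Definition vspeed f l : R := l / (f * root2 f l).
Definition lspeed f l : R := f / root2 f l.

Lemma root2_sqr f l : root2 f l ^+ 2 = f ^+ 2 + l ^+ 2.
Proof. by rewrite sqr_sqrtr// addr_ge0// sqr_ge0. Qed.

Lemma root2_gt0 f l : 0 < f -> 0 < root2 f l.
Proof. by move=> f0; rewrite sqrtr_gt0 ltr_pwDl ?sqr_ge0// exprn_gt0. Qed.

Lemma root2_ge0 f l : 0 <= root2 f l.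
Proof. exact: sqrtr_ge0. Qed.

Lemma root2_gel f l : 0 < f -> f <= root2 f l.
Proof.
move=> f0; rewrite -(@ler_pXn2r _ 2)// ?nnegrE ?root2_ge0//; last exact: ltW.
by rewrite root2_sqr lerDl sqr_ge0.
Qed.

Lemma root2_gtr f l : 0 < f -> l < root2 f l.
Proof.
move=> f0; have r0 := root2_gt0 l f0; have [l0|l0] := leP l 0; first by lra.
rewrite -(@ltr_pXn2r _ 2)// ?nnegrE ?root2_ge0//; last exact: ltW.
by rewrite root2_sqr ltrDr exprn_gt0.
Qed.

Lemma root2_mono f l m : 0 < f -> 0 <= l -> l <= m -> root2 f l <= root2 f m <= root2 f l + (m - l).
Proof.
move=> f0 l0 lm; have r0 := root2_gt0 l f0; have r1 := root2_gt0 m f0.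
have sl := root2_sqr f l; have sm := root2_sqr f m; have lr := root2_gtr l f0.
apply/andP; split.
  rewrite -(@ler_pXn2r _ 2)// ?nnegrE ?root2_ge0// sl sm lerD2l.
  by rewrite ler_pXn2r// nnegrE; lra.
rewrite -(@ler_pXn2r _ 2)// ?nnegrE; try lra.
nra.
Qed.

Lemma vspeed_ge0 f l : 0 < f -> 0 <= l -> 0 <= vspeed f l.
Proof. by move=> f0 l0; rewrite divr_ge0// mulr_ge0// ltW// root2_gt0. Qed.

Lemma vspeed_gt0 f l : 0 < f -> 0 < l -> 0 < vspeed f l.
Proof. by move=> f0 l0; rewrite divr_gt0// mulr_gt0// root2_gt0. Qed.

Lemma lspeed_gt0 f l : 0 < f -> 0 < lspeed f l.
Proof. by move=> f0; rewrite divr_gt0// root2_gt0. Qed.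

Lemma vspeed_lt f l : 0 < f -> vspeed f l < f^-1.
Proof.
move=> f0; have r0 := root2_gt0 l f0.
rewrite /vspeed ltr_pdivrMr ?mulr_gt0// mulKf ?gt_eqF//; exact: root2_gtr.
Qed.

(** By (root2 - l) (root2 + l) = f^2. The bound is free of [f]: extremals become null uniformly as
    [l] grows. *)
Lemma vspeed_gap f l : 0 < f -> 0 < l -> f^-1 - vspeed f l <= l^-1.
Proof.
move=> f0 l0; have r0 := root2_gt0 l f0; have lr := root2_gtr l f0; have s := root2_sqr f l.
have -> : f^-1 - vspeed f l = (root2 f l - l) / (f * root2 f l).
  by rewrite /vspeed; field; rewrite !gt_eqF.
rewrite ler_pdivrMr ?mulr_gt0// ler_pdivlMl//.
have fr := root2_gel l f0.
have : (root2 f l - l) * (root2 f l + l) = f ^+ 2 by nra.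
nra.
Qed.

Lemma vspeed_mono f l m : 0 < f -> 0 <= l -> l <= m ->
  0 <= vspeed f m - vspeed f l <= (m - l) / f ^+ 2.
Proof.
move=> f0 l0 lm; have r0 := root2_gt0 l f0; have r1 := root2_gt0 m f0.
have /andP[h1 h2] := root2_mono f0 l0 lm.
have lr := root2_gtr l f0; have mr := root2_gtr m f0; have fr := root2_gel l f0; have fm := root2_gel m f0.
have -> : vspeed f m - vspeed f l = (m * root2 f l - l * root2 f m) / (f * (root2 f l * root2 f m)).
  by rewrite /vspeed; field; rewrite !gt_eqF.
have p0 : 0 < f * (root2 f l * root2 f m) by rewrite !mulr_gt0.
apply/andP; split.
  apply: divr_ge0; last exact: ltW.
  have : m * (root2 f l - l) >= l * (root2 f m - m) by nra.
  nra.
rewrite ler_pdivrMr// mulrAC ler_pdivlMr ?exprn_gt0//.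
have : m * root2 f l - l * root2 f m <= (m - l) * root2 f l by nra.
have : 0 <= (m - l) * (root2 f l * f) * (root2 f m - f) by rewrite !mulr_ge0//; nra.
have : 0 <= f ^+ 2 by nra.
nra.
Qed.

Lemma vspeed_strict f l m : 0 < f -> 0 <= l -> l < m -> vspeed f l < vspeed f m.
Proof.
move=> f0 l0 lm; have r0 := root2_gt0 l f0; have r1 := root2_gt0 m f0.
rewrite /vspeed ltr_pdivrMr ?mulr_gt0// mulrAC ltr_pdivlMr ?mulr_gt0//.
have /andP[h1 h2] := root2_mono f0 l0 (ltW lm); have lr := root2_gtr l f0.
have : l * root2 f m < m * root2 f l by nra.
nra.
Qed.

Lemma lspeed_mono f l m : 0 < f -> 0 <= l -> l <= m ->
  lspeed f l - lspeed f m <= (m - l) / f.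
Proof.
move=> f0 l0 lm; have r0 := root2_gt0 l f0; have r1 := root2_gt0 m f0.
have /andP[h1 h2] := root2_mono f0 l0 lm; have fr := root2_gel l f0; have fm := root2_gel m f0.
have -> : lspeed f l - lspeed f m = f * (root2 f m - root2 f l) / (root2 f l * root2 f m).
  by rewrite /lspeed; field; rewrite !gt_eqF.
rewrite ler_pdivrMr ?mulr_gt0// mulrAC ler_pdivlMr//.
have : f * f <= root2 f l * root2 f m by nra.
nra.
Qed.

Lemma lspeed_le f l : 0 < f -> 0 < l -> lspeed f l <= f / l.
Proof.
move=> f0 l0; rewrite ler_pM2l// lef_pV2 ?posrE ?root2_gt0//.
exact/ltW/root2_gtr.
Qed.

Lemma lspeed_dual f l p q : 0 < f -> 0 <= l -> 0 <= q -> f * q <= p ->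
  Num.sqrt (p ^+ 2 - f ^+ 2 * q ^+ 2) + l * q <= (lspeed f l + l * vspeed f l) * p.
Proof.
move=> f0 l0 q0 fqp; have r0 := root2_gt0 l f0; have s := root2_sqr f l.
have p0 : 0 <= p by nra.
have -> : lspeed f l + l * vspeed f l = root2 f l / f.
  apply: (@mulIf _ (f * root2 f l)); first by rewrite gt_eqF// mulr_gt0.
  rewrite /lspeed /vspeed.
  have -> : (f / root2 f l + l * (l / (f * root2 f l))) * (f * root2 f l) = f ^+ 2 + l ^+ 2.
    by field; rewrite !gt_eqF.
  by rewrite -s; field; rewrite gt_eqF.
set w := Num.sqrt _.
have w0 : 0 <= w by exact: sqrtr_ge0.
have ws : w ^+ 2 = p ^+ 2 - f ^+ 2 * q ^+ 2.
  rewrite sqr_sqrtr// subr_ge0 -exprMn ler_pXn2r ?nnegrE//; nra.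
rewrite mulrAC ler_pdivlMr//.
rewrite -(@ler_pXn2r _ 2)// ?nnegrE; try by rewrite mulr_ge0//; lra.
  rewrite [leRHS]exprMn s.
  have -> : p ^+ 2 = w ^+ 2 + f ^+ 2 * q ^+ 2 by lra.
  (* This square is the defect in the Cauchy-Schwarz inequality for the vectors (f, l) and (w, f
     q). *)
  have : 0 <= (w * l - f ^+ 2 * q) ^+ 2 by exact: sqr_ge0.
  nra.
by rewrite mulr_ge0 ?addr_ge0// ?mulr_ge0// ltW.
Qed.

(** At fibre speed [vspeed f m] the two sides agree, and slowing down in the fibre only increases
    the Lorentzian speed. *)
Lemma lspeed_scaled f m k : 0 < f -> 0 <= k <= 1 ->
  lspeed f m <= Num.sqrt (1 - f ^+ 2 * (k * vspeed f m) ^+ 2).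
Proof.
move=> f0 /andP[k0 k1]; have r0 := root2_gt0 m f0; have s := root2_sqr f m.
have h0 := lspeed_gt0 m f0.
have E : 1 - f ^+ 2 * vspeed f m ^+ 2 = lspeed f m ^+ 2.
  apply: (@mulIf _ (root2 f m ^+ 2)); first by rewrite gt_eqF// exprn_gt0.
  rewrite /lspeed /vspeed.
  have -> : (f / root2 f m) ^+ 2 * root2 f m ^+ 2 = f ^+ 2 by field; rewrite gt_eqF.
  have -> : (1 - f ^+ 2 * (m / (f * root2 f m)) ^+ 2) * root2 f m ^+ 2 = root2 f m ^+ 2 - m ^+ 2.
    by field; rewrite !gt_eqF.
  by rewrite s; ring.
rewrite -[leLHS]ger0_norm; last exact: ltW.
rewrite -sqrtr_sqr ler_wsqrtr// -E lerD2l lerN2.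
rewrite ler_wpM2l ?sqr_ge0// exprMn ler_piMl ?sqr_ge0// expr_le1//.
Qed.

End WarpingAlgebra.

(** * Primitives and bounds on the open interval *)

Section OpenInterval.
Context {R : realType} (a0 b0 : \bar R).
Local Notation I := (in_I a0 b0).
Implicit Types (s t u : R).

Lemma in_I_open t : I t -> exists2 e, 0 < e & forall s, `|s - t| < e -> I s.
Proof.
move=> /andP[at_ tb].
have [e1 e10 H1] : exists2 e, 0 < e & forall s, `|s - t| < e -> (a0 < s%:E)%E.
  case: a0 at_ => [x||]//=; last by exists 1 => // s _; rewrite ltNyr.
  rewrite lte_fin => xt; exists (t - x); first by lra.
  by move=> s; rewrite ltr_norml lte_fin => /andP[h1 h2]; lra.
have [e2 e20 H2] : exists2 e, 0 < e & forall s, `|s - t| < e -> (s%:E < b0)%E.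
  case: b0 tb => [x||]//=; last by exists 1 => // s _; rewrite ltry.
  rewrite lte_fin => xt; exists (x - t); first by lra.
  by move=> s; rewrite ltr_norml lte_fin => /andP[h1 h2]; lra.
exists (Order.min e1 e2); first by rewrite lt_min e10.
by move=> s; rewrite lt_min => /andP[/H1 h1 /H2 h2]; apply/andP.
Qed.

Lemma in_I_near t : I t -> \forall s \near t, I s.
Proof.
move=> /in_I_open[e e0 H]; apply/nbhs_ballP; exists e => // s.
by rewrite /ball/= distrC => /H.
Qed.

Lemma in_I_itv t u s : I t -> I u -> t <= s -> s <= u -> I s.
Proof.
move=> /andP[at_ _] /andP[_ ub] ts su; apply/andP; split.
  by apply: lt_le_trans at_ _; rewrite lee_fin.
by apply: le_lt_trans ub; rewrite lee_fin.
Qed.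

Lemma in_I_widen t u : I t -> I u -> exists v w, [/\ I v, I w, v < t, v < u & t < w /\ u < w].
Proof.
wlog tu : t u / t <= u => [H It Iu|It Iu].
  have [tu|/ltW ut] := leP t u; first exact: H.
  by have [v [w [Iv Iw vu vt [uw tw]]]] := H _ _ ut Iu It; exists v, w.
have [e e0 He] := in_I_open It; have [e' e'0 He'] := in_I_open Iu.
exists (t - e / 2), (u + e' / 2); split; try lra.
  by apply: He; rewrite ler0_norm; lra.
by apply: He'; rewrite ger0_norm; lra.
Qed.

Lemma within_in_I_continuous (f : R -> R) : {within [set t | I t], continuous f} ->
  forall t, I t -> {for t, continuous f}.
Proof.
have oI : open [set t | I t].
  rewrite openE => t /= It; rewrite /interior; exact: in_I_near.
by rewrite continuous_open_subspace// => cf t It; apply: cf; rewrite inE.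
Qed.

(** A single operator [P] serves all integrands, and so yields [F] and the whole families [V l] and
    [H l]. *)
Lemma exists_primitive : exists P : (R -> R) -> R -> R, forall phi : R -> R,
  (forall t, I t -> {for t, continuous phi}) ->
  forall t, I t -> is_derive t 1 (P phi) (phi t).
Proof.
have [[t0 It0]|nI] := pselect (exists t0, I t0); last first.
  by exists (fun=> id) => phi _ t It; case: nI; exists t.
exists (prim t0) => phi cphi t It.
have [v [w [Iv Iw vt0 vt [t0w tw]]]] := in_I_widen It0 It.
apply: (@is_derive_prim _ v w t0 phi); rewrite ?vt0 ?vt//.
by move=> s; rewrite in_itv/= => /andP[vs sw]; apply: cphi; exact: in_I_itv vs sw.
Qed.

Lemma continuous_in_I_bounded (phi : R -> R) (t u : R) : I t -> I u ->
  (forall s, I s -> {for s, continuous phi}) ->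
  exists2 M, 0 < M & forall s, t <= s -> s <= u -> `|phi s| <= M.
Proof.
move=> It Iu cphi; have [tu|ut] := leP t u; last by exists 1 => // s ts su; lra.
have c : {within `[t, u], continuous (fun s => `|phi s|)}.
  apply: continuous_in_subspaceT => s; rewrite inE/= in_itv/= => /andP[ts su].
  have Is := in_I_itv It Iu ts su.
  by apply: continuous_comp; [exact: cphi|exact: norm_continuous].
have [m _ Hm] := EVT_max tu c.
exists (`|phi m| + 1); first by rewrite ltr_pwDr.
by move=> s ts su; have := Hm s; rewrite in_itv/= ts su => /(_ isT); lra.
Qed.

Lemma in_I_lipschitz (F phi : R -> R) (t u : R) : I t -> I u ->
  (forall s, I s -> {for s, continuous phi}) ->
  (forall s, I s -> is_derive s 1 F (phi s)) ->
  exists2 M, 0 < M & forall s s', t <= s -> s <= s' -> s' <= u -> `|F s' - F s| <= M * (s' - s).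
Proof.
move=> It Iu cphi dF; have [M M0 HM] := continuous_in_I_bounded It Iu cphi.
exists M => // s s' ts ss' s'u.
have Iss x : s <= x <= s' -> I x.
  by move=> /andP[sx xs']; apply: (in_I_itv It Iu); lra.
have dM (x : R) : is_derive x 1 (fun x => M * x) M.
  by have := is_deriveZ M (@is_derive_id _ _ x 1); rewrite /GRing.scale/= mulr1.
have dNM (x : R) : is_derive x 1 (fun x => - (M * x)) (- M) by have := dM x => ?; exact: is_deriveN.
have bd x : s <= x <= s' -> - M <= phi x <= M.
  by move=> /andP[sx xs']; rewrite -ler_norml; apply: HM; lra.
rewrite ler_norml; apply/andP; split.
  have := @derivative_le _ _ F (fun=> - M) phi s s' ss' (fun x _ => dNM x).
  by move=> /(_ (fun x h => dF x (Iss x h)) (fun x h => proj1 (andP (bd x h)))); lra.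
have := @derivative_le _ F _ phi (fun=> M) s s' ss' (fun x h => dF x (Iss x h)) (fun x _ => dM x).
by move=> /(_ (fun x h => proj2 (andP (bd x h)))); lra.
Qed.

Lemma in_I_continuous (F phi : R -> R) : (forall s, I s -> is_derive s 1 F (phi s)) ->
  forall t, I t -> forall e, 0 < e -> exists2 del, 0 < del & forall s, `|s - t| < del -> `|F s - F t| < e.
Proof.
move=> dF t It e e0; have [dFt _] := dF t It.
have /differentiable_continuous := proj1 (derivable1_diffP F t) dFt.
move=> /cvgrPdist_lt /(_ e e0) /nbhs_ballP[del /= del0 H].
exists del => // s st; rewrite distrC; apply: H; rewrite /ball/= distrC//.
Qed.

End OpenInterval.

Section WarpingContinuity.
Context {R : realType}.
Implicit Types (f : R -> R) (t l : R).

Lemma root2_continuous f t l : {for t, continuous f} ->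
  {for t, continuous (fun s => root2 (f s) l)}.
Proof.
move=> cf; apply: (@continuous_comp _ _ _ (fun s => f s ^+ 2 + l ^+ 2) Num.sqrt); last exact: sqrt_continuous.
apply: cvgD; last exact: cvg_cst.
apply: (@continuous_comp _ _ _ f (fun x => x ^+ 2)) => //; exact: exprn_continuous.
Qed.

Lemma lspeed_continuous f t l : {for t, continuous f} -> 0 < f t ->
  {for t, continuous (fun s => lspeed (f s) l)}.
Proof.
move=> cf f0; apply: cvgM => //; apply: cvgV; first by rewrite gt_eqF// root2_gt0.
exact: root2_continuous.
Qed.

Lemma vspeed_continuous f t l : {for t, continuous f} -> 0 < f t ->
  {for t, continuous (fun s => vspeed (f s) l)}.
Proof.
move=> cf f0; apply: cvgM; first exact: cvg_cst.
apply: cvgV; first by rewrite gt_eqF// mulr_gt0// root2_gt0.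
by apply: cvgM => //; exact: root2_continuous.
Qed.

Lemma inv_continuous f t : {for t, continuous f} -> 0 < f t ->
  {for t, continuous (fun s => (f s)^-1)}.
Proof. by move=> cf f0; apply: cvgV => //; rewrite gt_eqF. Qed.

Lemma ae_itv_exists (P : R -> Prop) (a b : R) : a < b ->
  {ae @lebesgue_measure R, forall t, P t} -> exists t, a < t < b /\ P t.
Proof.
move=> ab [N [mN N0 HN]]; apply: contrapT => nex.
have sub : `]a, b[%classic `<=` N.
  move=> t /=; rewrite in_itv/= => tab; apply: HN => /= Pt; apply: nex; exists t; split => //.
have : (@lebesgue_measure R `]a, b[%classic <= @lebesgue_measure R N)%E.
  by apply: le_measure => //; rewrite inE.
rewrite leNgt => /negP; apply.
apply: (@le_lt_trans _ _ 0%E); first by rewrite le_eqVlt; apply/orP; left; apply/eqP; exact: N0.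
by rewrite lebesgue_measure_itv/= lte_fin ab lte_fin subr_gt0.
Qed.

End WarpingContinuity.

(** * Bounds along causal curves of the cone *)

Section ConeCurves.
Context {R : realType} {X : Type} (d : X -> X -> R) (a0 b0 : \bar R) (f : R -> R).
Hypotheses (hd : is_metric d) (fpos : forall t, in_I a0 b0 t -> 0 < f t).
Hypothesis fcont : forall t, in_I a0 b0 t -> {for t, continuous f}.
Local Notation I := (in_I a0 b0).
Local Notation Y := (@cone R X a0 b0).
Local Notation al := (calpha a0 b0).
Local Notation be := (cbeta a0 b0).
Local Notation mu := (@lebesgue_measure R).
Implicit Types (g : R -> Y) (a b s t u v l : R).

Lemma calpha_in g t : I (al g t). Proof. exact: (valP (g t)). Qed.

Lemma cone_distE g s t : cone_dist d a0 b0 (g s) (g t) = `|al g s - al g t| + d (be g s) (be g t).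
Proof. by []. Qed.

Lemma mquotE g t h : mquot d a0 b0 g t h = d (be g (t + h)) (be g t) / `|h|.
Proof. by []. Qed.

Lemma mder_cvg g t : mder_exists d a0 b0 g t -> mquot d a0 b0 g t @ 0^' --> mder d a0 b0 g t.
Proof. by move=> [l Hl]; rewrite /mder (cvg_lim _ Hl). Qed.

Lemma mder_ge0 g t : mder_exists d a0 b0 g t -> 0 <= mder d a0 b0 g t.
Proof.
move=> [l Hl]; apply: limr_ge; first by apply/cvg_ex; exists l.
by apply: nearW => h; rewrite divr_ge0// dist_ge0.
Qed.

(** The distance to [z] may have no derivative along the fibre, but its difference quotients are
    bounded in absolute value by [mquot], for [h] of either sign. *)
Lemma cone_lower_derivative g t l z (Phi : R -> R) (p : R) : 0 <= l ->
  is_derive (al g t) 1 Phi (p) ->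
  derivable (al g) t 1 -> mder_exists d a0 b0 g t -> forall e, 0 < e ->
  \forall h \near 0^', p * derive1 (al g) t - l * mder d a0 b0 g t - e <=
    h^-1 * ((Phi (al g (t + h)) - l * d z (be g (t + h))) - (Phi (al g t) - l * d z (be g t))).
Proof.
move=> l0 dPhi da dm e e0.
have dPa : is_derive t 1 (Phi \o al g) (p * derive1 (al g) t).
  have dal : is_derive t 1 (al g) (derive1 (al g) t) by rewrite derive1E; exact: derivableP.
  exact: is_derive1_comp.
have [dPa1 dPa2] := dPa.
have cP := derivable_quot dPa1; rewrite derive1E dPa2 in cP.
have cm : (fun h => l * mquot d a0 b0 g t h) @ 0^' --> l * mder d a0 b0 g t.
  by apply: cvgM; [exact: cvg_cst|exact: mder_cvg].
have cPm : (fun h => h^-1 * (Phi (al g (t + h)) - Phi (al g t)) - l * mquot d a0 b0 g t h) @ 0^' -->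
    p * derive1 (al g) t - l * mder d a0 b0 g t by exact: cvgB cP cm.
have : \forall h \near (0 : R)^', p * derive1 (al g) t - l * mder d a0 b0 g t - e <=
    h^-1 * (Phi (al g (t + h)) - Phi (al g t)) - l * mquot d a0 b0 g t h.
  by apply: (cvgr_ge _ cPm); lra.
apply: filterS => h H; apply: le_trans H _.
rewrite mquotE.
have -> : h^-1 * (Phi (al g (t + h)) - l * d z (be g (t + h)) - (Phi (al g t) - l * d z (be g t)))
  = h^-1 * (Phi (al g (t + h)) - Phi (al g t)) - l * (h^-1 * (d z (be g (t + h)) - d z (be g t))) by ring.
rewrite lerD2l lerN2 ler_wpM2l//.
apply: le_trans (ler_norm _) _; rewrite normrM normfV mulrC.
rewrite ler_wpM2r ?invr_ge0// ler_norml.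
have := dist_tri hd (be g t) z (be g (t + h)); have := dist_tri hd (be g (t + h)) z (be g t).
by rewrite (dist_sym hd (be g t)) => *; apply/andP; split; lra.
Qed.

Lemma D_abs_contS a b s t g : a <= s -> t <= b ->
  D_abs_cont d a0 b0 a b g -> D_abs_cont d a0 b0 s t g.
Proof.
exact: (@abs_cont_itvS R a b s t (fun u v => cone_dist d a0 b0 (g u) (g v))).
Qed.

Lemma cone_abs_cont_alpha a b g : D_abs_cont d a0 b0 a b g -> abs_cont_on a b (al g).
Proof.
move=> ac; apply: (@abs_cont_itv_le _ a b 1 (fun u v => cone_dist d a0 b0 (g u) (g v)) _ _ _ ac) => // u v _ _ _.
by rewrite mul1r cone_distE distrC lerDl dist_ge0.
Qed.

Lemma cone_abs_cont a b g l z (Phi phi : R -> R) : a <= b -> 0 <= l ->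
  D_abs_cont d a0 b0 a b g ->
  (forall s t, a <= s -> s < t -> t <= b -> al g s < al g t) ->
  (forall s, I s -> {for s, continuous phi}) ->
  (forall s, I s -> is_derive s 1 Phi (phi s)) ->
  abs_cont_on a b (fun t => Phi (al g t) - l * d z (be g t)).
Proof.
move=> ab l0 ac inc cphi dPhi.
have incW s t : a <= s -> s <= t -> t <= b -> al g s <= al g t.
  by move=> as_; rewrite le_eqVlt => /predU1P[-> //|st tb]; rewrite ltW// inc.
have [M M0 HM] := in_I_lipschitz (calpha_in g a) (calpha_in g b) cphi dPhi.
apply: (@abs_cont_itv_le _ a b (M + l) (fun u v => cone_dist d a0 b0 (g u) (g v)) _ _ _ ac); first by lra.
move=> u v au uv vb.
have aua := incW a u (lexx _) au (le_trans uv vb).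
have auv := incW u v au uv vb.
have avb := incW v b (le_trans au uv) vb (lexx _).
have := HM _ _ aua auv avb.
have -> : Phi (al g v) - l * d z (be g v) - (Phi (al g u) - l * d z (be g u)) =
  (Phi (al g v) - Phi (al g u)) - l * (d z (be g v) - d z (be g u)) by ring.
move=> h; apply: le_trans (ler_normB _ _) _.
rewrite normrM (ger0_norm l0).
have : `|d z (be g v) - d z (be g u)| <= d (be g u) (be g v).
  rewrite ler_norml; have := dist_tri hd (be g u) z (be g v); have := dist_tri hd (be g v) z (be g u).
  by rewrite (dist_sym hd (be g v)) => *; apply/andP; split; lra.
rewrite cone_distE [X in (M + l) * (X + _)]distrC (ger0_norm (_ : 0 <= al g v - al g u)) ?subr_ge0//.
have d0 := dist_ge0 hd (be g u) (be g v).
move=> /(ler_wpM2l l0) h2; apply: le_trans (lerD h h2) _.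
have h3 : 0 <= M * d (be g u) (be g v) by rewrite mulr_ge0// ltW.
have h4 : 0 <= l * (al g v - al g u) by rewrite mulr_ge0// subr_ge0.
move: h3 h4; clear; move: (al g v - al g u) (d (be g u) (be g v)) => A B h3 h4.
lra.
Qed.

(** Causality leaves the direction of monotonicity open; a derivative that is positive almost
    everywhere excludes a decreasing [al g], by absolute continuity. *)
Lemma fd_increasing a b g : cone_causal d a0 b0 f a b g -> future_directed a0 b0 a b g ->
  forall s t, a <= s -> s < t -> t <= b -> al g s < al g t.
Proof.
move=> [ab ac [//|dec] ae1] ae2.
have : al g a <= al g b.
  apply: (ae_nondecreasing (ltW ab) (cone_abs_cont_alpha ac)).
  have FF : Filter (nbhs (almost_everywhere mu)) := ae_filter_ringOfSetsType mu.
  apply: filterS2 ae1 ae2 => t h1 h2 tab e e0; have [da _ _] := h1 tab.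
  by apply: (cvgr_ge _ (derivable_quot da)); have := h2 tab; lra.
by have := dec a b (lexx _) ab (lexx _); lra.
Qed.

Lemma causal_speed g t : 0 < derive1 (al g) t -> mder_exists d a0 b0 g t ->
  - derive1 (al g) t ^+ 2 + f (al g t) ^+ 2 * mder d a0 b0 g t ^+ 2 <= 0 ->
  f (al g t) * mder d a0 b0 g t <= derive1 (al g) t.
Proof.
move=> a'0 /mder_ge0 m0 h; have f0 := fpos (calpha_in g t).
rewrite -(@ler_pXn2r _ 2)// ?nnegrE; first by rewrite exprMn; lra.
- by rewrite mulr_ge0// ltW.
- exact: ltW.
Qed.

Variable F : R -> R.
Hypothesis dF : forall t, I t -> is_derive t 1 F (f t)^-1.

(** Causality makes the lower derivative of F(alpha) - d(beta s, beta) nonnegative almost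
    everywhere, so this function does not decrease. *)
Lemma fd_causal_dist_le a b g : cone_causal d a0 b0 f a b g -> future_directed a0 b0 a b g ->
  forall s t, a <= s -> s <= t -> t <= b -> d (be g s) (be g t) <= F (al g t) - F (al g s).
Proof.
move=> cau fd s t as_ st tb; have inc := fd_increasing cau fd; have [ab ac _ ae1] := cau.
have := @ae_nondecreasing R s t (fun u => F (al g u) - 1 * d (be g s) (be g u)) st.
rewrite !mul1r distxx// => H; suff : F (al g s) - 0 <= F (al g t) - d (be g s) (be g t) by lra.
apply: H.
  apply: (@cone_abs_cont s t g 1 (be g s) F (fun s => (f s)^-1)) => //.
  - exact: D_abs_contS as_ tb ac.
  - by move=> u v su uv vt; apply: inc => //; [exact: le_trans su|exact: le_trans tb].
  - by move=> u Iu; apply: inv_continuous; [exact: fcont|exact: fpos].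
have FF : Filter (nbhs (almost_everywhere mu)) := ae_filter_ringOfSetsType mu.
apply: filterS2 ae1 fd => u h1 h2 /andP[su ut] e e0.
have uab : a <= u <= b by apply/andP; split; lra.
have [da dm ineq] := h1 uab; have a'0 := h2 uab.
have := cone_lower_derivative (be g s) ler01 (dF (calpha_in g u)) da dm e0.
apply: filterS => h; apply: le_trans.
have := causal_speed a'0 dm ineq; rewrite -ler_pdivlMl ?fpos ?calpha_in//; lra.
Qed.

(** Equality would make [psi] constant on [a, b], while its lower derivative is positive at any one
    point where the timelike condition holds. *)
Lemma fd_timelike_dist_lt a b g : cone_timelike d a0 b0 f a b g -> future_directed a0 b0 a b g ->
  d (be g a) (be g b) < F (al g b) - F (al g a).
Proof.
move=> [ab ac mono ae1] fd.
have FF : Filter (nbhs (almost_everywhere mu)) := ae_filter_ringOfSetsType mu.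
have cau : cone_causal d a0 b0 f a b g.
  split => //; apply: filterS ae1 => t H /H[h1 h2 h3]; split => //; exact: ltW.
have le := fd_causal_dist_le cau fd.
rewrite lt_neqAle le ?lexx ?(ltW ab)// andbT; apply/eqP => E.
pose psi u := F (al g u) - 1 * d (be g a) (be g u).
have psiE u : a <= u -> u <= b -> psi u = F (al g a).
  move=> au ub; rewrite /psi mul1r; apply/eqP; rewrite eq_le.
  have := le u b au ub (lexx _); have := le a u (lexx _) au ub.
  by have := dist_tri hd (be g u) (be g a) (be g b) => *; apply/andP; split; lra.
have [t [/andP[at_ tb] []]] := ae_itv_exists ab (filterI ae1 fd).
have tab : a <= t <= b by rewrite !ltW.
move=> /(_ tab)[da dm ineq] /(_ tab) a'0.
pose k := (f (al g t))^-1 * derive1 (al g) t - 1 * mder d a0 b0 g t.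
have k0 : 0 < k.
  have f0 := fpos (calpha_in g t); rewrite /k mul1r subr_gt0 ltr_pdivlMl//.
  rewrite -(@ltr_pXn2r _ 2)// ?nnegrE ?exprMn; [lra| |exact: ltW].
  by rewrite mulr_ge0 ?mder_ge0// ltW.
have k20 : 0 < k / 2 by lra.
have := cone_lower_derivative (be g a) ler01 (dF (calpha_in g t)) da dm k20.
rewrite -/k -/(psi t).
have : \forall h \near (0 : R)^', `|h| < Order.min (t - a) (b - t).
  apply: dnbhs0_lt; rewrite lt_min; apply/andP; split; lra.
move=> near1 near2; have [h [h1 h2]] := filter_ex (filterI near1 near2).
move: h1 h2; rewrite lt_min !ltr_norml => /andP[/andP[h1 h2] /andP[h3 h4]].
by rewrite -/(psi (t + h)) !psiE; lra.
Qed.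

(** The pointwise duality [lspeed_dual] bounds the integrand by the lower derivative of [psi], and
    [ae_integral_le_increment] integrates this without measurability. *)
Lemma fd_causal_length_le a b g l (Phi : R -> R) : 0 <= l ->
  cone_causal d a0 b0 f a b g -> future_directed a0 b0 a b g ->
  (forall t, I t -> is_derive t 1 Phi (lspeed (f t) l + l * vspeed (f t) l)) ->
  (cone_length d a0 b0 f a b g <=
    (Phi (al g b) - Phi (al g a) - l * d (be g a) (be g b))%:E)%E.
Proof.
move=> l0 cau fd dPhi; have inc := fd_increasing cau fd; have [ab ac _ ae1] := cau.
pose psi u := Phi (al g u) - l * d (be g a) (be g u).
have -> : Phi (al g b) - Phi (al g a) - l * d (be g a) (be g b) = psi b - psi a.
  by rewrite /psi distxx//; ring.
apply: ae_integral_le_increment => //.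
  apply: (@cone_abs_cont a b g l (be g a) Phi (fun t => lspeed (f t) l + l * vspeed (f t) l)) => //.
    exact: ltW.
  move=> s Is; apply: cvgD; first by apply: lspeed_continuous; [exact: fcont|exact: fpos].
  apply: cvgM; first exact: cvg_cst.
  by apply: vspeed_continuous; [exact: fcont|exact: fpos].
have FF : Filter (nbhs (almost_everywhere mu)) := ae_filter_ringOfSetsType mu.
apply: filterS2 ae1 fd => u h1 h2 uab e e0.
have [da dm ineq] := h1 uab; have a'0 := h2 uab.
have := cone_lower_derivative (be g a) l0 (dPhi _ (calpha_in g u)) da dm e0.
apply: filterS => h; apply: le_trans.
have := lspeed_dual (fpos (calpha_in g u)) l0 (mder_ge0 dm) (causal_speed a'0 dm ineq).
lra.
Qed.

End ConeCurves.

(** * Cone curves over broken geodesics *)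

Section OffFiniteSets.
Context {R : realType}.
Local Notation mu := (@lebesgue_measure R).
Implicit Types (a b t s : R).

Lemma finite_seq_null (r : seq R) : measurable [set t : R | t \in r] /\ mu [set t : R | t \in r] = 0%E.
Proof.
have cr : countable [set t : R | t \in r].
  by apply: finite_set_countable; exact: finite_seq.
split; last exact: countable_lebesgue_measure0.
by apply: countable_measurable => // t; exact: measurable_set1.
Qed.

Lemma ae_notin (r : seq R) : {ae mu, forall t, t \notin r}.
Proof.
have [mr r0] := finite_seq_null r.
by exists [set t : R | t \in r]; split => // t /= /negP; rewrite negbK.
Qed.

(** As [g] may fail to be measurable, the finite set is removed from the integral of the continuous
    [eta]; then simple functions below [eta] are below [g]. *)
Lemma integral_le_off_seq a b (r : seq R) (eta g : R -> R) :
  {within `[a, b], continuous eta} -> (forall t, a <= t <= b -> 0 <= eta t) ->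
  (forall t, a <= t <= b -> 0 <= g t) ->
  (forall t, a <= t <= b -> t \notin r -> eta t <= g t) ->
  (\int[mu]_(t in `[a, b]) (eta t)%:E <= \int[mu]_(t in `[a, b]) (g t)%:E)%E.
Proof.
move=> ceta eta0 g0 le; have [mr r0] := finite_seq_null r.
have ieta : mu.-integrable `[a, b] (EFin \o eta).
  by apply: continuous_compact_integrable => //; exact: segment_compact.
rewrite [leLHS](@negligible_integral _ _ R mu `[a, b]%classic [set t : R | t \in r] (EFin \o eta) mr (measurable_itv _) ieta r0).
rewrite integral_mkcond [leRHS]integral_mkcond !ge0_integralTE; first last.
- move=> x; rewrite patchE; case: ifPn => //; rewrite inE => -[/= xab _].
  by rewrite lee_fin eta0//; move: xab; rewrite in_itv.
- by move=> x; rewrite patchE; case: ifPn => //; rewrite inE/= in_itv/= lee_fin => /g0.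
apply: le_ereal_sup => _ [h hle <-]; exists h => // x; apply: le_trans (hle x) _.
rewrite !patchE; case: ifPn => [|_].
  rewrite inE => -[/= xab /negP xr]; rewrite mem_set// lee_fin.
  by apply: le => //; move: xab; rewrite in_itv.
by case: ifPn => //; rewrite inE/= in_itv/= lee_fin => /g0.
Qed.

Lemma seq_preimage a b (phi : R -> R) (r : seq R) :
  {in `[a, b] &, injective phi} ->
  exists r' : seq R, forall t, a <= t <= b -> t \notin r' -> phi t \notin r.
Proof.
move=> inj; elim: r => [|u r [r' Hr']]; first by exists [::].
have [[s sab su]|nex] := pselect (exists2 s, a <= s <= b & phi s = u).
  exists (s :: r') => t tab; rewrite !inE !negb_or => /andP[ts tr].
  rewrite Hr'// andbT; apply: contra ts => /eqP tu; apply/eqP; apply: inj; rewrite ?in_itv//.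
  by rewrite tu.
exists r' => t tab tr; rewrite inE negb_or Hr'// andbT; apply/eqP => tu.
by apply: nex; exists t.
Qed.

End OffFiniteSets.

Section ScaledCurve.
Context {R : realType} {X : Type} (d : X -> X -> R) (a0 b0 : \bar R).
Hypotheses (hd : is_metric d).
Local Notation I := (in_I a0 b0).
Local Notation Y := (@cone R X a0 b0).
Local Notation al := (calpha a0 b0).
Local Notation be := (cbeta a0 b0).
Local Notation mu := (@lebesgue_measure R).
Implicit Types (g : R -> Y) (a b s t u v l : R).

Variables (t t' : R) (x x' : X) (W w : R -> R) (c : R -> X).
Hypotheses (It : I t) (It' : I t') (tt' : t < t').
Hypothesis dW : forall s, I s -> is_derive s 1 W (w s).
Hypothesis cw : forall s, I s -> {for s, continuous w}.
(** In the first case [W] is injective, so the finitely many corners pull back to finitely many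
    times; the second is the constant curve, met when the scaling factor is 0. *)
Hypothesis w0 : (forall s, I s -> 0 < w s) \/ (forall s, I s -> w s = 0).
Hypothesis hc : broken_geodesic d c (W t' - W t) x x'.

Let Iin u : t <= u -> u <= t' -> I u. Proof. exact: in_I_itv. Qed.

Let dzero u : is_derive u 1 (fun _ : R => 0 : R) 0.
Proof. exact: is_derive_cst. Qed.

Let W_le u v : t <= u -> u <= v -> v <= t' -> W u <= W v.
Proof.
move=> tu uv vt.
have Iuv s : u <= s <= v -> I s by move=> /andP[us sv]; apply: Iin; lra.
have := @derivative_le R _ W _ w u v uv (fun s _ => dzero s) (fun s h => dW (Iuv s h)).
have wge s : u <= s <= v -> 0 <= w s by move=> /Iuv Is; case: w0 => [/(_ s Is)/ltW|->].
by move=> /(_ wge); rewrite subrr subr_ge0.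
Qed.

Let W_dist u v : t <= u -> u <= v -> v <= t' -> d (c (W u - W t)) (c (W v - W t)) <= W v - W u.
Proof.
move=> tu uv vt; have [_ _ _ lip _] := hc.
have := lip (W u - W t) (W v - W t); rewrite subr_ge0 !lerD2r.
have -> : W v - W t - (W u - W t) = W v - W u by ring.
by apply; apply: W_le => //; lra.
Qed.

Let W_isometric : exists r : seq R, forall s, t < s < t' -> s \notin r ->
  \forall h \near (0 : R)^',
    d (c (W (s + h) - W t)) (c (W s - W t)) = `|W (s + h) - W s|.
Proof.
have near s : t < s < t' -> \forall h \near (0 : R)^', t <= s + h <= t'.
  move=> /andP[ts st].
  have : \forall h \near (0 : R)^', `|h| < Order.min (s - t) (t' - s).
    by apply: dnbhs0_lt; rewrite lt_min; apply/andP; split; lra.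
  apply: filterS => h; rewrite lt_min !ltr_norml => /andP[/andP[h1 h2] /andP[h3 h4]].
  by apply/andP; split; lra.
case: w0 => [wpos|wzero]; last first.
  exists [::] => s sI _; have := near s sI; apply: filterS => h th.
  have tst : t <= s <= t' by case/andP: sI => *; rewrite !ltW.
  have Wconst u : t <= u <= t' -> W u = W t.
    move=> /andP[tu ut]; have := @derivative_le R W _ w _ t u tu.
    have Itu r : t <= r <= u -> I r by move=> /andP[tr ru]; apply: Iin; lra.
    move=> /(_ _ _ (fun r h => dW (Itu r h)) (fun r _ => dzero r)).
    have wr r : t <= r <= u -> w r <= 0 by move=> /Itu /wzero ->.
    move=> /(_ wr); have := W_le (lexx t) tu ut; lra.
  by rewrite !Wconst// distxx// !subrr normr0.
have inj : {in `[t, t'] &, injective (fun s => W s - W t)}.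
  move=> u v; rewrite !in_itv/= => uI vI /addIr.
  wlog uv : u v uI vI / u <= v => [H|].
    by have [uv|/ltW vu] := leP u v; [exact: H|move=> /esym E; apply/esym; exact: H].
  move=> E; apply/eqP; move: uv; rewrite le_eqVlt => /orP[//|uv]; exfalso.
  have Iuv s : u <= s <= v -> I s.
    move: uI vI => /andP[? ?] /andP[? ?] /andP[us sv]; apply: Iin; lra.
  have := @derivative_lt R _ W _ w u v uv (fun s _ => dzero s) (fun s h => dW (Iuv s h)).
  by move=> /(_ (fun s h => wpos s (Iuv s h))); rewrite E subrr subrr ltxx.
have [_ _ _ _ [bad Hbad]] := hc.
have [r Hr] := seq_preimage bad inj.
exists r => s sI sr; have tst : t <= s <= t' by case/andP: sI => *; rewrite !ltW.
have Wlt u v : t <= u -> u < v -> v <= t' -> W u < W v.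
  move=> tu uv vt; have := W_le tu (ltW uv) vt; rewrite le_eqVlt => /orP[/eqP E|//].
  have := inj u v; rewrite !in_itv/= E => /(_ _ _ erefl) uvE.
  have : u = v by apply: uvE; apply/andP; split; lra.
  lra.
have [ts st] := andP sI.
have [|e e0 He] := Hbad (W s - W t) _ (Hr s tst sr).
  by apply/andP; split; [rewrite subr_gt0|rewrite ltrD2r]; apply: Wlt => //; exact: ltW.
have [del del0 Hdel] := in_I_continuous dW (Iin (ltW ts) (ltW st)) e0.
have : \forall h \near (0 : R)^', `|h| < del by exact: dnbhs0_lt.
have := near s sI; apply: filterS2 => h sh hdel.
have [tsh sht] := andP sh.
have E : W (s + h) - W t - (W s - W t) = W (s + h) - W s by ring.
have := He (W (s + h) - W t); rewrite E; apply.
  by rewrite subr_ge0 lerD2r !W_le.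
by apply: Hdel; rewrite addrC addKr.
Qed.

Lemma scaled_curve : exists g, [/\
  (forall s, I s -> al g s = s), be g t = x /\ be g t' = x',
  (forall u v, t <= u -> u <= v -> v <= t' -> d (be g u) (be g v) <= W v - W u),
  D_abs_cont d a0 b0 t t' g &
  exists r : seq R, forall s, t < s < t' -> s \notin r -> mquot d a0 b0 g s @ 0^' --> w s].
Proof.
(* The default value of [insubd], taken only at times outside [I]. *)
pose y0 : Y := exist _ (t, x) It.
pose g s : Y := insubd y0 (s, c (W s - W t)).
have gE s : I s -> val (g s) = (s, c (W s - W t)) by move=> Is; exact: insubdK.
have alE s : I s -> al g s = s by move=> Is; rewrite /calpha gE.
have beE s : I s -> be g s = c (W s - W t) by move=> Is; rewrite /cbeta gE.
have [_ c0 cl _ _] := hc.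
exists g; split => //.
- by rewrite !beE// subrr c0 cl.
- by move=> u v tu uv vt; rewrite !beE ?W_dist//; apply: Iin; lra.
- have [M M0 HM] := in_I_lipschitz It It' cw dW.
  have M10 : 0 < 1 + M by lra.
  apply: (@abs_cont_itv_le R t t' (1 + M) _ (fun u v => cone_dist d a0 b0 (g u) (g v)) M10 _ (@abs_cont_itv_id R t t')).
  move=> u v tu uv vt; rewrite cone_distE.
  have Iu : I u by apply: Iin; lra.
  have Iv : I v by apply: Iin; lra.
  rewrite !alE// !beE// distrC ger0_norm ?subr_ge0//.
  have := HM u v tu uv vt; have := ler_norm (W v - W u); have := W_dist tu uv vt; lra.
have [r Hr] := W_isometric.
exists r => s sI sr; have [ts st] := andP sI.
have Is : I s by apply: Iin; exact: ltW.
have [dWs W's] := dW Is.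
have lim : (fun h => `|h^-1 * (W (s + h) - W s)|) @ 0^' --> w s.
  have ws : 0 <= w s by case: w0 => [/(_ s Is)/ltW|->].
  rewrite -[X in _ --> X](ger0_norm ws) -W's -derive1E.
  exact: cvg_norm (derivable_quot dWs).
apply: cvg_trans lim; apply: near_eq_cvg.
have : \forall h \near (0 : R)^', I (s + h).
  have [e e0 He] := in_I_open Is.
  have : \forall h \near (0 : R)^', `|h| < e by exact: dnbhs0_lt.
  by apply: filterS => h he; apply: He; rewrite addrC addKr.
have := Hr s sI sr; apply: filterS2 => h E Ish.
by rewrite mquotE !beE// E normrM normfV mulrC.
Qed.

End ScaledCurve.

(** * The causal and timelike relations of the cone *)

Section ConeRelations.
Context {R : realType} {X : Type} (d : X -> X -> R) (a0 b0 : \bar R) (f : R -> R).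
Hypotheses (hd : is_metric d) (hlen : length_space d) (hlc : dlocally_compact d).
Hypothesis fpos : forall t, in_I a0 b0 t -> 0 < f t.
Hypothesis fcont : forall t, in_I a0 b0 t -> {for t, continuous f}.
Local Notation I := (in_I a0 b0).
Local Notation Y := (@cone R X a0 b0).
Local Notation al := (calpha a0 b0).
Local Notation be := (cbeta a0 b0).
Local Notation mu := (@lebesgue_measure R).
Local Notation tm y := ((val y).1).
Local Notation ps y := ((val y).2).
Implicit Types (g : R -> Y) (a b s t u v l : R) (y z : Y).

Lemma cone_eq y z : tm y = tm z -> ps y = ps z -> y = z.
Proof.
move=> h1 h2; apply: val_inj; case: (val y) (val z) h1 h2 => [? ?] [? ?] /= -> ->; by [].
Qed.

Lemma tm_in y : I (tm y). Proof. exact: (valP y). Qed.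

Section Graph.
Variables (g : R -> Y) (t t' : R) (w : R -> R).
Hypotheses (It : I t) (It' : I t') (tt' : t < t').
Hypothesis alE : forall s, I s -> al g s = s.
Hypothesis ac : D_abs_cont d a0 b0 t t' g.
Hypothesis w0 : forall s, I s -> 0 <= w s.
Hypothesis mq : exists r : seq R, forall s, t < s < t' -> s \notin r ->
  mquot d a0 b0 g s @ 0^' --> w s.

Let alD s : I s -> derivable (al g) s 1 /\ derive1 (al g) s = 1.
Proof.
move=> Is; have : is_derive s 1 (al g) 1.
  apply: near_eq_is_derive (is_derive_id s (1 : R)).
  by have := in_I_near Is; apply: filterS => u Iu; rewrite alE.
by move=> [h1 h2]; split => //; rewrite derive1E.
Qed.

Let mderE : exists r : seq R, forall s, t <= s <= t' -> s \notin r ->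
  mder_exists d a0 b0 g s /\ mder d a0 b0 g s = w s.
Proof.
(* The endpoints join the exceptional set because [mq] speaks of interior times. *)
have [r Hr] := mq; exists [:: t, t' & r] => s /andP[ts st].
rewrite !inE !negb_or => /and3P[nt nt' sr].
have mw : mquot d a0 b0 g s @ 0^' --> w s.
  by apply: Hr => //; rewrite !lt_neqAle ts st nt' eq_sym nt.
by split; [exists (w s)|rewrite /mder; exact: (cvg_lim _ mw)].
Qed.

Let alI s : t <= s <= t' -> I s. Proof. by move=> /andP[]; exact: in_I_itv. Qed.

Let graph_increasing : forall s u, t <= s -> s < u -> u <= t' -> al g s < al g u.
Proof. by move=> s u ts su ut; rewrite !alE//; apply: alI; lra. Qed.

Lemma graph_future_directed : future_directed a0 b0 t t' g.
Proof.
have FF : Filter (nbhs (almost_everywhere mu)) := ae_filter_ringOfSetsType mu.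
apply: (filterS _ (ae_notin [::])) => s _ /alI Is.
by have [_ ->] := alD Is; exact: ltr01.
Qed.

Lemma graph_causal : (forall s, I s -> w s <= (f s)^-1) -> cone_causal d a0 b0 f t t' g.
Proof.
move=> wf; split => //; first by left.
have [r Hr] := mderE.
have FF : Filter (nbhs (almost_everywhere mu)) := ae_filter_ringOfSetsType mu.
apply: filterS (ae_notin r) => s sr tst; have Is := alI tst.
have [h1 h2] := alD Is; have [h3 h4] := Hr s tst sr.
split => //; rewrite h2 h4 alE// -exprMn expr1n.
have f0 := fpos Is; have wfs := wf s Is; have w0s := w0 Is.
have : f s * w s <= 1 by rewrite -ler_pdivlMl// mulr1.
have : 0 <= f s * w s by rewrite mulr_ge0// ltW.
nra.
Qed.

Lemma graph_timelike : (forall s, I s -> w s < (f s)^-1) -> cone_timelike d a0 b0 f t t' g.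
Proof.
move=> wf; split => //; first by left.
have [r Hr] := mderE.
have FF : Filter (nbhs (almost_everywhere mu)) := ae_filter_ringOfSetsType mu.
apply: filterS (ae_notin r) => s sr tst; have Is := alI tst.
have [h1 h2] := alD Is; have [h3 h4] := Hr s tst sr.
split => //; rewrite h2 h4 alE// -exprMn expr1n.
have f0 := fpos Is; have wfs := wf s Is; have w0s := w0 Is.
have : f s * w s < 1 by rewrite -ltr_pdivlMl// mulr1.
have : 0 <= f s * w s by rewrite mulr_ge0// ltW.
nra.
Qed.

Lemma graph_length_ge (Phi eta : R -> R) :
  (forall s, I s -> is_derive s 1 Phi (eta s)) -> (forall s, I s -> {for s, continuous eta}) ->
  (forall s, I s -> 0 <= eta s) ->
  (forall s, I s -> eta s <= Num.sqrt (1 - f s ^+ 2 * w s ^+ 2)) ->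
  ((Phi t' - Phi t)%:E <= cone_length d a0 b0 f t t' g)%E.
Proof.
move=> dPhi ceta eta0 etale; have [r Hr] := mderE.
have cwithin : {within `[t, t'], continuous eta}.
  apply: continuous_in_subspaceT => s; rewrite inE/= in_itv/= => tst.
  by apply: ceta; exact: alI.
have cPhi s : I s -> {for s, continuous Phi}.
  by move=> /dPhi[h _]; apply: differentiable_continuous; exact/derivable1_diffP.
have <- : (\int[mu]_(s in `[t, t']) (eta s)%:E = (Phi t' - Phi t)%:E)%E.
  rewrite EFinB; apply: continuous_FTC2 => //.
    split.
    - move=> s; rewrite in_itv/= => /andP[ts st].
      by have [] := dPhi s (alI (introT andP (conj (ltW ts) (ltW st)))).
    - exact: cvg_at_right_filter (cPhi t It).
    - exact: cvg_at_left_filter (cPhi t' It').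
  move=> s; rewrite in_itv/= => /andP[ts st].
  have [_ <-] := dPhi s (alI (introT andP (conj (ltW ts) (ltW st)))).
  by rewrite derive1E.
apply: (@integral_le_off_seq R t t' r eta) => //.
- by move=> s /alI; exact: eta0.
- move=> s tst sr; have Is := alI tst.
  have [h1 h2] := alD Is; have [h3 h4] := Hr s tst sr.
  by rewrite h2 h4 alE// expr1n; exact: etale.
Qed.

End Graph.

Variable F : R -> R.
Hypothesis dF : forall t, I t -> is_derive t 1 F (f t)^-1.

Lemma F_lt t u : I t -> I u -> t < u -> F t < F u.
Proof.
move=> It Iu tu.
have Itu s : t <= s <= u -> I s by move=> /andP[]; exact: in_I_itv.
have := @derivative_lt R (fun=> 0) F (fun=> 0) _ t u tu (fun s _ => is_derive_cst 0 s 1) (fun s h => dF (Itu s h)).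
rewrite subrr subr_gt0; apply => s /Itu /fpos; rewrite invr_gt0//.
Qed.

Lemma F_le t u : I t -> I u -> t <= u -> F t <= F u.
Proof. by move=> It Iu; rewrite le_eqVlt => /predU1P[->//|/(F_lt It Iu)/ltW]. Qed.

Lemma invf_continuous s : I s -> {for s, continuous (fun t => (f t)^-1)}.
Proof. by move=> Is; apply: inv_continuous; [exact: fcont|exact: fpos]. Qed.

Lemma fd_tm_lt y z a b g : cone_fd_causal_from_to d a0 b0 f y z a b g -> tm y < tm z.
Proof.
move=> [cau fd <- <-]; have [ab _ _ _] := cau.
exact: (fd_increasing hd cau fd (lexx a) ab (lexx b)).
Qed.

(** The fibre part of a causal curve, parametrised by time. Stated through distances instead of
    derivatives, it is stable under concatenation, which makes the causal relation transitive. *)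
Definition fibre_curve (B : R -> X) y z : Prop :=
  [/\ tm y < tm z, B (tm y) = ps y, B (tm z) = ps z &
      forall s s', tm y <= s -> s <= s' -> s' <= tm z -> d (B s) (B s') <= F s' - F s].

Lemma fd_causal_fibre_curve y z a b g :
  cone_fd_causal_from_to d a0 b0 f y z a b g -> exists B, fibre_curve B y z.
Proof.
move=> H; have yz := fd_tm_lt H; have [cau fd gy gz] := H.
have [ab ac _ _] := cau; have inc := fd_increasing hd cau fd.
have le := fd_causal_dist_le hd fpos fcont dF cau fd.
have cal : {within `[a, b], continuous (al g)}.
  apply/subspace_continuousP => t; rewrite /= in_itv/= => /andP[at_ tb].
  apply/cvgrPdist_lt => e e0; have [del del0 Hdel] := cone_abs_cont_alpha hd ac e0.
  rewrite near_withinE; apply/nbhs_ballP; exists del => // s /=; rewrite /ball/= distrC => st.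
  rewrite in_itv/= => /andP[as_ sb]; move: st; rewrite /from_subspace.
  wlog ts : s t at_ tb as_ sb / s <= t => [W|].
    have [st|/ltW ts] := leP s t; first exact: W.
    by rewrite distrC [X in _ -> X < e]distrC; exact: W.
  rewrite distrC ger0_norm ?subr_ge0// => st.
  have := Hdel [:: (s, t)]; rewrite /= !big_cons !big_nil !addr0/= as_ ts tb.
  by apply.
have ay : al g a = tm y by rewrite /calpha gy.
have bz : al g b = tm z by rewrite /calpha gz.
(* The map [i] inverts the time coordinate, which is onto by continuity and one-to-one by strict
   monotonicity. *)
have /choice[i Hi] : forall s, exists u, tm y <= s <= tm z -> a <= u <= b /\ al g u = s.
  move=> s; have [sI|_] := boolP (tm y <= s <= tm z); last by exists 0.
  have [|u uI us] := @IVT R (al g) a b s (ltW ab) cal.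
    by rewrite ay bz min_l ?max_r ?(ltW yz).
  by exists u => _; split => //; move: uI; rewrite in_itv.
have imono s s' : tm y <= s -> s <= s' -> s' <= tm z -> i s <= i s'.
  move=> ys ss' sz; have [|/andP[_ ib] is_] := Hi s; first by rewrite ys; lra.
  have [|/andP[ia _] is'] := Hi s'; first by rewrite sz andbT; lra.
  rewrite leNgt; apply/negP => lt; have := inc _ _ ia lt ib; rewrite is_ is'; lra.
have iE u : a <= u <= b -> i (al g u) = u.
  move=> /andP[au ub].
  have incW s t : a <= s -> s <= t -> t <= b -> al g s <= al g t.
    by move=> as_; rewrite le_eqVlt => /predU1P[-> //|st tb]; rewrite ltW// inc.
  have [|/andP[ia ib] E] := Hi (al g u).
    have := incW a u (lexx _) au ub; have := incW u b au ub (lexx _).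
    by rewrite ay bz => -> ->.
  apply/eqP; rewrite eq_le !leNgt; apply/andP; split; apply/negP => lt.
    by have := inc _ _ au lt ib; rewrite E ltxx.
  by have := inc _ _ ia lt ub; rewrite E ltxx.
exists (fun s => be g (i s)); split => //.
- have := iE a; rewrite ay lexx (ltW ab) => /(_ isT) ->.
  by rewrite /cbeta gy.
- have := iE b; rewrite bz lexx (ltW ab) => /(_ isT) ->.
  by rewrite /cbeta gz.
- move=> s s' ys ss' sz.
  have [|/andP[ia _] is_] := Hi s; first by rewrite ys; lra.
  have [|/andP[_ ib] is'] := Hi s'; first by rewrite sz andbT; lra.
  by have := le _ _ ia (imono s s' ys ss' sz) ib; rewrite is_ is'.
Qed.

(* A broken geodesic from [ps y] to [ps z] is traversed with fibre speed
   [k * w], the constant [k <= 1] being its length over [W (tm z) - W (tm y)]. *)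
Lemma scaled_graph y z c l (W w : R -> R) : tm y < tm z ->
  (forall s, I s -> is_derive s 1 W (w s)) -> (forall s, I s -> {for s, continuous w}) ->
  (forall s, I s -> 0 < w s) -> (forall s, I s -> w s <= (f s)^-1) ->
  broken_geodesic d c l (ps y) (ps z) -> l <= W (tm z) - W (tm y) ->
  exists k g, [/\ 0 <= k <= 1, l < W (tm z) - W (tm y) -> k < 1,
    cone_fd_causal_from_to d a0 b0 f y z (tm y) (tm z) g,
    (forall s, I s -> al g s = s) /\
    (forall s, I s -> 0 <= k * w s) /\
    (forall u v, tm y <= u -> u <= v -> v <= tm z -> d (be g u) (be g v) <= k * (W v - W u)) &
    D_abs_cont d a0 b0 (tm y) (tm z) g /\
    exists r : seq R, forall s, tm y < s < tm z -> s \notin r ->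
      mquot d a0 b0 g s @ 0^' --> k * w s].
Proof.
move=> yz dW cw wpos wf hc lW; have [l0 _ _ _ _] := hc.
have Iy := tm_in y; have Iz := tm_in z.
have D0 : 0 < W (tm z) - W (tm y).
  have Iyz s : tm y <= s <= tm z -> I s by move=> /andP[]; exact: in_I_itv.
  have := derivative_lt yz (fun s _ => is_derive_cst 0 s 1) (fun s h => dW s (Iyz s h)).
  by rewrite subrr; apply => s /Iyz; exact: wpos.
pose k := l / (W (tm z) - W (tm y)).
have k0 : 0 <= k by rewrite divr_ge0// ltW.
have k1 : k <= 1 by rewrite ler_pdivrMr// mul1r.
have dkW s : I s -> is_derive s 1 (fun s => k * W s) (k * w s).
  by move=> Is; exact: (@is_derive_cM R k W w s (dW s Is)).
have ckw s : I s -> {for s, continuous (fun s => k * w s)}.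
  by move=> Is; apply: cvgM; [exact: cvg_cst|exact: cw].
have kw0 : (forall s, I s -> 0 < k * w s) \/ (forall s, I s -> k * w s = 0).
  move: k0; rewrite le_eqVlt => /orP[/eqP k00|kp]; [right|left] => s Is.
    by rewrite -k00 mul0r.
  by rewrite mulr_gt0// wpos.
have lE : k * W (tm z) - k * W (tm y) = l by rewrite -mulrBr /k divfK// gt_eqF.
rewrite -lE in hc.
have [g [alE [gx gz] lip ac mq]] := scaled_curve hd Iy Iz dkW ckw kw0 hc.
have kw0' s : I s -> 0 <= k * w s by move=> Is; rewrite mulr_ge0// ltW// wpos.
exists k, g; split; rewrite ?k0 ?k1//.
- by move=> lt; rewrite ltr_pdivrMr// mul1r.
- split.
  + apply: (graph_causal Iy Iz yz alE ac kw0' mq) => s Is.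
    by apply: le_trans (wf s Is); rewrite ler_piMl// ltW// wpos.
  + exact: graph_future_directed Iy Iz alE.
  + by apply: cone_eq => //; exact: alE.
  + by apply: cone_eq => //; exact: alE.
- by split => //; split => // u v yu uv vz; rewrite mulrBr; exact: lip.
Qed.

(** The case W = F of [scaled_graph], whose fibre speed 1/f is the null one; a length [l] strictly
    below the increment of [F] gives k < 1, hence a timelike curve. *)
Lemma broken_geodesic_graph y z c l : tm y < tm z ->
  broken_geodesic d c l (ps y) (ps z) -> l <= F (tm z) - F (tm y) ->
  exists g, cone_fd_causal_from_to d a0 b0 f y z (tm y) (tm z) g /\
    (l < F (tm z) - F (tm y) -> cone_timelike d a0 b0 f (tm y) (tm z) g).
Proof.
move=> yz hc lF.
have finv s : I s -> 0 < (f s)^-1 by move=> Is; rewrite invr_gt0 fpos.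
have [k [g [/andP[k0 k1] kl fd [alE [kw0 _]] [ac mq]]]] :=
  scaled_graph yz dF invf_continuous finv (fun s _ => lexx _) hc lF.
exists g; split=> // lt; apply: (graph_timelike (tm_in y) (tm_in z) yz alE ac kw0 mq) => s Is.
by rewrite gtr_pMl ?finv//; exact: kl.
Qed.

(** The curve [B] is replaced by an inscribed broken geodesic, whose length is at most the
    telescoping sum of the increments of [F]. *)
Lemma fibre_curve_le B y z : fibre_curve B y z -> cone_le d a0 b0 f y z.
Proof.
move=> [yz By Bz lip]; right.
have Iy := tm_in y; have Iz := tm_in z.
have cB : dcont_on d (tm y) (tm z) B.
  move=> t /andP[yt tz] e e0; have It := in_I_itv Iy Iz yt tz.
  have [del del0 Hdel] := in_I_continuous dF It e0.
  exists del => // s /andP[ys sz] /Hdel; rewrite ltr_norml => /andP[h1 h2].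
  have [st|/ltW ts] := leP s t; first by have := lip s t ys st tz; lra.
  by rewrite dist_sym//; have := lip t s yt ts sz; lra.
have [s ps [c hc]] := inscribed_broken_geodesic hd hlen hlc (ltW yz) cB.
rewrite By Bz in hc.
have [|g [H _]] := broken_geodesic_graph yz hc; last by exists (tm y), (tm z), g.
rewrite -(sum_steps_telescope F ps) big_seq [leRHS]big_seq; apply: ler_sum => p pin.
by have [h1 h2 h3] := steps_itv ps pin; apply: lip => //; exact: ltW.
Qed.

Lemma cone_leP y z : cone_le d a0 b0 f y z <-> y = z \/ exists B, fibre_curve B y z.
Proof.
split=> [[->|[a [b [g H]]]]|[->|[B HB]]]; [by left| |by left|exact: fibre_curve_le HB].
by right; exact: fd_causal_fibre_curve H.
Qed.

Lemma cone_llP y z : cone_ll d a0 b0 f y z <->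
  tm y < tm z /\ d (ps y) (ps z) < F (tm z) - F (tm y).
Proof.
split=> [[a [b [g [tl fd gy gz]]]]|[yz lt]].
  have lt := fd_timelike_dist_lt hd fpos fcont dF tl fd.
  have [ab ac mono ae1] := tl.
  have cau : cone_causal d a0 b0 f a b g.
    have FF : Filter (nbhs (almost_everywhere mu)) := ae_filter_ringOfSetsType mu.
    split => //; apply: filterS ae1 => t H /H[h1 h2 h3]; split => //; exact: ltW.
  have H : cone_fd_causal_from_to d a0 b0 f y z a b g by split.
  by split; [exact: fd_tm_lt H|move: lt; rewrite /calpha /cbeta gy gz].
have [c [l [lF hc]]] := broken_geodesic_exists hd hlen hlc lt.
have [g [[cau fd gy gz] tl]] := broken_geodesic_graph yz hc (ltW lF).
by exists (tm y), (tm z), g; split => //; exact: tl.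
Qed.

End ConeRelations.

(** * The time separation *)

Section Multipliers.
Context {R : realType} (a0 b0 : \bar R) (f : R -> R).
Hypothesis fpos : forall t, in_I a0 b0 t -> 0 < f t.
Hypothesis fcont : forall t, in_I a0 b0 t -> {for t, continuous f}.
Local Notation I := (in_I a0 b0).
Variables (F : R -> R) (V H : R -> R -> R).
Hypothesis dF : forall t, I t -> is_derive t 1 F (f t)^-1.
Hypothesis dV : forall l t, I t -> is_derive t 1 (V l) (vspeed (f t) l).
Hypothesis dH : forall l t, I t -> is_derive t 1 (H l) (lspeed (f t) l).
Implicit Types (t u l m : R).

Section Interval.
Variables (t u : R).
Hypotheses (It : I t) (Iu : I u) (tu : t <= u).

Let Itu s : t <= s <= u -> I s. Proof. by move=> /andP[]; exact: in_I_itv. Qed.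

Let lin (k s : R) : is_derive s 1 (fun x => k * x) k.
Proof. by have := is_deriveZ k (@is_derive_id _ _ s 1); rewrite /GRing.scale/= mulr1. Qed.

(** The price, in Lorentzian length, of enlarging a multiplier from [l] to [m]. *)
Lemma H_lip l m : 0 <= l -> l <= m ->
  (H l u - H l t) - (H m u - H m t) <= (m - l) * (F u - F t).
Proof.
move=> l0 lm.
have dHH s : t <= s <= u -> is_derive s 1 (fun s => H l s - H m s) (lspeed (f s) l - lspeed (f s) m).
  by move=> /Itu Is; have := dH l Is; have := dH m Is => ? ?; exact: is_deriveB.
have dkF s : t <= s <= u -> is_derive s 1 (fun s => (m - l) * F s) ((m - l) * (f s)^-1).
  by move=> /Itu Is; exact: (@is_derive_cM R (m - l) F (fun s => (f s)^-1) s (dF Is)).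
have := derivative_le tu dHH dkF.
move=> /(_ (fun s h => lspeed_mono (fpos (Itu h)) l0 lm)); lra.
Qed.

Lemma V_lip : exists2 C, 0 < C & forall l m, 0 <= l -> l <= m ->
  0 <= (V m u - V m t) - (V l u - V l t) <= (m - l) * C.
Proof.
have [M M0 HM] := continuous_in_I_bounded It Iu (fun s Is => inv_continuous (fcont Is) (fpos Is)).
exists (M ^+ 2 * (u - t) + 1) => [|l m l0 lm].
  by rewrite ltr_wpDl// mulr_ge0 ?sqr_ge0// subr_ge0.
have dVV s : t <= s <= u -> is_derive s 1 (fun s => V m s - V l s) (vspeed (f s) m - vspeed (f s) l).
  by move=> /Itu Is; have := dV l Is; have := dV m Is => ? ?; exact: is_deriveB.
have ge := derivative_le tu (fun s _ => is_derive_cst 0 s 1) dVV.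
have le := derivative_le tu dVV (fun s _ => lin ((m - l) * M ^+ 2) s).
have {}ge := ge (fun s h => proj1 (andP (vspeed_mono (fpos (Itu h)) l0 lm))).
have {}le : V m u - V l u - (V m t - V l t) <= (m - l) * M ^+ 2 * u - (m - l) * M ^+ 2 * t.
  apply: le => s h; have := vspeed_mono (fpos (Itu h)) l0 lm => /andP[_ /le_trans]; apply.
  have f0 := fpos (Itu h); rewrite ler_wpM2l ?subr_ge0// -exprVn ler_pXn2r// ?nnegrE.
  - by have [h1 h2] := andP h; apply: le_trans (ler_norm _) (HM s h1 h2).
  - by rewrite invr_ge0 ltW.
  - exact: ltW.
apply/andP; split; first by lra.
rewrite mulrDr mulr1 mulrA; lra.
Qed.

(** As [l] grows, [V l] exhausts the fibre distance that causality allows. *)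
Lemma V_gap l : 0 < l -> (F u - F t) - (V l u - V l t) <= (u - t) / l.
Proof.
move=> l0.
have dFV s : t <= s <= u -> is_derive s 1 (fun s => F s - V l s) ((f s)^-1 - vspeed (f s) l).
  by move=> /Itu Is; have := dF Is; have := dV l Is => ? ?; exact: is_deriveB.
have := derivative_le tu dFV (fun s _ => lin l^-1 s).
move=> /(_ (fun s h => vspeed_gap (fpos (Itu h)) l0)); rewrite mulrC; lra.
Qed.

Lemma V_le_F l : V l u - V l t <= F u - F t.
Proof.
apply: (derivative_le tu (fun s h => dV l (Itu h)) (fun s h => dF (Itu h))) => s h.
exact/ltW/vspeed_lt/fpos/Itu.
Qed.

Lemma V_zero : V 0 u - V 0 t = 0.
Proof.
have z s : t <= s <= u -> vspeed (f s) 0 = 0 by rewrite /vspeed mul0r.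
have le := derivative_le tu (fun s h => dV 0 (Itu h)) (fun s _ => is_derive_cst 0 s 1).
have ge := derivative_le tu (fun s _ => is_derive_cst 0 s 1) (fun s h => dV 0 (Itu h)).
have {}le := le (fun s h => eq_ind_r (fun x => x <= 0) (lexx 0) (z s h)).
have {}ge := ge (fun s h => eq_ind_r (fun x => 0 <= x) (lexx 0) (z s h)).
lra.
Qed.

Lemma H_bound : exists2 C, 0 < C & forall l, 0 < l -> H l u - H l t <= C / l.
Proof.
have [M M0 HM] := continuous_in_I_bounded It Iu fcont.
exists (M * (u - t) + 1) => [|l l0]; first by rewrite ltr_wpDl// mulr_ge0 ?subr_ge0// ltW.
have := derivative_le tu (fun s h => dH l (Itu h)) (fun s _ => lin (M / l) s).
have le s : t <= s <= u -> lspeed (f s) l <= M / l.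
  move=> h; apply: le_trans (lspeed_le (fpos (Itu h)) l0) _.
  rewrite ler_wpM2r ?invr_ge0 ?(ltW l0)//.
  by have [h1 h2] := andP h; apply: le_trans (ler_norm _) (HM s h1 h2).
move=> /(_ le) {}le; apply: le_trans le _.
have -> : M / l * u - M / l * t = M * (u - t) / l by ring.
by rewrite ler_pM2r ?invr_gt0// lerDl.
Qed.

End Interval.

Lemma V_strict t u l m : I t -> I u -> t < u -> 0 <= l -> l < m ->
  V l u - V l t < V m u - V m t.
Proof.
move=> It Iu tu l0 lm.
have Itu s : t <= s <= u -> I s by move=> /andP[]; exact: in_I_itv.
apply: (derivative_lt tu (fun s h => dV l (Itu s h)) (fun s h => dV m (Itu s h))) => s h.
exact: vspeed_strict (fpos (Itu s h)) l0 lm.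
Qed.

Lemma H_pos t u l : I t -> I u -> t < u -> 0 < H l u - H l t.
Proof.
move=> It Iu tu.
have Itu s : t <= s <= u -> I s by move=> /andP[]; exact: in_I_itv.
have := derivative_lt tu (fun s _ => is_derive_cst 0 s 1) (fun s h => dH l (Itu s h)).
by rewrite subrr; apply => s h; exact: lspeed_gt0 (fpos (Itu s h)).
Qed.

Lemma multiplier_exists t u (D : R) : I t -> I u -> t <= u -> 0 <= D -> D < F u - F t ->
  exists2 l, 0 <= l & V l u - V l t = D.
Proof.
(* By [V_gap] this [L] makes the increment of [V L] at least [D], so the intermediate value theorem
   applies in [l] on [0, L]. The summand 1 makes [L] positive. *)
move=> It Iu tu D0 DF; pose L := (u - t + 1) / (F u - F t - D).
have FD : 0 < F u - F t - D by lra.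
have L0 : 0 < L by rewrite divr_gt0//; lra.
have [C C0 HC] := V_lip It Iu tu.
have cont : {within `[0, L], continuous (fun l => V l u - V l t)}.
  apply/subspace_continuousP => m; rewrite /= in_itv/= => /andP[m0 mL].
  apply/cvgrPdist_lt => e e0; rewrite near_withinE; apply/nbhs_ballP.
  exists (e / C) => /=; first by rewrite divr_gt0.
  move=> l; rewrite /ball/= ltr_pdivlMr// => ml; rewrite in_itv/= => /andP[l0 lL].
  rewrite /from_subspace; wlog lm : l m m0 mL l0 lL ml / l <= m => [W|].
    have [lm|/ltW lm] := leP l m; first exact: W.
    by rewrite distrC; apply: W; rewrite // distrC.
  have /andP[h1 h2] := HC l m l0 lm.
  by rewrite ger0_norm// (le_lt_trans h2)//; move: ml; rewrite ger0_norm// subr_ge0.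
have [|l lI lD] := @IVT R (fun l => V l u - V l t) 0 L D (ltW L0) cont; last first.
  by exists l => //; move: lI; rewrite in_itv/= => /andP[].
rewrite V_zero//; have := V_gap It Iu tu L0.
have -> : (u - t) / L = (u - t) / (u - t + 1) * (F u - F t - D).
  by rewrite /L; field; apply/andP; split; lra.
have : (u - t) / (u - t + 1) * (F u - F t - D) <= F u - F t - D.
  by rewrite ler_piMl ?(ltW FD)// ler_pdivrMr; lra.
by move=> h1 h2; rewrite ge_min le_max; apply/andP; split; apply/orP; [left|right]; lra.
Qed.

End Multipliers.

Section TimeSeparation.
Context {R : realType} {X : Type} (d : X -> X -> R) (a0 b0 : \bar R) (f : R -> R).
Hypotheses (hd : is_metric d) (hlen : length_space d) (hlc : dlocally_compact d).
Hypothesis fpos : forall t, in_I a0 b0 t -> 0 < f t.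
Hypothesis fcont : forall t, in_I a0 b0 t -> {for t, continuous f}.
Local Notation I := (in_I a0 b0).
Local Notation Y := (@cone R X a0 b0).
Local Notation al := (calpha a0 b0).
Local Notation be := (cbeta a0 b0).
Local Notation tm y := ((val y).1).
Local Notation ps y := ((val y).2).
Local Notation D := (cone_dist d a0 b0).
Local Notation le := (cone_le d a0 b0 f).
Local Notation ll := (cone_ll d a0 b0 f).
Local Notation tau := (cone_tau d a0 b0 f).
Variables (F : R -> R) (V H : R -> R -> R).
Hypothesis dF : forall t, I t -> is_derive t 1 F (f t)^-1.
Hypothesis dV : forall l t, I t -> is_derive t 1 (V l) (vspeed (f t) l).
Hypothesis dH : forall l t, I t -> is_derive t 1 (H l) (lspeed (f t) l).
Implicit Types (g : R -> Y) (a b s t u v l m : R) (x y z : Y).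

(* The upper bound for [tau y z] given by the multiplier [l], attained when
   [d (ps y) (ps z) = V l (tm z) - V l (tm y)]. *)
Definition dual l y z : R :=
  H l (tm z) - H l (tm y) + l * (V l (tm z) - V l (tm y) - d (ps y) (ps z)).

Let E l t : R := H l t + l * V l t.

Let dE l t : I t -> is_derive t 1 (E l) (lspeed (f t) l + l * vspeed (f t) l).
Proof.
move=> It; have hH := dH l It.
have hV := @is_derive_cM R l (V l) (fun t => vspeed (f t) l) t (dV l It).
exact: is_deriveD.
Qed.

Let dualE l y z : dual l y z = E l (tm z) - E l (tm y) - l * d (ps y) (ps z).
Proof. by rewrite /dual /E; ring. Qed.

Lemma cone_le_tm y z : le y z -> y = z \/ tm y < tm z.
Proof. by move=> /(cone_leP hd hlen hlc fpos fcont dF)[->|[B [yz _ _ _]]]; [left|right]. Qed.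

Lemma cone_le_tmW y z : le y z -> tm y <= tm z.
Proof. by move=> /cone_le_tm[->//|/ltW]. Qed.

Lemma cone_le_dist y z : le y z -> d (ps y) (ps z) <= F (tm z) - F (tm y).
Proof.
move=> /(cone_leP hd hlen hlc fpos fcont dF)[->|[B [yz <- <- lip]]].
  by rewrite distxx// subrr.
by apply: lip => //; exact: ltW.
Qed.

Lemma cone_llE y z : ll y z <-> tm y < tm z /\ d (ps y) (ps z) < F (tm z) - F (tm y).
Proof. exact: cone_llP. Qed.

Lemma cone_ll_le y z : ll y z -> le y z.
Proof.
move=> /cone_llE[yz lt]; have [c [l [lF hc]]] := broken_geodesic_exists hd hlen hlc lt.
have [g [fd _]] := broken_geodesic_graph hd fpos fcont dF yz hc (ltW lF).
by right; exists (tm y), (tm z), g.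
Qed.

Lemma cone_le_ll x y z : le x y -> ll y z -> ll x z.
Proof.
move=> xy /cone_llE[yz lt]; apply/cone_llE.
have := cone_le_dist xy; have := cone_le_tmW xy; have := dist_tri hd (ps y) (ps x) (ps z).
by move=> *; split; lra.
Qed.

Lemma cone_ll_le_trans x y z : ll x y -> le y z -> ll x z.
Proof.
move=> /cone_llE[xy lt] yz; apply/cone_llE.
have := cone_le_dist yz; have := cone_le_tmW yz; have := dist_tri hd (ps y) (ps x) (ps z).
by move=> *; split; lra.
Qed.

Lemma cone_le_refl y : le y y. Proof. by left. Qed.

Lemma cone_le_trans x y z : le x y -> le y z -> le x z.
Proof.
move=> /(cone_leP hd hlen hlc fpos fcont dF)[->//|[B1 [xy B1x B1y lip1]]].
move=> /(cone_leP hd hlen hlc fpos fcont dF)[<-|[B2 [yz B2y B2z lip2]]].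
  by apply/(cone_leP hd hlen hlc fpos fcont dF); right; exists B1.
apply/(cone_leP hd hlen hlc fpos fcont dF); right.
exists (fun s => if s <= tm y then B1 s else B2 s); split.
- lra.
- by rewrite ltW.
- by rewrite leNgt yz.
- move=> s s' xs ss' sz; case: (leP s (tm y)) => sy; case: (leP s' (tm y)) => s'y.
  + exact: lip1.
  + have := dist_tri hd (ps y) (B1 s) (B2 s').
    have := lip1 s (tm y) xs sy (lexx _); have := lip2 (tm y) s' (lexx _) (ltW s'y) sz.
    by rewrite B1y B2y; lra.
  + lra.
  + by apply: lip2 => //; exact: ltW.
Qed.

Lemma tau_ge0 y z : (0 <= tau y z)%E.
Proof.
rewrite /cone_tau; case: pselect => // -[a [b [g hg]]].
apply: (@le_trans _ _ (cone_length d a0 b0 f a b g)).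
  by apply: integral_ge0 => t _; rewrite lee_fin; exact: sqrtr_ge0.
by apply: ereal_sup_ubound; exists a, b, g.
Qed.

Lemma tau_not_le y z : ~ le y z -> tau y z = 0%E.
Proof. by move=> nle; rewrite /cone_tau; case: pselect => // h; case: nle; right. Qed.

Lemma tau_le_dual l y z : 0 <= l -> le y z -> (tau y z <= (dual l y z)%:E)%E.
Proof.
move=> l0 yz; rewrite /cone_tau; case: pselect => [ex|nex]; last first.
  have yzE : y = z by case: yz.
  suff -> : dual l y z = 0 by [].
  by rewrite yzE /dual !subrr distxx// subrr mulr0 addr0.
apply: ge_ereal_sup => _ [a [b [g [[cau fd gy gz] ->]]]].
have := fd_causal_length_le hd fpos fcont l0 cau fd (dE l).
by rewrite dualE /calpha /cbeta gy gz.
Qed.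

(** A continuous upper bound valid for all pairs, causally related or not: upper semicontinuity of
    [tau] rests on it. *)
Lemma tau_le_max l y z : 0 <= l -> (tau y z <= (Order.max 0 (dual l y z))%:E)%E.
Proof.
move=> l0; have [yz|nyz] := pselect (le y z).
  by apply: le_trans (tau_le_dual l0 yz) _; rewrite lee_fin le_max lexx orbT.
by rewrite tau_not_le// lee_fin le_max lexx.
Qed.

Lemma tau_fin_num y z : tau y z \is a fin_num.
Proof.
by rewrite ge0_fin_numE ?tau_ge0//; apply: le_lt_trans (tau_le_max y z (lexx 0)) _; rewrite ltry.
Qed.

Lemma vspeed_le_inv m s : I s -> vspeed (f s) m <= (f s)^-1.
Proof. by move=> /fpos f0; exact/ltW/vspeed_lt. Qed.

(** If the broken geodesic is shorter than the increment of [V m], it is traversed more slowly; by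
    [lspeed_scaled] this does not reduce the length below the increment of [H m]. *)
Lemma multiplier_graph m y z : 0 < m -> tm y < tm z ->
  forall c l, broken_geodesic d c l (ps y) (ps z) -> l <= V m (tm z) - V m (tm y) ->
  exists g, [/\ cone_fd_causal_from_to d a0 b0 f y z (tm y) (tm z) g,
    (forall s, I s -> al g s = s),
    (forall u v, tm y <= u -> u <= v -> v <= tm z -> d (be g u) (be g v) <= V m v - V m u) &
    ((H m (tm z) - H m (tm y))%:E <= cone_length d a0 b0 f (tm y) (tm z) g)%E].
Proof.
move=> m0 yz c l hc lV; have Iy := tm_in y; have Iz := tm_in z.
have vpos s : I s -> 0 < vspeed (f s) m by move=> /fpos f0; exact: vspeed_gt0.
have cv s : I s -> {for s, continuous (fun t => vspeed (f t) m)}.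
  by move=> Is; apply: vspeed_continuous; [exact: fcont|exact: fpos].
have [k [g [k01 _ fd [alE [kw0 lip]] [ac mq]]]] :=
  scaled_graph hd fpos yz (dV m) cv vpos (vspeed_le_inv m) hc lV.
exists g; split => //.
- move=> u v yu uv vz; apply: le_trans (lip u v yu uv vz) _.
  have Iu : I u := in_I_itv Iy Iz yu (le_trans uv vz).
  have Iv : I v := in_I_itv Iy Iz (le_trans yu uv) vz.
  have Iuv s : u <= s <= v -> I s by move=> /andP[]; exact: in_I_itv.
  have := derivative_le uv (fun s _ => is_derive_cst 0 s 1) (fun s h => dV m (Iuv s h)).
  move=> /(_ (fun s h => ltW (vpos s (Iuv s h)))); rewrite subrr => V0.
  by have [_ k1] := andP k01; rewrite ler_piMl.
- apply: (graph_length_ge Iy Iz yz alE mq (dH m)).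
  + by move=> s Is; apply: lspeed_continuous; [exact: fcont|exact: fpos].
  + by move=> s /fpos f0; exact/ltW/lspeed_gt0.
  + by move=> s /fpos f0; exact: lspeed_scaled.
Qed.

Lemma tau_ge_strict m y z : 0 <= m -> tm y < tm z ->
  d (ps y) (ps z) < V m (tm z) - V m (tm y) -> ((H m (tm z) - H m (tm y))%:E <= tau y z)%E.
Proof.
move=> m0 yz lt; have Iy := tm_in y; have Iz := tm_in z.
have {m0} mpos : 0 < m.
  move: m0; rewrite le_eqVlt => /orP[/eqP m0|//]; exfalso.
  move: lt; rewrite -m0 (V_zero dV Iy Iz (ltW yz)).
  by have := dist_ge0 hd (ps y) (ps z); lra.
have [c [l [lV hc]]] := broken_geodesic_exists hd hlen hlc lt.
have [g [fd _ _ len]] := multiplier_graph mpos yz hc (ltW lV).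
apply: le_trans len _; rewrite /cone_tau; case: pselect => [ex|[]]; last by exists (tm y), (tm z), g.
by apply: ereal_sup_ubound; exists (tm y), (tm z), g.
Qed.

(** In the case of equality a shortest path may be missing. A larger [m'] leaves room for a nearly
    shortest one, and its distance to [m] is chosen so that [H_lip] costs exactly [e]. *)
Lemma tau_ge m y z : 0 <= m -> tm y < tm z ->
  d (ps y) (ps z) <= V m (tm z) - V m (tm y) -> ((H m (tm z) - H m (tm y))%:E <= tau y z)%E.
Proof.
move=> m0 yz le; have Iy := tm_in y; have Iz := tm_in z.
apply/lee_addgt0Pr => e e0.
have C0 : 0 < F (tm z) - F (tm y) by rewrite subr_gt0 (F_lt fpos dF).
pose m' := m + e / (F (tm z) - F (tm y)).
have mm' : m < m' by rewrite ltrDl divr_gt0.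
have := tau_ge_strict (le_trans m0 (ltW mm')) yz (le_lt_trans le (V_strict fpos dV Iy Iz yz m0 mm')).
have := H_lip fpos dF dH Iy Iz (ltW yz) m0 (ltW mm').
have -> : (m' - m) * (F (tm z) - F (tm y)) = e by rewrite /m' addrC addKr divfK// gt_eqF.
move=> h1 h2; apply: le_trans (_ : (H m' (tm z) - H m' (tm y))%:E + e%:E <= _)%E.
  by rewrite -EFinD lee_fin; lra.
by rewrite leeD2r.
Qed.

Lemma ll_multiplier y z : ll y z -> exists2 l, 0 <= l &
  V l (tm z) - V l (tm y) = d (ps y) (ps z) /\ tau y z = (H l (tm z) - H l (tm y))%:E.
Proof.
move=> yz; have [lt dlt] := (cone_llE y z).1 yz; have Iy := tm_in y; have Iz := tm_in z.
have [l l0 Vl] := multiplier_exists fpos fcont dF dV Iy Iz (ltW lt) (dist_ge0 hd _ _) dlt.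
exists l => //; split => //; apply/eqP; rewrite eq_le tau_ge// ?Vl// andbT.
have := tau_le_dual l0 (cone_ll_le yz).
by rewrite /dual Vl subrr mulr0 addr0.
Qed.

Lemma tau_gt0 y z : (0 < tau y z)%E <-> ll y z.
Proof.
split=> [tpos|yz]; last first.
  have [l _ [_ ->]] := ll_multiplier yz; have [lt _] := (cone_llE y z).1 yz.
  by rewrite lte_fin (H_pos fpos dH)//; exact: tm_in.
have yz : le y z by apply: contrapT => /tau_not_le tau0; rewrite tau0 ltxx in tpos.
have [yzE|lt] := cone_le_tm yz.
  move: tpos; rewrite ltNge yzE => /negP[]; apply: le_trans (tau_le_dual (lexx 0) (cone_le_refl z)) _.
  by rewrite /dual !subrr mul0r addr0.
apply/cone_llE; split => //; rewrite lt_neqAle cone_le_dist// andbT; apply/eqP => dE'.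
have Iy := tm_in y; have Iz := tm_in z.
have [C C0 HC] := H_bound fpos fcont dH Iy Iz (ltW lt).
move: tpos; rewrite ltNge => /negP[]; apply/lee_addgt0Pr => e e0; rewrite add0e.
(* With this multiplier the increment of [H] is at most [e], while the other term of [dual] is
   nonpositive on the boundary of the future. *)
have l0 : 0 < C / e by rewrite divr_gt0.
apply: le_trans (tau_le_dual (ltW l0) yz) _; rewrite lee_fin /dual dE'.
have := HC _ l0; rewrite invf_div mulrCA divff ?gt_eqF// mulr1.
have : (C / e) * (V (C / e) (tm z) - V (C / e) (tm y) - (F (tm z) - F (tm y))) <= 0.
  apply: mulr_ge0_le0; first exact: ltW.
  by rewrite subr_le0; exact: (V_le_F fpos dF dV Iy Iz (ltW lt)).
lra.
Qed.

Lemma tau_not_ll y z : ~ ll y z -> tau y z = 0%E.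
Proof.
move=> nll; apply/eqP; rewrite eq_le tau_ge0 andbT leNgt; apply/negP => /tau_gt0; exact: nll.
Qed.

(** The multiplier of (x, z) bounds both summands. The increments of [H l] and [V l] add up, and the
    triangle inequality in [X] has the favourable sign. *)
Lemma tau_triangle x y z : le x y -> le y z -> (tau x y + tau y z <= tau x z)%E.
Proof.
move=> xy yz; have [xz|nxz] := pselect (ll x z); last first.
  rewrite !tau_not_ll ?adde0//; first by move=> h; apply: nxz; exact: cone_le_ll xy h.
  by move=> h; apply: nxz; exact: cone_ll_le_trans h yz.
have [l l0 [Vl ->]] := ll_multiplier xz.
apply: le_trans (leeD (tau_le_dual l0 xy) (tau_le_dual l0 yz)) _.
rewrite -EFinD lee_fin /dual.
have := dist_tri hd (ps y) (ps x) (ps z); rewrite -Vl => /(ler_wpM2l l0); lra.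
Qed.


(** * Continuity of the time separation *)

Lemma tm_dist y z : `|tm z - tm y| <= D y z.
Proof. by rewrite /cone_dist distrC lerDl dist_ge0. Qed.

Lemma ps_dist y z : d (ps y) (ps z) <= D y z.
Proof. by rewrite /cone_dist lerDr. Qed.

Lemma cone_metric : is_metric D.
Proof.
split; first by move=> y z; rewrite addr_ge0// dist_ge0.
split.
  move=> y z; split=> [D0|->]; last by rewrite /cone_dist subrr normr0 distxx// addr0.
  have := tm_dist y z; have := ps_dist y z; rewrite D0 => ps0 tm0.
  apply: cone_eq.
    by apply/esym/eqP; rewrite -subr_eq0 -normr_eq0 eq_le tm0 normr_ge0.
  by apply: (dist_eq0 hd); apply/eqP; rewrite eq_le ps0 dist_ge0.
split=> [y z|x y z]; first by rewrite /cone_dist distrC (dist_sym hd).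
rewrite /cone_dist addrACA; apply: lerD; last exact: dist_tri.
exact: ler_distD.
Qed.

(** Covers at once the time difference (k = 0), the causal defect (Phi = F, k = 1) and [dual l] (k =
    l). *)
Lemma increment_continuous (Phi phi : R -> R) (k : R) y z :
  (forall t, I t -> is_derive t 1 Phi (phi t)) -> forall e, 0 < e ->
  exists2 del, 0 < del & forall y' z', D y y' < del -> D z z' < del ->
    `|(Phi (tm z') - Phi (tm y') - k * d (ps y') (ps z')) -
      (Phi (tm z) - Phi (tm y) - k * d (ps y) (ps z))| < e.
Proof.
move=> dPhi e e0; have e4 : 0 < e / 4 by lra.
have [d1 d10 H1] := in_I_continuous dPhi (tm_in y) e4.
have [d2 d20 H2] := in_I_continuous dPhi (tm_in z) e4.
have k1 : 0 < `|k| + 1 by rewrite ltr_wpDl.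
pose d3 := e / 4 / (`|k| + 1); have d30 : 0 < d3 by rewrite divr_gt0.
exists (Order.min d1 (Order.min d2 d3)); first by rewrite !lt_min d10 d20.
move=> y' z'; rewrite !lt_min => /and3P[y1 _ y3] /and3P[_ z2 z3].
have h1 := H1 _ (le_lt_trans (tm_dist y y') y1).
have h2 := H2 _ (le_lt_trans (tm_dist z z') z2).
have h3 : `|k * (d (ps y') (ps z') - d (ps y) (ps z))| <= e / 4 + e / 4.
  have p1 := le_lt_trans (ps_dist y y') y3; have p2 := le_lt_trans (ps_dist z z') z3.
  have a1 := dist_tri hd (ps y) (ps y') (ps z'); have a2 := dist_tri hd (ps z) (ps y) (ps z').
  have a3 := dist_tri hd (ps y') (ps y) (ps z); have a4 := dist_tri hd (ps z') (ps y') (ps z).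
  rewrite (dist_sym hd (ps y') (ps y)) in a1; rewrite (dist_sym hd (ps z') (ps z)) in a4.
  have dd : `|d (ps y') (ps z') - d (ps y) (ps z)| <= d3 + d3.
    by rewrite ler_norml; apply/andP; split; lra.
  rewrite normrM; apply: le_trans (ler_wpM2l (normr_ge0 k) dd) _.
  have k3 : `|k| * d3 <= e / 4.
    by rewrite /d3 mulrCA ger_pMr// ler_pdivrMr// mul1r lerDl.
  by rewrite mulrDr; exact: lerD.
move: h1 h2 h3; rewrite !ltr_norml ler_norml => /andP[? ?] /andP[? ?] /andP[? ?].
by apply/andP; split; lra.
Qed.

Lemma increment_gt (Phi phi : R -> R) (k r : R) y z :
  (forall t, I t -> is_derive t 1 Phi (phi t)) ->
  r < Phi (tm z) - Phi (tm y) - k * d (ps y) (ps z) ->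
  exists2 del, 0 < del & forall y' z', D y y' < del -> D z z' < del ->
    r < Phi (tm z') - Phi (tm y') - k * d (ps y') (ps z').
Proof.
move=> dPhi lt; move: (lt); rewrite -subr_gt0 => e0.
have [del del0 Hdel] := increment_continuous k y z dPhi e0.
exists del => // y' z' yy zz; have := Hdel y' z' yy zz.
by rewrite ltr_norml => /andP[? ?]; lra.
Qed.

Let did t : I t -> is_derive t 1 (@id R) 1.
Proof. by move=> _; exact: is_derive_id. Qed.

Lemma ll_open y z : ll y z -> exists2 del, 0 < del &
  forall y' z', D y y' < del -> D z z' < del -> ll y' z'.
Proof.
move=> /cone_llE[lt dlt].
have [|d1 d10 H1] := @increment_gt id (fun=> 1) 0 0 y z did; first by rewrite mul0r subr0 subr_gt0.
have [|d2 d20 H2] := @increment_gt F (fun t => (f t)^-1) 1 0 y z dF; first by rewrite mul1r subr_gt0.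
exists (Order.min d1 d2); first by rewrite lt_min d10.
move=> y' z'; rewrite !lt_min => /andP[y1 y2] /andP[z1 z2]; apply/cone_llE.
have := H1 y' z' y1 z1; have := H2 y' z' y2 z2.
by rewrite mul0r mul1r subr0 !subr_gt0.
Qed.

Lemma tau_lower_semicontinuous y z (r : R) : (r%:E < tau y z)%E ->
  exists2 del, 0 < del & forall y' z', D y y' < del -> D z z' < del -> (r%:E < tau y' z')%E.
Proof.
have [r0 _|r0 lt] := ltP r 0.
  by exists 1 => // y' z' _ _; apply: lt_le_trans (tau_ge0 y' z'); rewrite lte_fin.
have yz : ll y z by apply/tau_gt0; apply: le_lt_trans lt; rewrite lee_fin.
have [tlt _] := (cone_llE y z).1 yz; have Iy := tm_in y; have Iz := tm_in z.
have [l l0 [Vl tauE]] := ll_multiplier yz; move: lt; rewrite tauE lte_fin => rH.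
have C0 : 0 < F (tm z) - F (tm y) by rewrite subr_gt0 (F_lt fpos dF).
(* Half of the slack above [r] pays for a multiplier m > l, for which the equality V l = d becomes a
   strict inequality, stable under perturbation. *)
pose e := (H l (tm z) - H l (tm y) - r) / 2; have e0 : 0 < e by rewrite /e; lra.
pose m := l + e / (F (tm z) - F (tm y)).
have lm : l < m by rewrite ltrDl divr_gt0.
have m0 : 0 <= m := le_trans l0 (ltW lm).
have Hm := H_lip fpos dF dH Iy Iz (ltW tlt) l0 (ltW lm).
have mE : (m - l) * (F (tm z) - F (tm y)) = e by rewrite /m addrC addKr divfK// gt_eqF.
rewrite mE in Hm.
have [|d1 d10 H1] := @increment_gt (H m) (fun t => lspeed (f t) m) 0 r y z (dH m).
  by rewrite mul0r subr0; move: Hm; rewrite /e; lra.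
have [|d2 d20 H2] := @increment_gt (V m) (fun t => vspeed (f t) m) 1 0 y z (dV m).
  by rewrite mul1r subr_gt0 -Vl; exact: (V_strict fpos dV Iy Iz tlt l0 lm).
have [d3 d30 H3] := ll_open yz.
exists (Order.min d1 (Order.min d2 d3)); first by rewrite !lt_min d10 d20.
move=> y' z'; rewrite !lt_min => /and3P[y1 y2 y3] /and3P[z1 z2 z3].
have [tlt' _] := (cone_llE y' z').1 (H3 y' z' y3 z3).
have := H1 y' z' y1 z1; have := H2 y' z' y2 z2; rewrite mul0r mul1r subr0 subr_gt0 => dV' dH'.
by apply: lt_le_trans (tau_ge m0 tlt' (ltW dV')); rewrite lte_fin.
Qed.

(** The upper bound is sharp up to [e] also where [tau] vanishes: l = 0 serves when [z] is earlier
    than [y], a large [l] when the fibre distance is too big for a timelike curve. *)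
Lemma dual_approx y z e : 0 < e -> exists2 l, 0 <= l & dual l y z < fine (tau y z) + e.
Proof.
move=> e0; have Iy := tm_in y; have Iz := tm_in z.
have t0 : 0 <= fine (tau y z) by rewrite fine_ge0// tau_ge0.
have [yz|nyz] := pselect (ll y z).
  have [l l0 [Vl tauE]] := ll_multiplier yz; exists l => //.
  by rewrite /dual tauE Vl subrr mulr0 addr0/= ltrDl.
have [lt|tyz] := ltP (tm z) (tm y).
  exists 0 => //; rewrite /dual mul0r addr0.
  by have := H_pos fpos dH 0 Iz Iy lt; lra.
have dF' : F (tm z) - F (tm y) <= d (ps y) (ps z).
  move: tyz; rewrite le_eqVlt => /orP[/eqP ->|tyz]; first by rewrite subrr dist_ge0.
  by rewrite leNgt; apply/negP => lt; apply: nyz; apply/cone_llE.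
have [C C0 HC] := H_bound fpos fcont dH Iy Iz tyz.
have l0 : 0 < 2 * C / e by rewrite divr_gt0// mulr_gt0.
exists (2 * C / e); first exact: ltW.
have := HC _ l0; have -> : C / (2 * C / e) = e / 2 by field; rewrite !gt_eqF.
have : 2 * C / e * (V (2 * C / e) (tm z) - V (2 * C / e) (tm y) - d (ps y) (ps z)) <= 0.
  apply: mulr_ge0_le0; first exact: ltW.
  by rewrite subr_le0; apply: le_trans dF'; exact: (V_le_F fpos dF dV Iy Iz tyz).
by rewrite /dual; lra.
Qed.

Lemma tau_continuous y z e : 0 < e ->
  exists2 del, 0 < del & forall y' z', D y y' < del -> D z z' < del ->
    `|fine (tau y' z') - fine (tau y z)| < e.
Proof.
move=> e0.
have [|d1 d10 H1] := @tau_lower_semicontinuous y z (fine (tau y z) - e).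
  by rewrite -[X in (_ < X)%E](fineK (tau_fin_num y z)) lte_fin; lra.
have [l l0 dl] := dual_approx y z e0.
have [d2 d20 H2] : exists2 del, 0 < del & forall y' z', D y y' < del -> D z z' < del ->
    dual l y' z' < fine (tau y z) + e.
  have e'0 : 0 < fine (tau y z) + e - dual l y z by lra.
  have [del del0 Hdel] := increment_continuous l y z (dE l) e'0.
  exists del => // y' z' yy zz; have := Hdel y' z' yy zz.
  by rewrite -!dualE ltr_norml => /andP[? ?]; lra.
exists (Order.min d1 d2); first by rewrite lt_min d10.
move=> y' z'; rewrite !lt_min => /andP[y1 y2] /andP[z1 z2].
have := H1 y' z' y1 z1; rewrite -[X in (_ < X)%E](fineK (tau_fin_num y' z')) lte_fin.
have := tau_le_max y' z' l0; rewrite -[X in (X <= _)%E](fineK (tau_fin_num y' z')) lee_fin.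
have := H2 y' z' y2 z2; have t0 : 0 <= fine (tau y z) by rewrite fine_ge0// tau_ge0.
move=> h1 h2 h3; rewrite ltr_norml; apply/andP; split; first by lra.
by move: h2; rewrite le_max => /orP[]; lra.
Qed.

Lemma cone_axioms_on (S : set Y) : LpLS_axioms_on D le ll tau S.
Proof.
split.
- split.
  + by move=> x _; exact: cone_le_refl.
  + by move=> x y z _ _ _; exact: cone_le_trans.
  + by move=> x y z _ _ _ xy yz; apply: cone_ll_le_trans xy _; exact: cone_ll_le.
  + by move=> x y _ _; exact: cone_ll_le.
- by move=> x y _ _; exact: tau_ge0.
- split.
  + move=> x y r _ _ /tau_lower_semicontinuous[del del0 Hdel].
    by exists del => // x' y' _ _; exact: Hdel.
  + by move=> x y z _ _ _; exact: tau_triangle.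
  + by move=> x y _ _; exact: tau_not_le.
  + by move=> x y _ _; exact: tau_gt0.
Qed.

(** * The Lorentzian length space axioms *)

Lemma fibre_graph y (B : R -> X) :
  exists g, (forall s, I s -> al g s = s) /\ (forall s, I s -> be g s = B s).
Proof.
exists (fun s => insubd y (s, B s)).
have gE s : I s -> val (insubd y (s, B s) : Y) = (s, B s) by move=> Is; exact: insubdK.
by split => s Is; rewrite /calpha /cbeta gE.
Qed.

Section GraphCurve.
Variables (g : R -> Y) (a b : R).
Hypotheses (Ia : I a) (Ib : I b) (ab : a < b).
Hypothesis alE : forall s, I s -> al g s = s.
Hypothesis lip : forall u v, a <= u -> u <= v -> v <= b -> d (be g u) (be g v) <= F v - F u.

Let Iab s : a <= s -> s <= b -> I s. Proof. exact: in_I_itv. Qed.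

Lemma graph_le u v : a <= u -> u <= v -> v <= b -> le (g u) (g v).
Proof.
move=> au; rewrite le_eqVlt => /predU1P[-> _|uv vb]; first exact: cone_le_refl.
have uE : tm (g u) = u by apply: alE; apply: Iab => //; lra.
have vE : tm (g v) = v by apply: alE; apply: Iab => //; lra.
apply/(cone_leP hd hlen hlc fpos fcont dF); right; exists (be g); split; rewrite ?uE ?vE//.
by move=> s s' us ss' s'v; apply: lip; lra.
Qed.

Lemma graph_loc_lipschitz : loc_lipschitz_on D a b g.
Proof.
have [M M0 HM] := in_I_lipschitz Ia Ib (fun s Is => inv_continuous (fcont Is) (fpos Is)) dF.
move=> t _; exists 1 => //; exists (1 + M) => s s' sI s'I _ _.
wlog ss' : s s' sI s'I / s <= s' => [W|].
  have [ss'|/ltW s's] := leP s s'; first exact: W.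
  by have [_ [_ [sym _]]] := cone_metric; rewrite sym distrC; exact: W.
have [as_ sb] := andP sI; have [as' sb'] := andP s'I.
rewrite cone_distE !alE ?Iab// mulrDl mul1r lerD2l.
rewrite distrC [X in _ * X]ger0_norm ?subr_ge0//.
apply: le_trans (lip as_ ss' sb') _; apply: le_trans (ler_norm _) _.
exact: HM.
Qed.

Lemma graph_nowhere_constant : nowhere_constant_on a b g.
Proof.
move=> s s' as_ ss' s'b; exists s, s'; rewrite !lexx !(ltW ss'); split => // gE.
have := alE (Iab as_ (ltW (lt_le_trans ss' s'b))); have := alE (Iab (ltW (le_lt_trans as_ ss')) s'b).
by rewrite /calpha gE => -> ssE; rewrite ssE ltxx in ss'.
Qed.

Lemma graph_causal_curve : causal_curve D le a b g.
Proof.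
split => //; [exact: graph_loc_lipschitz|exact: graph_nowhere_constant|].
by move=> t1 t2 at1 t12 t2b; apply: graph_le => //; exact: ltW.
Qed.

Lemma graph_timelike_curve :
  (forall u v, a <= u -> u < v -> v <= b -> d (be g u) (be g v) < F v - F u) ->
  timelike_curve D ll a b g.
Proof.
move=> lt; split => //; [exact: graph_loc_lipschitz|exact: graph_nowhere_constant|].
move=> t1 t2 at1 t12 t2b; apply/cone_llE.
have E1 : tm (g t1) = t1 by apply: alE; apply: Iab => //; lra.
have E2 : tm (g t2) = t2 by apply: alE; apply: Iab => //; lra.
by rewrite E1 E2; split => //; exact: lt.
Qed.

(** The fibre bound holds on every subinterval, so [tau_ge] applies to each step of a partition with
    the same [m], and the increments of [H m] telescope. *)
Lemma graph_tau_length_ge m : 0 <= m ->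
  (forall u v, a <= u -> u <= v -> v <= b -> d (be g u) (be g v) <= V m v - V m u) ->
  ((H m b - H m a)%:E <= tau_length tau a b g)%E.
Proof.
move=> m0 lipV; apply: le_ereal_inf_tmp => _ [s ps ->].
rewrite -(sum_steps_telescope (H m) ps) -sumEFin big_seq [leRHS]big_seq.
apply: lee_sum => p pin; have [h1 h2 h3] := steps_itv ps pin.
have E1 : tm (g p.1) = p.1 by apply: alE; apply: Iab => //; lra.
have E2 : tm (g p.2) = p.2 by apply: alE; apply: Iab => //; lra.
have := @tau_ge m (g p.1) (g p.2) m0; rewrite E1 E2; apply => //.
by apply: lipV => //; exact: ltW.
Qed.

End GraphCurve.

Lemma tau_length_ge0 a b g : (0 <= tau_length tau a b g)%E.
Proof.
apply: le_ereal_inf_tmp => _ [s _ ->]; apply: sume_ge0 => p _; exact: tau_ge0.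
Qed.

Lemma tau_length_le a b g : a < b -> (tau_length tau a b g <= tau (g a) (g b))%E.
Proof.
move=> ab; apply: ereal_inf_lbound; exists [:: b]; first by split => //=; rewrite ab.
by rewrite /steps/= big_cons big_nil adde0.
Qed.

Lemma cone_path_connected : causally_path_connected D le ll.
Proof.
move=> y z; have Iy := tm_in y; have Iz := tm_in z; split=> [yz|yz nyz].
  have [lt dlt] := (cone_llE y z).1 yz.
  have [c [l [lF hc]]] := broken_geodesic_exists hd hlen hlc dlt.
  have finv s : I s -> 0 < (f s)^-1 by move=> Is; rewrite invr_gt0 fpos.
  have [k [g [/andP[k0 k1] kl [_ _ gy gz] [alE [kw0 lip]] _]]] :=
    scaled_graph hd fpos lt dF (invf_continuous fpos fcont) finv (fun s _ => lexx _) hc (ltW lF).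
  have lipF u v : tm y <= u -> u <= v -> v <= tm z -> d (be g u) (be g v) <= F v - F u.
    move=> yu uv vz; apply: le_trans (lip u v yu uv vz) _; rewrite ler_piMl// subr_ge0.
    by apply: (F_le fpos dF) => //; apply: (in_I_itv Iy Iz); lra.
  exists (tm y), (tm z), g; split => //; apply: graph_timelike_curve => // u v yu uv vz.
  apply: le_lt_trans (lip u v yu (ltW uv) vz) _; rewrite gtr_pMl; first exact: kl.
  by rewrite subr_gt0; apply: (F_lt fpos dF) => //; apply: (in_I_itv Iy Iz); lra.
have /(cone_leP hd hlen hlc fpos fcont dF)[//|[B [lt By Bz lip]]] := yz.
have [g [alE beE]] := fibre_graph y B.
have lipF u v : tm y <= u -> u <= v -> v <= tm z -> d (be g u) (be g v) <= F v - F u.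
  by move=> yu uv vz; rewrite !beE; [exact: lip| |]; apply: (in_I_itv Iy Iz); lra.
exists (tm y), (tm z), g; split; first exact: graph_causal_curve.
- by apply: cone_eq; [exact: alE|rewrite -By; exact: beE].
- by apply: cone_eq; [exact: alE|rewrite -Bz; exact: beE].
Qed.

(** The trivial partition gives one inequality. For the other, graphs of a multiplier m > l have
    [tau_length] within [e] of [tau]; no maximal curve need exist globally. *)
Lemma tau_Tcal y z : tau y z = Tcal D le tau y z.
Proof.
rewrite /Tcal; case: pselect => [ex|nex]; last first.
  apply: tau_not_ll => yz; apply: nex.
  have [/(_ yz)[a [b [g [[ab lp nc cll] gy gz]]]] _] := cone_path_connected y z.
  exists a, b, g; split => //; split => // t1 t2 at1 t12 t2b.
  by apply: cone_ll_le; exact: cll.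
apply/eqP; rewrite eq_le; apply/andP; split; last first.
  apply: ge_ereal_sup => _ [a [b [g [[ab _ _ _] <- <- ->]]]].
  exact: tau_length_le.
have [yz|nyz] := pselect (ll y z); last first.
  rewrite tau_not_ll//; have [a [b [g [cg gy gz]]]] := ex.
  apply: le_trans (tau_length_ge0 a b g) _; apply: ereal_sup_ubound.
  by exists a, b, g.
have Iy := tm_in y; have Iz := tm_in z.
have [l l0 [Vl ->]] := ll_multiplier yz; have [lt dlt] := (cone_llE y z).1 yz.
apply/lee_addgt0Pr => e e0.
have C0 : 0 < F (tm z) - F (tm y) by rewrite subr_gt0 (F_lt fpos dF).
pose m := l + e / (F (tm z) - F (tm y)).
have lm : l < m by rewrite ltrDl divr_gt0.
have m0 : 0 < m := le_lt_trans l0 lm.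
have Hm := H_lip fpos dF dH Iy Iz (ltW lt) l0 (ltW lm).
have mE : (m - l) * (F (tm z) - F (tm y)) = e by rewrite /m addrC addKr divfK// gt_eqF.
have dVm : d (ps y) (ps z) < V m (tm z) - V m (tm y).
  by rewrite -Vl; exact: (V_strict fpos dV Iy Iz lt l0 lm).
have [c [l' [lV hc]]] := broken_geodesic_exists hd hlen hlc dVm.
have [g [[_ _ gy gz] alE lip _]] := multiplier_graph m0 lt hc (ltW lV).
have Iin s : tm y <= s -> s <= tm z -> I s by exact: in_I_itv.
have lipF u v : tm y <= u -> u <= v -> v <= tm z -> d (be g u) (be g v) <= F v - F u.
  move=> yu uv vz; apply: le_trans (lip u v yu uv vz) _.
  exact: (V_le_F fpos dF dV (Iin _ yu (le_trans uv vz)) (Iin _ (le_trans yu uv) vz) uv).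
apply: (@le_trans _ _ (tau_length tau (tm y) (tm z) g + e%:E)%E).
  have len := graph_tau_length_ge Iy Iz alE (ltW m0) lip.
  apply: (@le_trans _ _ ((H m (tm z) - H m (tm y))%:E + e%:E)%E); last by rewrite leeD2r.
  by rewrite -EFinD lee_fin; rewrite mE in Hm; lra.
rewrite leeD2r//; apply: ereal_sup_ubound; exists (tm y), (tm z), g; split => //.
exact: graph_causal_curve.
Qed.

(** In the limit only d <= F(t') - F(t) survives, and near [p] a geodesic turns this into a causal
    curve. The radius r / 2 keeps the closed neighbourhood where geodesics exist. *)
Lemma cone_locally_causally_closed : locally_causally_closed D le.
Proof.
move=> p; have [r r0 Hr] := local_geodesics hd hlen hlc (ps p).
have [Dge0 [D0 [Dsym Dtri]]] := cone_metric.
exists (dball D p (r / 2)).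
  exists (dball D p (r / 2)); last by split => //; rewrite /dball/= (D0 p p).2//; lra.
  move=> y yr; exists (r / 2 - D p y); first by move: yr; rewrite /dball/=; lra.
  by move=> z; rewrite /dball/= => yz; have := Dtri p y z; lra.
have near y : dclosure D (dball D p (r / 2)) y -> d (ps p) (ps y) <= r.
  move=> /(_ (r / 2) ltac:(lra))[z pz yz]; apply: le_trans (ps_dist p y) _.
  by have := Dtri p z y; rewrite (Dsym z y); move: pz; rewrite /dball/=; lra.
move=> xs ys x y _ _ /near px /near py cx cy xy.
have lim (Phi phi : R -> R) k : (forall t, I t -> is_derive t 1 Phi (phi t)) ->
    (forall n, Phi (tm (ys n)) - Phi (tm (xs n)) - k * d (ps (xs n)) (ps (ys n)) >= 0) ->
    Phi (tm y) - Phi (tm x) - k * d (ps x) (ps y) >= 0.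
  move=> dPhi Hn; rewrite leNgt; apply/negP => lt.
  have e0 : 0 < - (Phi (tm y) - Phi (tm x) - k * d (ps x) (ps y)) by rewrite oppr_gt0.
  have [del del0 Hdel] := increment_continuous k x y dPhi e0.
  have [N1 HN1] := cx del del0; have [N2 HN2] := cy del del0.
  have := Hdel (xs (maxn N1 N2)) (ys (maxn N1 N2)).
  rewrite Dsym HN1 ?leq_maxl// Dsym HN2 ?leq_maxr// => /(_ isT isT).
  by have := Hn (maxn N1 N2); rewrite ltr_norml => ? /andP[? ?]; lra.
have txy : tm x <= tm y.
  have := lim id (fun=> 1) 0 did; rewrite mul0r subr0 subr_ge0; apply => n.
  by rewrite mul0r subr0 subr_ge0; exact: cone_le_tmW.
have dxy : d (ps x) (ps y) <= F (tm y) - F (tm x).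
  have := lim F (fun t => (f t)^-1) 1 dF; rewrite mul1r subr_ge0; apply => n.
  by rewrite mul1r subr_ge0; exact: cone_le_dist.
move: txy; rewrite le_eqVlt => /orP[/eqP txy|lt].
  left; apply: cone_eq => //; apply: (dist_eq0 hd); apply/eqP.
  by rewrite eq_le dist_ge0// andbT; move: dxy; rewrite txy subrr.
have [c [c0 c1 iso]] := Hr _ _ px py.
have [g [fd _]] := broken_geodesic_graph hd fpos fcont dF lt (geodesic_broken hd c0 c1 iso) dxy.
by right; exists (tm x), (tm y), g.
Qed.

(** Used with [V l] for chronologically related points and with [F] for null related ones. *)
Lemma geodesic_graph y z (c : R -> X) (W : R -> R) : tm y < tm z ->
  c 0 = ps y -> c (d (ps y) (ps z)) = ps z ->
  (forall s s', 0 <= s -> s <= s' -> s' <= d (ps y) (ps z) -> d (c s) (c s') = s' - s) ->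
  W (tm z) - W (tm y) = d (ps y) (ps z) ->
  (forall u v, I u -> I v -> u <= v -> 0 <= W v - W u <= F v - F u) ->
  exists g, [/\ (forall s, I s -> al g s = s), g (tm y) = y, g (tm z) = z &
    forall u v, tm y <= u -> u <= v -> v <= tm z -> d (be g u) (be g v) <= W v - W u].
Proof.
move=> lt c0 c1 iso WE WF; have Iy := tm_in y; have Iz := tm_in z.
pose B s := c (W s - W (tm y)).
have Iin s : tm y <= s -> s <= tm z -> I s by exact: in_I_itv.
have lip u v : tm y <= u -> u <= v -> v <= tm z -> d (B u) (B v) <= W v - W u.
  move=> yu uv vz; have Iu : I u by apply: Iin; lra.
  have Iv : I v by apply: Iin; lra.
  have /andP[h1 _] := WF _ _ Iy Iu yu; have /andP[h2 _] := WF _ _ Iu Iv uv.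
  have /andP[h3 _] := WF _ _ Iv Iz vz; rewrite /B iso; lra.
have [g [alE beE]] := fibre_graph y B.
exists g; split => //.
- apply: cone_eq; first exact: alE.
  by rewrite -c0; have := beE _ Iy; rewrite /B subrr.
- apply: cone_eq; first exact: alE.
  by rewrite -c1; have := beE _ Iz; rewrite /B WE.
- by move=> u v yu uv vz; rewrite !beE; [exact: lip| |]; apply: Iin; lra.
Qed.

(* The geodesic is run through with the fibre speed of the multiplier of
   [(y, z)], or along a null curve when [z] is on the boundary of the future. *)
Lemma maximal_graph y z (c : R -> X) : le y z -> y <> z ->
  c 0 = ps y -> c (d (ps y) (ps z)) = ps z ->
  (forall s s', 0 <= s -> s <= s' -> s' <= d (ps y) (ps z) -> d (c s) (c s') = s' - s) ->
  exists a b g, [/\ causal_curve D le a b g, g a = y, g b = z,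
    (forall t, a <= t <= b -> le y (g t) /\ le (g t) z) & tau_length tau a b g = tau y z].
Proof.
move=> yz nyz c0 c1 iso; have Iy := tm_in y; have Iz := tm_in z.
have lt : tm y < tm z by case: (cone_le_tm yz).
suff [g [alE gy gz lip len]] : exists g, [/\ (forall s, I s -> al g s = s), g (tm y) = y, g (tm z) = z,
    (forall u v, tm y <= u -> u <= v -> v <= tm z -> d (be g u) (be g v) <= F v - F u) &
    (tau y z <= tau_length tau (tm y) (tm z) g)%E].
  exists (tm y), (tm z), g; split => //; first exact: graph_causal_curve.
    move=> t /andP[yt tz]; split.
      by rewrite -[X in le X _]gy; apply: (graph_le Iy Iz alE lip).
    by rewrite -[X in le _ X]gz; apply: (graph_le Iy Iz alE lip).
  apply/eqP; rewrite eq_le len andbT.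
  by have := tau_length_le g lt; rewrite gy gz.
have [yzll|nll] := pselect (ll y z); last first.
  have [||g [alE gy gz lip]] := geodesic_graph (W := F) lt c0 c1 iso.
  - apply/eqP; rewrite eq_le cone_le_dist// andbT leNgt; apply/negP => dlt.
    by apply: nll; apply/cone_llE.
  - by move=> u v Iu Iv uv; rewrite lexx subr_ge0 (F_le fpos dF).
  - by exists g; split => //; rewrite tau_not_ll// tau_length_ge0.
have [l l0 [Vl tauE]] := ll_multiplier yzll.
have VF u v : I u -> I v -> u <= v -> 0 <= V l v - V l u <= F v - F u.
  move=> Iu Iv uv; rewrite (V_le_F fpos dF dV)// andbT.
  have Iuv s : u <= s <= v -> I s by move=> /andP[]; exact: in_I_itv.
  have := derivative_le uv (fun s _ => is_derive_cst 0 s 1) (fun s h => dV l (Iuv s h)).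
  by rewrite subrr; apply => s h; exact: vspeed_ge0 (fpos (Iuv s h)) l0.
have [g [alE gy gz lip]] := geodesic_graph lt c0 c1 iso Vl VF.
exists g; split => //; last by rewrite tauE; exact: graph_tau_length_ge.
move=> u v yu uv vz; apply: le_trans (lip u v yu uv vz) _.
by have /andP[] := VF u v (in_I_itv Iy Iz yu (le_trans uv vz)) (in_I_itv Iy Iz (le_trans yu uv) vz) uv.
Qed.

(** * Small diamonds, localizability and strong causality *)

Definition shift_tm y e (Ie : I (tm y + e)) : Y := exist _ (tm y + e, ps y) Ie.

Lemma shift_near y : exists2 e0, 0 < e0 & forall e, `|e| < e0 -> I (tm y + e).
Proof.
have [e0 e00 He] := in_I_open (tm_in y).
by exists e0 => // e ee; apply: He; rewrite addrC addKr.
Qed.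

Lemma shift_ll y e e' (Ie : I (tm y + e)) (Ie' : I (tm y + e')) : e < e' ->
  ll (shift_tm Ie) (shift_tm Ie').
Proof.
move=> ee; apply/cone_llE => /=; rewrite ltrD2l; split => //.
by rewrite distxx// subr_gt0; apply: (F_lt fpos dF) => //; rewrite ltrD2l.
Qed.

Lemma shift_dist y e (Ie : I (tm y + e)) : D y (shift_tm Ie) = `|e|.
Proof. by rewrite /cone_dist/= distxx// addr0 opprD addrA subrr sub0r normrN. Qed.

Lemma shift0 y (I0 : I (tm y + 0)) : shift_tm I0 = y.
Proof. by apply: cone_eq => /=; rewrite ?addr0. Qed.

Lemma small_diamond p r : 0 < r -> exists pm pp, [/\ ll pm p, ll p pp,
  (forall y, ll pm y -> ll y pp -> D p y < r) &
  (forall y, ll pm y -> ll y pp -> tm pm < tm y < tm pp)].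
Proof.
move=> r0; have r20 : 0 < r / 2 by lra.
have [e1 e10 He1] := shift_near p.
have [e2 e20 He2] := in_I_continuous dF (tm_in p) r20.
(* Below [e1] the vertices stay in the cone, below [e2] they change [F] by less than r / 2, and e <=
   r / 2 controls the time part of [D]. *)
pose e := Order.min (Order.min e1 e2) r / 2.
have e0 : 0 < e by rewrite divr_gt0// !lt_min e10 e20.
have [ee1 ee2 er] : [/\ e < e1, e < e2 & e <= r / 2].
  have m0 : 0 < Order.min (Order.min e1 e2) r by rewrite !lt_min e10 e20.
  have m1 : Order.min (Order.min e1 e2) r <= e1 by rewrite !ge_min lexx.
  have m2 : Order.min (Order.min e1 e2) r <= e2 by rewrite !ge_min lexx orbT.
  have m3 : Order.min (Order.min e1 e2) r <= r by rewrite ge_min lexx orbT.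
  by rewrite /e; split; lra.
have Ip : I (tm p + e) by apply: He1; rewrite gtr0_norm.
have Im : I (tm p + - e) by apply: He1; rewrite normrN gtr0_norm.
have I0 : I (tm p + 0) by apply: He1; rewrite normr0.
exists (shift_tm Im), (shift_tm Ip); split.
- by rewrite -[X in ll _ X](shift0 I0); apply: shift_ll; rewrite oppr_lt0.
- by rewrite -[X in ll X _](shift0 I0); exact: shift_ll.
- move=> y /cone_llE/=[h1 h2] /cone_llE/=[h3 h4].
  have := He2 (tm p + e); rewrite [tm p + e - _]addrAC subrr add0r gtr0_norm// => /(_ ee2).
  have := He2 (tm p + - e); rewrite [tm p + - e - _]addrAC subrr add0r normrN gtr0_norm// => /(_ ee2).
  rewrite !ltr_norml => /andP[h5 h6] /andP[h7 h8].
  have ty : `|tm p - tm y| < r / 2 by rewrite ltr_norml; apply/andP; split; lra.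
  rewrite (dist_sym hd) in h4.
  have py : d (ps p) (ps y) <= r / 2.
    (* Both vertices lie over [ps p]: for [y] not later than [p] the past vertex bounds the fibre
       distance, otherwise the future one. *)
    have Iy := tm_in y; have Itp := tm_in p; have [yp|py] := leP (tm y) (tm p).
      by have := F_le fpos dF Iy Itp yp; lra.
    by have := F_le fpos dF Itp Iy (ltW py); lra.
  by rewrite /cone_dist; lra.
- by move=> y /cone_llE/=[h1 _] /cone_llE/=[h3 _]; rewrite h1.
Qed.

Lemma diamond_open pm pp : dopen D [set y | ll pm y /\ ll y pp].
Proof.
have Dxx y : D y y = 0 by rewrite /cone_dist subrr normr0 distxx// addr0.
move=> y [my yp]; have [d1 d10 H1] := ll_open my; have [d2 d20 H2] := ll_open yp.
exists (Order.min d1 d2); first by rewrite lt_min d10.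
move=> z; rewrite /dball/= lt_min => /andP[z1 z2].
by split; [apply: H1|apply: H2]; rewrite ?Dxx.
Qed.

Lemma cone_localizable : localizable D le ll tau.
Proof.
move=> p; have [r r0 Hr] := local_geodesics hd hlen hlc (ps p).
have [pm [pp [pmp ppp small tmO]]] := small_diamond p r0.
pose O := [set y | ll pm y /\ ll y pp].
have oO : dopen D O by exact: diamond_open.
have tauE : (fun x y => (fine (tau x y))%:E) = tau.
  by apply/funext => x; apply/funext => y; rewrite fineK// tau_fin_num.
exists O; split => //.
  (* Between causally related points [D] is at most the increment of t + F t, which telescopes along
     any partition. *)
  exists (tm pp + F (tm pp) - (tm pm + F (tm pm))) => a b g [ab _ _ cg] gO.
  apply: ge_ereal_sup => _ [s ps ->]; rewrite lee_fin.
  apply: (@le_trans _ _ (tm (g b) + F (tm (g b)) - (tm (g a) + F (tm (g a))))).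
    rewrite -(sum_steps_telescope (fun t => tm (g t) + F (tm (g t))) ps).
    rewrite big_seq [leRHS]big_seq; apply: ler_sum => q qin.
    have [h1 h2 h3] := steps_itv ps qin; have leq := cg _ _ h1 h2 h3.
    have t12 := cone_le_tmW leq; have d12 := cone_le_dist leq.
    by rewrite /cone_dist distrC ger0_norm ?subr_ge0//; lra.
  have [ma ap] : O (g a) by apply: gO; rewrite lexx ltW.
  have [mb bp] : O (g b) by apply: gO; rewrite lexx ltW.
  have /andP[a1 a2] := tmO _ ma ap; have /andP[b1 b2] := tmO _ mb bp.
  have := F_lt fpos dF (tm_in pm) (tm_in (g a)) a1.
  by have := F_lt fpos dF (tm_in (g b)) (tm_in pp) b2; lra.
(* Since [tau] is finite and continuous, it serves as its own local version. *)
exists (fun x y => fine (tau x y)); split.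
- by move=> x y _ _; rewrite fine_ge0// tau_ge0.
- move=> x y _ _ e e0; have [del del0 Hdel] := tau_continuous x y e0.
  by exists del => // x' y' _ _; exact: Hdel.
- by rewrite tauE; exact: cone_axioms_on.
- move=> y yO; have [del del0 Hdel] := oO y yO; have [e1 e10 He1] := shift_near y.
  pose e := Order.min del e1 / 2.
  have [e0 ed ee] : [/\ 0 < e, e < del & e < e1].
    have m0 : 0 < Order.min del e1 by rewrite lt_min del0.
    have m1 : Order.min del e1 <= del by rewrite ge_min lexx.
    have m2 : Order.min del e1 <= e1 by rewrite ge_min lexx orbT.
    by rewrite /e; split; lra.
  have Ip : I (tm y + e) by apply: He1; rewrite gtr0_norm.
  have Im : I (tm y + - e) by apply: He1; rewrite normrN gtr0_norm.
  have I0 : I (tm y + 0) by apply: He1; rewrite normr0.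
  split; [exists (shift_tm Ip)|exists (shift_tm Im)]; split.
  + by apply: Hdel; rewrite /dball/= shift_dist gtr0_norm.
  + by rewrite -[X in ll X _](shift0 I0); exact: shift_ll.
  + by apply: Hdel; rewrite /dball/= shift_dist normrN gtr0_norm.
  + by rewrite -[X in ll _ X](shift0 I0); apply: shift_ll; rewrite oppr_lt0.
- move=> x y [mx xp] [my yp] xy nxy.
  have near z : ll pm z -> ll z pp -> d (ps p) (ps z) <= r.
    by move=> mz zp; apply: le_trans (ps_dist p z) (ltW (small z mz zp)).
  have [c [c0 c1 iso]] := Hr _ _ (near x mx xp) (near y my yp).
  have [a [b [g [cg gx gy between len]]]] := maximal_graph xy nxy c0 c1 iso.
  exists a, b, g; split => //.
    (* The curve runs between [x] and [y] causally, so the push-up property keeps it in the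
       diamond. *)
    move=> t /between[xg gy']; split; first exact: cone_ll_le_trans mx xg.
    exact: cone_le_ll gy' yp.
  split; rewrite ?len ?fineK ?tau_fin_num//.
  move=> a' b' g' [ab' _ _ _] <- <- _; exact: tau_length_le.
Qed.

Lemma cone_strongly_causal : strongly_causal D ll.
Proof.
move=> U; split=> [oU x Ux|aU x Ux].
  have [r r0 rU] := oU x Ux; have [pm [pp [mx xp small _]]] := small_diamond x r0.
  exists [:: (pm, pp)]; split=> [pq [<-|//]|z Hz]; first by split.
  by apply: rU; have [|mz zp] := Hz (pm, pp); [left|exact: small].
have [s [sx sU]] := aU x Ux.
suff [del del0 Hdel] : exists2 del, 0 < del & forall z, D x z < del ->
    forall pq, Stdlib.Lists.List.In pq s -> (Ifut ll pq.1 `&` Ipast ll pq.2) z.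
  by exists del => // z xz; apply: sU; exact: Hdel.
elim: s sx {sU} => [|[p q] s IH] sx; first by exists 1.
have [|d1 d10 H1] := IH; first by move=> pq pqs; apply: sx; right.
have [px xq] := sx (p, q) (or_introl erefl).
have [d2 d20 H2] := @diamond_open p q x (conj px xq).
exists (Order.min d1 d2); first by rewrite lt_min d10.
move=> z; rewrite lt_min => /andP[z1 z2] pq [<-|pqs]; last exact: H1.
exact: H2.
Qed.

Lemma cone_LLS : is_LLS D le ll tau.
Proof.
split.
- by split; [exact: cone_metric|exact: cone_axioms_on].
- exact: cone_path_connected.
- exact: cone_locally_causally_closed.
- exact: cone_localizable.
- exact: tau_Tcal.
Qed.

End TimeSeparation.

Theorem theorem4p8 (R : realType) (X : Type) (d : X -> X -> R)
    (a0 b0 : \bar R) (f : R -> R) :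
  is_metric d -> dlocally_compact d -> length_space d ->
  (forall t : R, in_I a0 b0 t -> 0 < f t) ->
  {within [set t : R | in_I a0 b0 t], continuous f} ->
  is_LLS (cone_dist d a0 b0) (cone_le d a0 b0 f) (cone_ll d a0 b0 f)
         (cone_tau d a0 b0 f) /\
  strongly_causal (cone_dist d a0 b0) (cone_ll d a0 b0 f).
Proof.
move=> hd hlc hlen fpos /within_in_I_continuous fcont.
have [P HP] := @exists_primitive R a0 b0.
have dF := HP _ (fun t It => inv_continuous (fcont t It) (fpos t It)).
have dV l := HP _ (fun t It => @vspeed_continuous R f t l (fcont t It) (fpos t It)).
have dH l := HP _ (fun t It => @lspeed_continuous R f t l (fcont t It) (fpos t It)).
split; first exact: (cone_LLS hd hlen hlc fpos fcont dF dV dH).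
exact: (cone_strongly_causal hd hlen hlc fpos fcont dF).
Qed.
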